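(* Let $f \in \mathcal{S}_{\mathcal{AP}}^{*}$ and let $\Gamma_1,\Gamma_2$ be the first two inverse logarithmic coefficients of $f$. Then $$-\frac{3\sqrt{3}}{2\sqrt{41}} \le |\Gamma_2|-|\Gamma_1| \le \frac{3}{8}.$$ The inequalities are sharp, i.e. each of the two bounds is attained by some function in $\mathcal{S}_{\mathcal{AP}}^{*}$.
   Context: Let $\mathbb{D}=\{z\in\mathbb{C}:|z|<1\}$, and let $\mathcal{A}$ be the class of analytic functions $f$ on $\mathbb{D}$ normalized by $f(0)=0$, $f'(0)=1$, written $f(z)=z+\sum_{n=2}^{\infty}a_nz^n$. For analytic $f,g$ on $\mathbb{D}$, $f\prec g$ (subordination) means that there is an analytic function $\omega$ on $\mathbb{D}$ with $\omega(0)=0$ and $|\omega(z)|<1$ (a Schwarz function) such that $f(z)=g(\omega(z))$ for $z\in\mathbb{D}$. The class $\mathcal{S}_{\mathcal{AP}}^{*}$ consists of all $f\in\mathcal{A}$ with $$\frac{zf'(z)}{f(z)}\prec\psi_{\mathcal{AP}}(z):=e^{z}\sqrt{1+z},\quad z\in\mathbb{D},$$ where the square root is the principal branch (value $1$ at $z=0$). It is a subclass of the univalent functions. The inverse logarithmic coefficients $\Gamma_n$ of $f$ are defined by $$\log\frac{f^{-1}(w)}{w}=2\sum_{n=1}^{\infty}\Gamma_n w^n,\qquad |w|<\tfrac14,$$ where the logarithm vanishes at $w=0$; explicitly, $\Gamma_1=-\frac12a_2$ and $\Gamma_2=-\frac12a_3+\frac34a_2^2$. *)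

(* Defs.v *)
From Stdlib Require Import Reals Lra.
From Coquelicot Require Import Coquelicot.
Open Scope R_scope.

(** Functions on a disc are represented by total functions [C -> C]; their
    values outside the disc are irrelevant. *)

Definition disc (r : R) (z : C) : Prop := Cmod z < r.

(** Analytic = complex differentiable at every point of the (open) set [D]. *)
Definition analytic_on (D : C -> Prop) (f : C -> C) : Prop :=
  forall z : C, D z -> ex_derive (K := C_AbsRing) (V := C_NormedModule) f z.

Definition Cexp (z : C) : C :=
  (exp (Re z) * cos (Im z), exp (Re z) * sin (Im z)).

(** Principal square root (nonnegative real part); the value on the cut, the
    negative real axis, is taken on the positive imaginary axis. *)
Definition Csqrt (z : C) : C :=
  (sqrt ((Cmod z + Re z) / 2),
   (if Rle_dec 0 (Im z) then 1 else -1) * sqrt ((Cmod z - Re z) / 2)).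

Lemma Csqrt_sqr (z : C) : (Csqrt z * Csqrt z)%C = z.
Proof.
  pose proof (proj1 (Rabs_le_between _ _) (re_le_Cmod z)) as H.
  assert (H1 : 0 <= (Cmod z + Re z) / 2) by lra.
  assert (H2 : 0 <= (Cmod z - Re z) / 2) by lra.
  assert (Hs : sqrt ((Cmod z + Re z) / 2) * sqrt ((Cmod z - Re z) / 2)
               = Rabs (Im z) / 2).
  { rewrite <- sqrt_mult by assumption.
    replace ((Cmod z + Re z) / 2 * ((Cmod z - Re z) / 2))
      with (Rsqr (Im z / 2)).
    - rewrite sqrt_Rsqr_abs; unfold Rdiv; rewrite Rabs_mult.
      now rewrite (Rabs_pos_eq (/ 2)) by lra.
    - pose proof (Cmod2_alt z) as E; unfold Rsqr; lra. }
  pose proof (sqrt_sqrt _ H1) as E1; pose proof (sqrt_sqrt _ H2) as E2.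
  unfold Csqrt.
  set (u := sqrt ((Cmod z + Re z) / 2)) in *.
  set (v := sqrt ((Cmod z - Re z) / 2)) in *.
  apply injective_projections; unfold Cmult; cbn [fst snd];
    [change (fst z) with (Re z) | change (snd z) with (Im z)];
    revert Hs; unfold Rabs; destruct (Rle_dec 0 (Im z)), (Rcase_abs (Im z));
    intro Hs; lra.
Qed.

Lemma Csqrt_Re_ge_0 (z : C) : 0 <= Re (Csqrt z).
Proof. apply sqrt_pos. Qed.

Definition psi_AP (z : C) : C := (Cexp z * Csqrt (1 + z))%C.

Definition schwarz_function (w : C -> C) : Prop :=
  analytic_on (disc 1) w /\ w 0 = 0 /\
  (forall z : C, disc 1 z -> Cmod (w z) < 1).

Definition subordinate (F G : C -> C) : Prop :=
  exists w : C -> C, schwarz_function w /\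
    forall z : C, disc 1 z -> F z = G (w z).

Definition class_A (f : C -> C) : Prop :=
  analytic_on (disc 1) f /\ f 0 = 0 /\ C_derive f 0 = 1.

(** [z f'(z) / f(z)], with its removable singularity at [0] filled by the value
    [1].  Division by zero gives [0] in Coquelicot, so where [f] vanishes at
    some [z <> 0] this function is [0]; as [psi_AP] has no zero in the unit
    disc, subordination to [psi_AP] rules such [z] out. *)
Definition starlike_quotient (f : C -> C) (z : C) : C :=
  if Ceq_dec z 0 then 1 else (z * C_derive f z / f z)%C.

Definition class_S_AP (f : C -> C) : Prop :=
  class_A f /\ subordinate (starlike_quotient f) psi_AP.

(** [g] is the inverse of the univalent function [f] on the disc of radius 1/4:
    when [f] is injective on the unit disc these conditions determine [g]. *)
Definition is_inverse_quarter (f g : C -> C) : Prop :=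
  forall w : C, disc (1/4) w -> disc 1 (g w) /\ f (g w) = w.

(** [L] is the branch of [log (g w / w)] that vanishes at [0]; at [w = 0] the
    quotient has a removable singularity. *)
Definition is_log_quotient (g L : C -> C) : Prop :=
  analytic_on (disc (1/4)) L /\ L 0 = 0 /\
  (forall w : C, disc (1/4) w -> w <> 0 -> Cexp (L w) = (g w / w)%C).

(** The value [Gamma 0] is irrelevant. *)
Definition inverse_log_coeffs (f : C -> C) (Gamma : nat -> C) : Prop :=
  exists g L : C -> C,
    is_inverse_quarter f g /\ is_log_quotient g L /\
    forall w : C, disc (1/4) w ->
      is_series (K := C_AbsRing) (V := C_NormedModule)
        (fun k : nat => (2 * (Gamma (S k) * w ^ S k))%C) (L w).

(* Main.v *)
(** If [w = f (z)] and [L] is the logarithm of [g w / w], then logarithmic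
    differentiation of [f (g w) = w] gives
      [psi_AP (om (g w)) * (1 + w * L' w) = 1].
    Comparing second-order expansions at [0], with [om z = c1 z + c2 z^2 + O(z^3)],
      [Gamma 1 = - 3/4 c1] and [Gamma 2 = 29/32 c1^2 - 3/8 c2],
    and the bounds follow from the Schwarz-Pick inequality [|c2| <= 1 - |c1|^2].
    Equality forces [om z = z^2] for the upper bound and
    [om z = z (z + x) / (1 + x z)] with [x^2 = 12/41] for the lower one.  For
    these [om], put [f z = z exp (h z)] with [h' z = (psi_AP (om z) - 1) / z]; on
    the disc of radius 1/4 the inverse of [f] is the fixed point of the
    contraction [z |-> w exp (- h z)] of the closed disc of radius 1/2. *)

From Stdlib Require Import Reals Lra Lia Psatz ClassicalEpsilon.
From Coquelicot Require Import Coquelicot.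
(* Imported last: both Stdlib and Coquelicot export another [disc]. *)
Require Import Defs.
Open Scope R_scope.

(** * Derivatives in the complex plane *)

(** The definitions grant complex differentiability only, whereas the comparison needs expansions
    with cubic error of [om], [L], [Cexp] and [Csqrt] at [0]. They come from Cauchy theory on discs
    centred at [0], developed with integrals along segments and circles. Its pivot is a primitive
    for functions continuous on the disc and differentiable off one point: applied to difference
    quotients it yields Cauchy's formula, and later the function [h] of the construction. The
    differential equation determines [L'] only away from [0], so the expansion of [L] is recovered
    through a mean value inequality. The number 12/41 solves 29/32 x^2 = 3/8 (1 - x^2), the case in
    which [Gamma 2] vanishes. Sharpness is delicate because [inverse_log_coeffs] asks for an inverse
    on the whole disc of radius 1/4: the contraction argument wants |exp (- h)| <= 2 and |h'| < 2 on
    the closed disc of radius 1/2. The bound obtained for |h'| is 1.958, hence the second-order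
    estimate of [psi_AP] and the particular rational constants. *)

Definition cderiv (f : C -> C) (z l : C) : Prop :=
  @is_derive C_AbsRing C_NormedModule f z l.
(** Here [C] is a module over the reals, as suits curves and integrals with a real parameter. It
    meets the complex structure through the epsilon forms of the two derivatives. *)
Definition rderiv (f : R -> C) (t : R) (l : C) : Prop :=
  @is_derive R_AbsRing C_R_NormedModule f t l.

Definition ccont (f : C -> C) (z : C) : Prop :=
  forall e, 0 < e -> exists d, 0 < d /\
    forall u, Cmod (u - z) < d -> Cmod (f u - f z) < e.

Definition rcont (f : R -> C) (t : R) : Prop :=
  forall e, 0 < e -> exists d, 0 < d /\
    forall u, Rabs (u - t) < d -> Cmod (f u - f t) < e.

Lemma Cmod_minus_sym (a b : C) : Cmod (a - b) = Cmod (b - a).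
Proof. rewrite <- Cmod_opp. f_equal. ring. Qed.

Lemma Cmod_sub_ge (a b : C) : Cmod a - Cmod b <= Cmod (a - b).
Proof.
  pose proof (Cmod_triangle (a - b) b) as H.
  replace (a - b + b)%C with a in H by ring. lra.
Qed.

Lemma Cmod_sub_le (a b : C) : Cmod (a - b) <= Cmod a + Cmod b.
Proof. unfold Cminus. rewrite <- (Cmod_opp b). apply Cmod_triangle. Qed.

(** Passage between the filter formulation, which supplies the algebraic rules, and inequalities for
    [Cmod], in which the estimates are made. *)
Lemma cderiv_eps (f : C -> C) (z l : C) :
  cderiv f z l <->
  forall e, 0 < e -> exists d, 0 < d /\
    forall u, Cmod (u - z) < d ->
      Cmod (f u - f z - l * (u - z)) <= e * Cmod (u - z).
Proof.
  split.
  - intros [_ H] e He.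
    destruct (H z (fun P HP => HP) (mkposreal e He)) as [d Hd].
    exists d. split. { apply cond_pos. }
    intros u Hu.
    replace (f u - f z - l * (u - z))%C with (minus (minus (f u) (f z)) (scal (minus u z) l) : C).
    + apply (Hd u). exact Hu.
    + unfold minus, plus, opp, scal; simpl. unfold mult; simpl. ring.
  - intros H. split. { apply is_linear_scal_l. }
    intros x Hx e.
    apply (is_filter_lim_locally_unique (V := AbsRing_NormedModule C_AbsRing)) in Hx. subst x.
    destruct (H e (cond_pos e)) as [d [Hd H']].
    exists (mkposreal d Hd). intros u Hu.
    specialize (H' u Hu).
    replace (f u - f z - l * (u - z))%C with (minus (minus (f u) (f z)) (scal (minus u z) l) : C) in H'.
    + exact H'.
    + unfold minus, plus, opp, scal; simpl. unfold mult; simpl. ring.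
Qed.

Lemma cderiv_ccont f z l : cderiv f z l -> ccont f z.
Proof.
  intros H e He. rewrite cderiv_eps in H.
  destruct (H 1 Rlt_0_1) as [d [Hd H1]].
  pose proof (Cmod_ge_0 l) as Hl.
  assert (0 < e / (Cmod l + 2)) by (apply Rdiv_lt_0_compat; lra).
  exists (Rmin d (e / (Cmod l + 2))). split. { apply Rmin_pos; lra. }
  intros u Hu.
  specialize (H1 u (Rlt_le_trans _ _ _ Hu (Rmin_l _ _))).
  pose proof (Rlt_le_trans _ _ _ Hu (Rmin_r _ _)) as H2.
  pose proof (Cmod_triangle (f u - f z - l * (u - z)) (l * (u - z))) as H3.
  replace (f u - f z - l * (u - z) + l * (u - z))%C with (f u - f z)%C in H3 by ring.
  rewrite Cmod_mult in H3.
  apply (Rmult_lt_compat_r (Cmod l + 2)) in H2; [|lra].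
  unfold Rdiv in H2. rewrite Rmult_assoc, Rinv_l, Rmult_1_r in H2 by lra.
  pose proof (Cmod_ge_0 (u - z)). nra.
Qed.

Lemma cderiv_plus f g z a b :
  cderiv f z a -> cderiv g z b -> cderiv (fun u => (f u + g u)%C) z (a + b)%C.
Proof. exact (is_derive_plus f g z a b). Qed.

Lemma cderiv_minus f g z a b :
  cderiv f z a -> cderiv g z b -> cderiv (fun u => (f u - g u)%C) z (a - b)%C.
Proof. exact (is_derive_minus f g z a b). Qed.

Lemma cderiv_opp f z a :
  cderiv f z a -> cderiv (fun u => (- f u)%C) z (- a)%C.
Proof. exact (is_derive_opp f z a). Qed.

(** The rules for products and compositions live on the module structure that a ring has over
    itself. The linearity part is proved anew, and the estimate carries over by conversion. *)
Lemma cderiv_absring (f : C -> C) z l :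
  cderiv f z l <-> @is_derive C_AbsRing (AbsRing_NormedModule C_AbsRing) f z l.
Proof.
  split; intros [_ H]; (split; [apply is_linear_scal_l | exact H]).
Qed.

Lemma cderiv_mult f g z a b :
  cderiv f z a -> cderiv g z b ->
  cderiv (fun u => (f u * g u)%C) z (a * g z + f z * b)%C.
Proof.
  rewrite !cderiv_absring. intros Hf Hg.
  exact (is_derive_mult f g z a b Hf Hg Cmult_comm).
Qed.

Lemma cderiv_comp f g z a b :
  cderiv f (g z) a -> cderiv g z b -> cderiv (fun u => f (g u)) z (a * b)%C.
Proof.
  intros Hf Hg. rewrite cderiv_absring in Hg. rewrite Cmult_comm.
  exact (is_derive_comp f g z a b Hf Hg).
Qed.

Lemma cderiv_id z : cderiv (fun u => u) z 1.
Proof. rewrite cderiv_absring. exact (is_derive_id z). Qed.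

Lemma cderiv_const c z : cderiv (fun _ => c) z 0.
Proof. exact (is_derive_const (V := C_NormedModule) c z). Qed.

Lemma cderiv_eq f z a b : cderiv f z a -> a = b -> cderiv f z b.
Proof. now intros H <-. Qed.

Lemma cderiv_ext_loc f g z l d :
  0 < d -> (forall u, Cmod (u - z) < d -> f u = g u) -> cderiv f z l -> cderiv g z l.
Proof.
  intros Hd He H. rewrite cderiv_eps in *. intros e H0.
  destruct (H e H0) as [d' [Hd' H']].
  exists (Rmin d d'). split. { now apply Rmin_pos. }
  intros u Hu.
  rewrite <- (He u), <- (He z).
  - apply H'. eapply Rlt_le_trans; [apply Hu | apply Rmin_r].
  - replace (z - z)%C with (RtoC 0) by ring. now rewrite Cmod_0.
  - eapply Rlt_le_trans; [apply Hu | apply Rmin_l].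
Qed.

(** With increments [h = u - w] and [k = g u - g w], differentiability of [f] at [g w] first gives
    |k| |a| / 2 <= |h|. This turns an error that is small relative to [k] into one that is small
    relative to [h]. *)
Lemma cderiv_inverse f g w a d :
  0 < d -> (forall u, Cmod (u - w) < d -> f (g u) = u) ->
  ccont g w -> cderiv f (g w) a -> a <> 0 -> cderiv g w (/ a)%C.
Proof.
  intros Hd0 Hfg Hg Hf Ha.
  rewrite cderiv_eps in *. intros e He.
  pose proof (proj1 (Cmod_gt_0 a) Ha) as Hap.
  set (A := Cmod a) in *.
  set (e1 := Rmin (A / 2) (e * A * A / 2)).
  assert (He1 : 0 < e1).
  { apply Rmin_pos; [lra|]. assert (0 < e * A * A) by (repeat apply Rmult_lt_0_compat; lra). lra. }
  destruct (Hf e1 He1) as [d1 [Hd1 H1]].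
  destruct (Hg d1 Hd1) as [d2 [Hd2 H2]].
  exists (Rmin d d2). split. { now apply Rmin_pos. }
  intros u Hu.
  assert (Hu0 : Cmod (u - w) < d) by (eapply Rlt_le_trans; [apply Hu | apply Rmin_l]).
  assert (Hu2 : Cmod (u - w) < d2) by (eapply Rlt_le_trans; [apply Hu | apply Rmin_r]).
  specialize (H1 (g u) (H2 u Hu2)).
  rewrite (Hfg u Hu0) in H1.
  rewrite (Hfg w) in H1 by (replace (w - w)%C with (RtoC 0) by ring; now rewrite Cmod_0).
  set (k := (g u - g w)%C) in *. set (h := (u - w)%C) in *.
  assert (E1 : e1 <= A / 2) by apply Rmin_l.
  assert (E2 : e1 <= e * A * A / 2) by apply Rmin_r.
  pose proof (Cmod_ge_0 k) as Hk. pose proof (Cmod_ge_0 h) as Hh.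
  pose proof (Cmod_sub_ge (a * k) h) as H3. rewrite Cmod_mult in H3. fold A in H3.
  rewrite Cmod_minus_sym in H3.
  assert (Hkh : Cmod k * (A / 2) <= Cmod h) by nra.
  replace (k - / a * h)%C with (- / a * (h - a * k))%C by (field; exact Ha).
  rewrite Cmod_mult, Cmod_opp, Cmod_inv by exact Ha. fold A.
  apply Rmult_le_reg_l with A; [lra|].
  rewrite <- Rmult_assoc, Rinv_r, Rmult_1_l by lra.
  apply Rle_trans with (1 := H1).
  apply Rle_trans with (e * A * A / 2 * Cmod k); [nra|].
  assert (0 < e * A) by nra. nra.
Qed.

Lemma cderiv_inv (z : C) : z <> 0 -> cderiv (fun u => (/ u)%C) z (- / (z * z))%C.
Proof.
  intros Hz. rewrite cderiv_eps. intros e He.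
  pose proof (proj1 (Cmod_gt_0 z) Hz) as Hp. set (A := Cmod z) in *.
  exists (Rmin (A / 2) (e * (A * A * A) / 2)). 
  assert (HA : 0 < A * A * A) by (repeat apply Rmult_lt_0_compat; lra).
  split. { apply Rmin_pos; [lra|]. nra. }
  intros u Hu.
  pose proof (Rlt_le_trans _ _ _ Hu (Rmin_l _ _)) as H1.
  pose proof (Rlt_le_trans _ _ _ Hu (Rmin_r _ _)) as H2.
  pose proof (Cmod_sub_ge z u) as H3. rewrite (Cmod_minus_sym z u) in H3. fold A in H3.
  assert (Hu0 : A / 2 < Cmod u) by lra.
  assert (Hun : u <> 0). { apply Cmod_gt_0. lra. }
  replace (/ u - / z - - / (z * z) * (u - z))%C with ((u - z) * (u - z) / (u * z * z))%C
    by (field; split; assumption).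
  assert (u * z * z <> 0)%C by (repeat apply Cmult_neq_0; assumption).
  rewrite Cmod_div by assumption. rewrite !Cmod_mult. fold A.
  set (h := Cmod (u - z)) in *. set (U := Cmod u) in *.
  assert (0 <= h) by apply Cmod_ge_0.
  apply Rle_div_l. { repeat apply Rmult_lt_0_compat; lra. }
  rewrite (Rmult_comm e h), Rmult_assoc. apply Rmult_le_compat_l; [assumption|].
  assert (e * (A * A * A) / 2 <= e * (U * A * A)); [|lra].
  assert (A / 2 * (A * A) <= U * (A * A)) by (apply Rmult_le_compat_r; nra). nra.
Qed.

Lemma cderiv_div f g z a b :
  cderiv f z a -> cderiv g z b -> g z <> 0 ->
  cderiv (fun u => (f u / g u)%C) z ((a * g z - f z * b) / (g z * g z))%C.
Proof.
  intros Hf Hg H0.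
  eapply cderiv_eq.
  - apply (cderiv_mult f (fun u => / g u)%C). { exact Hf. }
    apply (cderiv_comp (fun u => / u)%C g). { now apply cderiv_inv. } exact Hg.
  - field. exact H0.
Qed.

Lemma ccont_mult f g z : ccont f z -> ccont g z -> ccont (fun u => f u * g u)%C z.
Proof.
  intros Hf Hg e He.
  pose proof (Cmod_ge_0 (f z)) as HF. pose proof (Cmod_ge_0 (g z)) as HG.
  set (F := Cmod (f z)) in *. set (G := Cmod (g z)) in *.
  set (m := Rmin 1 (e / (F + G + 2))).
  assert (Hm : 0 < m). { apply Rmin_pos; [lra|]. apply Rdiv_lt_0_compat; lra. }
  destruct (Hf m Hm) as [d1 [Hd1 H1]]. destruct (Hg m Hm) as [d2 [Hd2 H2]].
  exists (Rmin d1 d2). split. { now apply Rmin_pos. }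
  intros u Hu.
  specialize (H1 u (Rlt_le_trans _ _ _ Hu (Rmin_l _ _))).
  specialize (H2 u (Rlt_le_trans _ _ _ Hu (Rmin_r _ _))).
  replace (f u * g u - f z * g z)%C
    with ((f u - f z) * (g u - g z) + (f u - f z) * g z + f z * (g u - g z))%C by ring.
  eapply Rle_lt_trans; [apply Cmod_triangle|].
  eapply Rle_lt_trans; [apply Rplus_le_compat_r, Cmod_triangle|].
  rewrite !Cmod_mult. fold F G.
  pose proof (Cmod_ge_0 (f u - f z)). pose proof (Cmod_ge_0 (g u - g z)).
  assert (m <= 1) by apply Rmin_l.
  assert (Hme : m * (F + G + 2) <= e).
  { apply Rle_div_r; [lra|]. apply Rmin_r. }
  nra.
Qed.

Lemma rcont_continuous (f : R -> C) t :
  rcont f t <-> continuous (T := R_UniformSpace) (U := C_UniformSpace) f t.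
Proof.
  split.
  - intros H P [e He]. destruct (H e (cond_pos e)) as [d [Hd H']].
    exists (mkposreal d Hd). intros u Hu. apply He.
    apply C_NormedModule_mixin_compat1. apply H'. exact Hu.
  - intros H e He.
    assert (H2 : 0 < sqrt 2) by (apply sqrt_lt_R0; lra).
    assert (He2 : 0 < e / sqrt 2) by (apply Rdiv_lt_0_compat; lra).
    destruct (H (ball (f t) (e / sqrt 2))) as [d Hd].
    { exists (mkposreal _ He2). intros y Hy. exact Hy. }
    exists d. split. { apply cond_pos. }
    intros u Hu. specialize (Hd u Hu).
    pose proof (C_NormedModule_mixin_compat2 (f t) (f u) (mkposreal _ He2) Hd) as H3.
    simpl in H3. replace (sqrt 2 * (e / sqrt 2)) with e in H3 by (field; lra). exact H3.
Qed.

Lemma C_R_norm (z : C) : norm (z : C_R_NormedModule) = Cmod z.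
Proof.
  change (sqrt (Rabs (fst z) ^ 2 + Rabs (snd z) ^ 2) = Cmod z).
  rewrite <- !Rsqr_pow2, <- !Rsqr_abs, !Rsqr_pow2. reflexivity.
Qed.

Lemma rderiv_eps (f : R -> C) (t : R) (l : C) :
  rderiv f t l <->
  forall e, 0 < e -> exists d, 0 < d /\
    forall u, Rabs (u - t) < d ->
      Cmod (f u - f t - l * RtoC (u - t)) <= e * Rabs (u - t).
Proof.
  assert (E : forall u, norm (minus (minus (f u) (f t)) (scal (minus u t) l) : C_R_NormedModule)
              = Cmod (f u - f t - l * RtoC (u - t))).
  { intros u. rewrite C_R_norm. f_equal.
    apply injective_projections; unfold minus, plus, opp, scal; simpl;
    unfold scal; simpl; unfold mult, plus, opp; simpl; ring. }
  split.
  - intros [_ H] e He.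
    destruct (H t (fun P HP => HP) (mkposreal e He)) as [d Hd].
    exists d. split. { apply cond_pos. }
    intros u Hu. rewrite <- E. apply (Hd u). exact Hu.
  - intros H. split. { apply is_linear_scal_l. }
    intros x Hx e.
    apply (is_filter_lim_locally_unique (V := R_NormedModule)) in Hx. subst x.
    destruct (H e (cond_pos e)) as [d [Hd H']].
    exists (mkposreal d Hd). intros u Hu.
    specialize (H' u Hu). rewrite <- E in H'. exact H'.
Qed.

Lemma rderiv_eq f t a b : rderiv f t a -> a = b -> rderiv f t b.
Proof. now intros H <-. Qed.

Lemma rderiv_rcont f t l : rderiv f t l -> rcont f t.
Proof.
  intros H. apply rcont_continuous.
  apply (ex_derive_continuous (V := C_R_NormedModule)). now exists l.
Qed.

Lemma rderiv_comp_c (F : C -> C) (g : R -> C) t l m :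
  cderiv F (g t) l -> rderiv g t m -> rderiv (fun s => F (g s)) t (l * m)%C.
Proof.
  intros HF Hg. pose proof (rderiv_rcont _ _ _ Hg) as Hc.
  rewrite cderiv_eps in HF. rewrite rderiv_eps in *. intros e He.
  pose proof (Cmod_ge_0 l) as Hl. pose proof (Cmod_ge_0 m) as Hm.
  set (e1 := Rmin 1 (e / (Cmod l + Cmod m + 1))).
  assert (He1 : 0 < e1). { apply Rmin_pos; [lra|]. apply Rdiv_lt_0_compat; lra. }
  destruct (HF e1 He1) as [d1 [Hd1 H1]].
  destruct (Hg e1 He1) as [d2 [Hd2 H2]].
  destruct (Hc d1 Hd1) as [d3 [Hd3 H3]].
  exists (Rmin d2 d3). split. { now apply Rmin_pos. }
  intros u Hu.
  specialize (H2 u (Rlt_le_trans _ _ _ Hu (Rmin_l _ _))).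
  specialize (H3 u (Rlt_le_trans _ _ _ Hu (Rmin_r _ _))).
  specialize (H1 (g u) H3).
  set (k := (g u - g t)%C) in *. set (h := RtoC (u - t)) in *.
  assert (Hh : Cmod h = Rabs (u - t)) by apply Cmod_R.
  rewrite <- Hh in *. pose proof (Cmod_ge_0 h).
  replace (F (g u) - F (g t) - l * m * h)%C
    with ((F (g u) - F (g t) - l * k) + l * (k - m * h))%C by ring.
  eapply Rle_trans; [apply Cmod_triangle|]. rewrite Cmod_mult.
  assert (Hk : Cmod k <= (e1 + Cmod m) * Cmod h).
  { replace k with ((k - m * h) + m * h)%C by ring.
    eapply Rle_trans; [apply Cmod_triangle|]. rewrite Cmod_mult. lra. }
  assert (E1 : e1 <= 1) by apply Rmin_l.
  assert (E2 : e1 * (Cmod l + Cmod m + 1) <= e).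
  { apply Rle_div_r; [lra|]. apply Rmin_r. }
  assert (e1 * Cmod k <= e1 * ((1 + Cmod m) * Cmod h)) by (apply Rmult_le_compat_l; nra).
  assert (Cmod l * Cmod (k - m * h) <= Cmod l * (e1 * Cmod h)) by (apply Rmult_le_compat_l; lra).
  nra.
Qed.

Lemma rcont_comp_c (F : C -> C) (g : R -> C) t :
  ccont F (g t) -> rcont g t -> rcont (fun s => F (g s)) t.
Proof.
  intros HF Hg e He. destruct (HF e He) as [d [Hd H]].
  destruct (Hg d Hd) as [d' [Hd' H']]. exists d'. split; [assumption|].
  intros u Hu. apply H, H', Hu.
Qed.

Lemma rderiv_pair (f g : R -> R) t a b :
  is_derive f t a -> is_derive g t b -> rderiv (fun s => (f s, g s)) t (a, b).
Proof.
  intros Hf Hg. rewrite rderiv_eps. intros e He.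
  destruct Hf as [_ Hf]. destruct Hg as [_ Hg].
  assert (He2 : 0 < e / 2) by lra.
  destruct (Hf t (fun P HP => HP) (mkposreal _ He2)) as [d1 H1].
  destruct (Hg t (fun P HP => HP) (mkposreal _ He2)) as [d2 H2].
  exists (Rmin d1 d2). split. { apply Rmin_pos; apply cond_pos. }
  intros u Hu.
  specialize (H1 u (Rlt_le_trans _ _ _ Hu (Rmin_l _ _))).
  specialize (H2 u (Rlt_le_trans _ _ _ Hu (Rmin_r _ _))).
  cbv [norm minus plus opp scal mult] in H1, H2; simpl in H1, H2.
  cbv [abs mult] in H1, H2; simpl in H1, H2.
  change (Rabs (f u + - f t + - ((u + - t) * a)) <= e / 2 * Rabs (u - t)) in H1.
  change (Rabs (g u + - g t + - ((u + - t) * b)) <= e / 2 * Rabs (u - t)) in H2.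
  replace ((f u, g u) - (f t, g t) - (a, b) * RtoC (u - t))%C
    with (RtoC (f u + - f t + - ((u + - t) * a)) + Ci * RtoC (g u + - g t + - ((u + - t) * b)))%C
    by (apply injective_projections; simpl; ring).
  eapply Rle_trans; [apply Cmod_triangle|].
  rewrite Cmod_mult, Cmod_Ci, !Cmod_R. lra.
Qed.

(** * Complex-valued integrals *)

Definition CInt (f : R -> C) (a b : R) : C :=
  RInt (V := C_R_CompleteNormedModule) f a b.

Definition is_CInt (f : R -> C) (a b : R) (l : C) : Prop :=
  is_RInt (V := C_R_NormedModule) f a b l.

Lemma is_CInt_unique f a b l : is_CInt f a b l -> CInt f a b = l.
Proof. exact (is_RInt_unique (V := C_R_CompleteNormedModule) f a b l). Qed.

Lemma CInt_correct f a b :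
  a <= b -> (forall t, a <= t <= b -> rcont f t) -> is_CInt f a b (CInt f a b).
Proof.
  intros Hab Hc. apply (RInt_correct (V := C_R_CompleteNormedModule)).
  apply (ex_RInt_continuous (V := C_R_CompleteNormedModule)).
  intros z Hz. rewrite Rmin_left, Rmax_right in Hz by assumption.
  apply rcont_continuous. now apply Hc.
Qed.

Lemma is_CInt_plus f g a b l m :
  is_CInt f a b l -> is_CInt g a b m -> is_CInt (fun t => (f t + g t)%C) a b (l + m)%C.
Proof. exact (is_RInt_plus (V := C_R_NormedModule) f g a b l m). Qed.

(** A complex factor is not a scalar of the real module, so the integral is taken componentwise. *)
Lemma is_CInt_cmult (c : C) f a b l :
  is_CInt f a b l -> is_CInt (fun t => (c * f t)%C) a b (c * l)%C.
Proof.
  intros H.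
  pose proof (is_RInt_fct_extend_fst (U := R_NormedModule) (V := R_NormedModule) f a b l H) as H1.
  pose proof (is_RInt_fct_extend_snd (U := R_NormedModule) (V := R_NormedModule) f a b l H) as H2.
  apply (is_RInt_fct_extend_pair (U := R_NormedModule) (V := R_NormedModule)).
  - exact (is_RInt_minus _ _ _ _ _ _ (is_RInt_scal _ _ _ (fst c) _ H1) (is_RInt_scal _ _ _ (snd c) _ H2)).
  - exact (is_RInt_plus _ _ _ _ _ _ (is_RInt_scal _ _ _ (fst c) _ H2) (is_RInt_scal _ _ _ (snd c) _ H1)).
Qed.

Lemma is_CInt_ext f g a b l :
  (forall t, f t = g t) -> is_CInt f a b l -> is_CInt g a b l.
Proof. intros H. apply (is_RInt_ext (V := C_R_NormedModule)). intros x _. apply H. Qed.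

Lemma is_CInt_Chasles f a b c l m :
  is_CInt f a b l -> is_CInt f b c m -> is_CInt f a c (l + m)%C.
Proof. exact (is_RInt_Chasles (V := C_R_NormedModule) f a b c l m). Qed.

Lemma is_CInt_comp_lin f u v a b l :
  is_CInt f (u * a + v) (u * b + v) l ->
  is_CInt (fun t => (RtoC u * f (u * t + v)%R)%C) a b l.
Proof.
  intros H. eapply is_CInt_ext;
    [| exact (is_RInt_comp_lin (V := C_R_NormedModule) f u v a b l H)].
  intros t. apply injective_projections; unfold scal; simpl;
    unfold scal; simpl; unfold mult; simpl; ring.
Qed.

Lemma is_CInt_bound f a b l M :
  a <= b -> (forall t, a <= t <= b -> Cmod (f t) <= M) -> is_CInt f a b l ->
  Cmod l <= (b - a) * M.
Proof.
  intros Hab H Hl. rewrite <- C_R_norm.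
  refine (norm_RInt_le_const (V := C_R_NormedModule) f a b l M Hab _ Hl).
  intros t Ht. rewrite C_R_norm. now apply H.
Qed.

Lemma is_CInt_le f g a b l m :
  a <= b -> (forall t, a <= t <= b -> Cmod (f t) <= g t) -> is_CInt f a b l ->
  is_RInt g a b m -> Cmod l <= m.
Proof.
  intros Hab H Hl Hm. rewrite <- C_R_norm.
  refine (norm_RInt_le (V := C_R_NormedModule) f g a b l m Hab _ Hl Hm).
  intros t Ht. rewrite C_R_norm. now apply H.
Qed.

Lemma is_CInt_FTC F f a b :
  a <= b -> (forall t, a <= t <= b -> rderiv F t (f t)) ->
  (forall t, a <= t <= b -> rcont f t) -> is_CInt f a b (F b - F a)%C.
Proof.
  intros Hab HF Hf.
  apply (is_RInt_derive (V := C_R_CompleteNormedModule) F f a b);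
    rewrite Rmin_left, Rmax_right by assumption.
  - exact HF.
  - intros t Ht. apply rcont_continuous. now apply Hf.
Qed.

(** * Integrals along segments *)

Definition pt (a b : C) (t : R) : C := (a + RtoC t * (b - a))%C.

Definition seg (f : C -> C) (a b : C) : C := ((b - a) * CInt (fun t => f (pt a b t)) 0 1)%C.

Definition cont_seg (f : C -> C) (a b : C) : Prop :=
  forall t, 0 <= t <= 1 -> ccont f (pt a b t).

Lemma rderiv_pt a b t : rderiv (pt a b) t (b - a)%C.
Proof.
  rewrite rderiv_eps. intros e He. exists 1. split; [lra|]. intros u _.
  replace (pt a b u - pt a b t - (b - a) * RtoC (u - t))%C with (RtoC 0).
  - rewrite Cmod_0. pose proof (Rabs_pos (u - t)). nra.
  - unfold pt. rewrite RtoC_minus. ring.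
Qed.

Lemma rcont_pt a b t : rcont (pt a b) t.
Proof. eapply rderiv_rcont, rderiv_pt. Qed.

Lemma seg_correct f a b : cont_seg f a b ->
  is_CInt (fun t => ((b - a) * f (pt a b t))%C) 0 1 (seg f a b).
Proof.
  intros H. apply is_CInt_cmult. apply CInt_correct; [lra|].
  intros t Ht. apply (rcont_comp_c f); [now apply H | apply rcont_pt].
Qed.

Lemma seg_unique f a b l : 
  is_CInt (fun t => ((b - a) * f (pt a b t))%C) 0 1 l -> cont_seg f a b -> seg f a b = l.
Proof.
  intros H Hc. rewrite <- (is_CInt_unique _ _ _ _ H).
  symmetry. apply is_CInt_unique. now apply seg_correct.
Qed.

Lemma seg_bound f a b M :
  cont_seg f a b -> (forall t, 0 <= t <= 1 -> Cmod (f (pt a b t)) <= M) ->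
  Cmod (seg f a b) <= Cmod (b - a) * M.
Proof.
  intros Hc HM. replace (Cmod (b - a) * M) with ((1 - 0) * (Cmod (b - a) * M)) by ring.
  eapply is_CInt_bound; [lra | | apply (seg_correct f a b Hc)].
  intros t Ht. simpl. rewrite Cmod_mult. apply Rmult_le_compat_l; [apply Cmod_ge_0 | now apply HM].
Qed.

Lemma seg_FTC F f a b :
  (forall t, 0 <= t <= 1 -> cderiv F (pt a b t) (f (pt a b t))) -> cont_seg f a b ->
  seg f a b = (F b - F a)%C.
Proof.
  intros HF Hc. apply seg_unique; [|assumption].
  assert (E1 : pt a b 1 = b) by (unfold pt; ring).
  assert (E0 : pt a b 0 = a) by (unfold pt; ring).
  pose proof (is_CInt_FTC (fun t => F (pt a b t)) (fun t => ((b - a) * f (pt a b t))%C) 0 1) as H.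
  cbv beta in H. rewrite E1, E0 in H. apply H; [lra| |].
  - intros t Ht. rewrite Cmult_comm. apply (rderiv_comp_c F); [now apply HF|apply rderiv_pt].
  - intros t Ht. apply (rcont_comp_c (fun z => (b - a) * f z)%C).
    + apply (ccont_mult (fun _ => (b - a)%C) f); [|now apply Hc].
      eapply cderiv_ccont, cderiv_const.
    + apply rcont_pt.
Qed.

Lemma seg_linear f g c a b :
  cont_seg f a b -> cont_seg g a b ->
  cont_seg (fun z => (f z + c * g z)%C) a b ->
  seg (fun z => (f z + c * g z)%C) a b = (seg f a b + c * seg g a b)%C.
Proof.
  intros Hf Hg H. apply seg_unique; [|assumption].
  eapply is_CInt_ext; [|apply is_CInt_plus; [apply (seg_correct f a b Hf)
    | apply is_CInt_cmult, (seg_correct g a b Hg)]].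
  intros t; simpl. ring.
Qed.

Lemma pt_rev a b t : pt b a t = pt a b (1 - t).
Proof. unfold pt. rewrite RtoC_minus. ring. Qed.

Lemma cont_seg_rev f a b : cont_seg f a b -> cont_seg f b a.
Proof. intros H t Ht. rewrite pt_rev. apply H. lra. Qed.

Lemma seg_rev f a b : cont_seg f a b -> seg f b a = (- seg f a b)%C.
Proof.
  intros H. apply seg_unique; [|now apply cont_seg_rev].
  assert (Hs := is_RInt_swap _ _ _ _ (seg_correct f a b H)).
  replace (- seg f a b)%C with (opp (seg f a b : C_R_NormedModule)) by reflexivity.
  eapply is_CInt_ext; [| apply (is_CInt_comp_lin (fun t => ((b - a) * f (pt a b t))%C) (-1) 1)].
  - intros t; simpl. rewrite (pt_rev a b). replace (-1 * t + 1) with (1 - t) by ring. 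
    replace (RtoC (-1)) with (- (1))%C by (rewrite <- RtoC_opp; f_equal; ring). ring.
  - replace (-1 * 0 + 1) with 1 by ring. replace (-1 * 1 + 1) with 0 by ring. exact Hs.
Qed.

Lemma pt_sub a b s t : pt a (pt a b s) t = pt a b (s * t).
Proof. unfold pt. rewrite RtoC_mult. ring. Qed.

Lemma seg_split f a b s :
  0 <= s <= 1 -> cont_seg f a b ->
  seg f a b = (seg f a (pt a b s) + seg f (pt a b s) b)%C.
Proof.
  intros Hs H.
  assert (P2 : forall t, pt (pt a b s) b t = pt a b ((1 - s) * t + s)).
  { intros t. unfold pt. rewrite RtoC_plus, RtoC_mult, RtoC_minus. ring. }
  assert (Hc : forall t, 0 <= t <= 1 -> rcont (fun t => ((b - a) * f (pt a b t))%C) t).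
  { intros t Ht. apply (rcont_comp_c (fun z => (b - a) * f z)%C); [|apply rcont_pt].
    apply (ccont_mult (fun _ => (b - a)%C) f); [|now apply H].
    eapply cderiv_ccont, cderiv_const. }
  assert (I1 := CInt_correct _ 0 s (proj1 Hs) (fun t Ht => Hc t ltac:(lra))).
  assert (I2 := CInt_correct _ s 1 (proj2 Hs) (fun t Ht => Hc t ltac:(lra))).
  set (l1 := CInt _ 0 s) in I1. set (l2 := CInt _ s 1) in I2.
  rewrite (seg_unique f a b (l1 + l2)%C);
    [| exact (is_CInt_Chasles _ _ _ _ _ _ I1 I2) | assumption].
  f_equal; symmetry; apply seg_unique.
  - assert (I3 : is_CInt (fun t => ((b - a) * f (pt a b t))%C) (s * 0 + 0) (s * 1 + 0) l1).
    { now rewrite Rmult_0_r, Rmult_1_r, !Rplus_0_r. }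
    apply is_CInt_comp_lin in I3. eapply is_CInt_ext; [|exact I3].
    intros t; simpl. rewrite pt_sub, Rplus_0_r. unfold pt. ring.
  - intros t Ht. rewrite pt_sub. apply H. nra.
  - assert (I3 : is_CInt (fun t => ((b - a) * f (pt a b t))%C) ((1 - s) * 0 + s) ((1 - s) * 1 + s) l2).
    { rewrite Rmult_0_r, Rmult_1_r, Rplus_0_l. now replace (1 - s + s) with 1 by ring. }
    apply is_CInt_comp_lin in I3. eapply is_CInt_ext; [|exact I3].
    intros t; simpl. rewrite P2. rewrite RtoC_minus. unfold pt. ring.
  - intros t Ht. rewrite P2. apply H. nra.
Qed.

(** * Series and geometrically convergent sequences *)

Lemma Ceq_of_Cmod (a b : C) : Cmod (a - b) = 0 -> a = b.
Proof.
  intros H. apply Cmod_eq_0 in H. replace a with (a - b + b)%C by ring. rewrite H. ring.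
Qed.

(** Sums the [n] terms of index below [n], so that the Taylor remainder after [csum a n] has order
    [n]; [sum_n] also includes the index [n]. *)
Fixpoint csum (a : nat -> C) (n : nat) : C :=
  match n with O => 0 | S m => (csum a m + a m)%C end.

Definition cseries (a : nat -> C) (l : C) : Prop :=
  is_series (K := C_AbsRing) (V := C_NormedModule) a l.

Lemma sum_n_csum (a : nat -> C) n : sum_n (G := C_NormedModule) a n = csum a (S n).
Proof.
  induction n as [|n IH].
  - rewrite sum_O. simpl. ring.
  - rewrite sum_Sn, IH. reflexivity.
Qed.

Lemma cseries_eps (a : nat -> C) (l : C) :
  cseries a l <->
  forall e, 0 < e -> exists N, forall n, (N <= n)%nat -> Cmod (csum a n - l) < e.
Proof.
  split.
  - intros H e He.
    unfold cseries, is_series in H.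
    rewrite (filterlim_locally_ball_norm (K := C_AbsRing) (U := C_NormedModule)) in H.
    destruct (H (mkposreal e He)) as [N HN].
    exists (S N). intros n Hn. destruct n as [|n]; [lia|].
    specialize (HN n ltac:(lia)). rewrite sum_n_csum in HN. exact HN.
  - intros H. apply (filterlim_locally_ball_norm (K := C_AbsRing) (U := C_NormedModule)).
    intros e. destruct (H e (cond_pos e)) as [N HN].
    exists N. intros n Hn. rewrite sum_n_csum. apply (HN (S n)). lia.
Qed.

Lemma csum_telescope (u : nat -> C) n :
  csum (fun n => (u (S n) - u n)%C) n = (u n - u 0%nat)%C.
Proof. induction n as [|n IH]; simpl; [ring | rewrite IH; ring]. Qed.

(** Serves both the nested triangles of Goursat's theorem and the iterates of a contraction. The
    increments form a series dominated by a geometric one, and the limit is [u 0] plus its sum. *)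
Lemma geometric_Cauchy (u : nat -> C) (M q : R) :
  0 <= q < 1 -> (forall n, Cmod (u (S n) - u n) <= M * q ^ n) ->
  exists p, forall n, Cmod (u n - p) <= M * q ^ n / (1 - q).
Proof.
  intros Hq Hu.
  assert (Hex : ex_series (K := C_AbsRing) (V := C_CompleteNormedModule)
                  (fun n => (u (S n) - u n)%C)).
  { apply (ex_series_le (K := C_AbsRing) (V := C_CompleteNormedModule) _ (fun n => M * q ^ n)).
    - intros n. apply Hu.
    - apply (ex_series_scal (K := R_AbsRing) (V := R_NormedModule) M).
      apply ex_series_geom. rewrite Rabs_pos_eq; lra. }
  destruct Hex as [l Hl]. 
  pose proof (proj1 (cseries_eps _ _) Hl) as Hl'. clear Hl.
  exists (u 0%nat + l)%C. intros n.
  (* The factor [1 - q ^ k] is kept so that the induction on [k] closes with equality of the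
     bounds. *)
  assert (HM : forall k, Cmod (u n - u (n + k)%nat) <= M * q ^ n * (1 - q ^ k) / (1 - q)).
  { induction k as [|k IH].
    - rewrite Nat.add_0_r. replace (u n - u n)%C with (RtoC 0) by ring.
      rewrite Cmod_0. simpl. unfold Rdiv. rewrite Rminus_diag. lra.
    - replace (n + S k)%nat with (S (n + k)) by lia.
      replace (u n - u (S (n + k)))%C
        with ((u n - u (n + k)%nat) + - (u (S (n + k)) - u (n + k)%nat))%C by ring.
      eapply Rle_trans; [apply Cmod_triangle|]. rewrite Cmod_opp.
      eapply Rle_trans; [apply Rplus_le_compat; [apply IH | apply Hu]|].
      rewrite pow_add. right. simpl. field. lra. }
  apply le_epsilon. intros e He.
  destruct (Hl' e He) as [N HN].
  specialize (HN (n + N)%nat ltac:(lia)). rewrite csum_telescope in HN.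
  replace (u n - (u 0%nat + l))%C
    with ((u n - u (n + N)%nat) + (u (n + N)%nat - u 0%nat - l))%C by ring.
  eapply Rle_trans; [apply Cmod_triangle|].
  apply Rplus_le_compat; [|lra].
  eapply Rle_trans; [apply HM|].
  apply Rmult_le_compat_r; [left; apply Rinv_0_lt_compat; lra|].
  assert (0 <= M * q ^ n) by (eapply Rle_trans; [apply Cmod_ge_0|apply Hu]).
  assert (0 <= q ^ N) by (apply pow_le; lra). nra.
Qed.

(** * Goursat's theorem for triangles *)

Definition tri (f : C -> C) (a b c : C) : C := (seg f a b + seg f b c + seg f c a)%C.

Definition perim (a b c : C) : R := Cmod (b - a) + Cmod (c - b) + Cmod (a - c).

(** Convexity keeps the subdivided triangles in [K], closedness keeps their limit point there. The
    set stays abstract so that it can later be a closed disc cut by a half-plane. *)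
Record convex_closed (K : C -> Prop) : Prop := {
  cc_convex : forall a b t, K a -> K b -> 0 <= t <= 1 -> K (pt a b t);
  cc_closed : forall p, (forall e, 0 < e -> exists z, K z /\ Cmod (z - p) < e) -> K p }.

Notation mid a b := (pt a b (1 / 2)).

Lemma tri_split f K a b c :
  convex_closed K -> (forall z, K z -> ccont f z) -> K a -> K b -> K c ->
  tri f a b c = (tri f a (mid a b) (mid c a) + tri f b (mid b c) (mid a b)
    + tri f c (mid c a) (mid b c) + tri f (mid a b) (mid b c) (mid c a))%C.
Proof.
  intros HK Hf Ha Hb Hc.
  assert (Hcs : forall x y, K x -> K y -> cont_seg f x y).
  { intros x y Hx Hy t Ht. apply Hf. now apply (cc_convex K HK). }
  assert (Hm : forall x y, K x -> K y -> K (mid x y)).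
  { intros x y Hx Hy. apply (cc_convex K HK); try assumption. lra. }
  unfold tri.
  rewrite (seg_split f a b (1/2)), (seg_split f b c (1/2)), (seg_split f c a (1/2));
    try lra; try (apply Hcs; assumption).
  rewrite (seg_rev f (mid a b) (mid b c)), (seg_rev f (mid b c) (mid c a)),
    (seg_rev f (mid c a) (mid a b)) by (apply Hcs; apply Hm; assumption).
  ring.
Qed.

Lemma RtoC_half : RtoC (1 / 2) = (/ 2)%C.
Proof. rewrite RtoC_div by lra. unfold Cdiv. ring. Qed.

Lemma half_mod (u v : C) : (2 * u)%C = v -> Cmod u = Cmod v / 2.
Proof. intros <-. rewrite Cmod_mult, Cmod_R, Rabs_pos_eq by lra. field. Qed.

(** Bisection: one of the four half-size triangles carries at least a quarter of the integral. At
    the limit point [p] the affine part of [f] has a primitive and contributes nothing; the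
    remainder contributes at most a multiple of [e] times the squared perimeter, which decreases
    like [4 ^ - n] and cancels the factor [4 ^ n]. *)
Lemma Goursat f K a b c :
  convex_closed K -> (forall z, K z -> exists l, cderiv f z l) -> K a -> K b -> K c ->
  tri f a b c = 0.
Proof.
  intros HK Hd Ha Hb Hc.
  assert (Hf : forall z, K z -> ccont f z).
  { intros z Hz. destruct (Hd z Hz) as [l Hl]. now apply cderiv_ccont in Hl. }
  assert (Hcs : forall x y, K x -> K y -> cont_seg f x y).
  { intros x y Hx Hy t Ht. apply Hf. now apply (cc_convex K HK). }
  assert (Hm : forall x y, K x -> K y -> K (mid x y)).
  { intros x y Hx Hy. apply (cc_convex K HK); try assumption. lra. }
  (* Membership in [K] is a premise inside [good], so that every triple has a successor and [next]
     can be chosen as a total function. The halving of the perimeter and the bound on the drift of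
     the first vertex are unconditional. *)
  set (good := fun (T T' : C * C * C) =>
    let '(a, b, c) := T in let '(a', b', c') := T' in
    (K a -> K b -> K c -> K a' /\ K b' /\ K c' /\ Cmod (tri f a b c) <= 4 * Cmod (tri f a' b' c'))
    /\ perim a' b' c' = perim a b c / 2 /\ Cmod (a' - a) <= perim a b c).
  assert (Hstep : forall T, exists T', good T T').
  { clear a b c Ha Hb Hc. intros [[a b] c].
    assert (Hx : K a -> K b -> K c ->
       Cmod (tri f a b c) <= Cmod (tri f a (mid a b) (mid c a)) + Cmod (tri f b (mid b c) (mid a b))
        + Cmod (tri f c (mid c a) (mid b c)) + Cmod (tri f (mid a b) (mid b c) (mid c a))).
    { intros Ha Hb Hc. rewrite (tri_split f K a b c HK Hf Ha Hb Hc).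
      eapply Rle_trans; [apply Cmod_triangle|]. apply Rplus_le_compat_r.
      eapply Rle_trans; [apply Cmod_triangle|]. apply Rplus_le_compat_r.
      apply Cmod_triangle. }
    pose proof (Cmod_ge_0 (b - a)). pose proof (Cmod_ge_0 (c - b)). pose proof (Cmod_ge_0 (a - c)).
    pose proof RtoC_half as H12.
    assert (E1 : Cmod (mid a b - a) = Cmod (b - a) / 2)
      by (apply half_mod; unfold pt; rewrite H12; field).
    assert (Ebb : Cmod (mid a b - b) = Cmod (b - a) / 2)
      by (rewrite Cmod_minus_sym; apply half_mod; unfold pt; rewrite H12; field).
    assert (E3 : Cmod (mid b c - b) = Cmod (c - b) / 2)
      by (apply half_mod; unfold pt; rewrite H12; field).
    assert (E4 : Cmod (mid b c - c) = Cmod (c - b) / 2)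
      by (rewrite Cmod_minus_sym; apply half_mod; unfold pt; rewrite H12; field).
    assert (E5 : Cmod (mid c a - c) = Cmod (a - c) / 2)
      by (apply half_mod; unfold pt; rewrite H12; field).
    assert (E6 : Cmod (mid c a - a) = Cmod (a - c) / 2)
      by (rewrite Cmod_minus_sym; apply half_mod; unfold pt; rewrite H12; field).
    assert (F1 : Cmod (mid b c - mid a b) = Cmod (a - c) / 2)
      by (rewrite Cmod_minus_sym; apply half_mod; unfold pt; rewrite H12; field).
    assert (F2 : Cmod (mid c a - mid b c) = Cmod (b - a) / 2)
      by (rewrite Cmod_minus_sym; apply half_mod; unfold pt; rewrite H12; field).
    assert (F3 : Cmod (mid a b - mid c a) = Cmod (c - b) / 2)
      by (rewrite Cmod_minus_sym; apply half_mod; unfold pt; rewrite H12; field).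
    assert (G : forall T', (K a -> K b -> K c -> let '(a', b', c') := T' in
        K a' /\ K b' /\ K c' /\ Cmod (tri f a b c) <= 4 * Cmod (tri f a' b' c'))
        -> (let '(a', b', c') := T' in perim a' b' c' = perim a b c / 2 /\ Cmod (a' - a) <= perim a b c)
        -> exists T', good (a, b, c) T').
    { intros [[a' b'] c'] H3 H4. exists (a', b', c'). unfold good. split; [exact H3 | exact H4]. }
    assert (Haa : Cmod (a - a) = 0) by (replace (a - a)%C with (RtoC 0) by ring; apply Cmod_0).
    destruct (Rle_dec (Cmod (tri f a b c)) (4 * Cmod (tri f a (mid a b) (mid c a)))) as [D1|D1].
    { apply (G (a, mid a b, mid c a)).
      - intros; repeat split; auto.
      - unfold perim. rewrite E1, (Cmod_minus_sym _ (mid a b)), F3, (Cmod_minus_sym a (mid c a)), E6, Haa.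
        split; lra. }
    destruct (Rle_dec (Cmod (tri f a b c)) (4 * Cmod (tri f b (mid b c) (mid a b)))) as [D2|D2].
    { apply (G (b, mid b c, mid a b)).
      - intros; repeat split; auto.
      - unfold perim. rewrite E3, (Cmod_minus_sym _ (mid b c)), F1, (Cmod_minus_sym b (mid a b)), Ebb.
        split; lra. }
    destruct (Rle_dec (Cmod (tri f a b c)) (4 * Cmod (tri f c (mid c a) (mid b c)))) as [D3|D3].
    { apply (G (c, mid c a, mid b c)).
      - intros; repeat split; auto.
      - unfold perim. rewrite E5, (Cmod_minus_sym _ (mid c a)), F2, (Cmod_minus_sym c (mid b c)), E4.
        rewrite (Cmod_minus_sym c a). split; lra. }
    apply (G (mid a b, mid b c, mid c a)).
    - intros Ha Hb Hc. repeat split; auto. specialize (Hx Ha Hb Hc). lra.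
    - unfold perim. rewrite F1, F2, F3, E1. split; lra. }
  set (next := fun T => proj1_sig (constructive_indefinite_description _ (Hstep T))).
  assert (Hnext : forall T, good T (next T))
    by (intros T; exact (proj2_sig (constructive_indefinite_description _ (Hstep T)))).
  clearbody next. clear Hstep.
  set (T := fun n => Nat.iter n next (a, b, c)).
  set (P := perim a b c).
  assert (HP0 : 0 <= P).
  { unfold P, perim. pose proof (Cmod_ge_0 (b - a)). pose proof (Cmod_ge_0 (c - b)).
    pose proof (Cmod_ge_0 (a - c)). lra. }
  assert (HT : forall n, let '(a', b', c') := T n in
     K a' /\ K b' /\ K c' /\ Cmod (tri f a b c) <= 4 ^ n * Cmod (tri f a' b' c')
     /\ perim a' b' c' = P * (/ 2) ^ n).
  { induction n as [|n IH].
    - simpl. repeat split; try assumption; unfold P; lra.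
    - change (T (S n)) with (next (T n)). pose proof (Hnext (T n)) as Hn.
      destruct (T n) as [[a1 b1] c1]. destruct (next (a1, b1, c1)) as [[a2 b2] c2].
      destruct IH as (I1 & I2 & I3 & I4 & I5). destruct Hn as (Hn1 & Hn2 & _).
      destruct (Hn1 I1 I2 I3) as (J1 & J2 & J3 & J4).
      repeat split; try assumption.
      + eapply Rle_trans; [apply I4|]. simpl.
        assert (0 < 4 ^ n) by (apply pow_lt; lra). nra.
      + rewrite Hn2, I5. simpl. field. }
  destruct (geometric_Cauchy (fun n => fst (fst (T n))) P (/ 2)) as [p Hp]; [lra| |].
  { intros n. pose proof (HT n) as H1. pose proof (Hnext (T n)) as H2.
    change (T (S n)) with (next (T n)).
    destruct (T n) as [[a1 b1] c1]. destruct (next (a1, b1, c1)) as [[a2 b2] c2].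
    destruct H1 as (_ & _ & _ & _ & H1). destruct H2 as (_ & _ & H2). simpl.
    rewrite <- H1. exact H2. }
  assert (Hp' : forall n, Cmod (fst (fst (T n)) - p) <= 2 * P * (/2) ^ n).
  { intros n. specialize (Hp n). simpl in Hp. lra. }
  clear Hp. rename Hp' into Hp.
  assert (Hsm : forall e, 0 < e -> exists n, P * (/ 2) ^ n < e).
  { intros e He. destruct (pow_lt_1_zero (/ 2)) with (y := e / (P + 1)) as [n Hn].
    - rewrite Rabs_pos_eq; lra.
    - apply Rdiv_lt_0_compat; lra.
    - exists n. specialize (Hn n (le_n n)). rewrite Rabs_pos_eq in Hn by (apply pow_le; lra).
      assert (0 < (/ 2) ^ n) by (apply pow_lt; lra).
      apply (Rmult_lt_compat_r (P + 1)) in Hn; [|lra].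
      unfold Rdiv in Hn. rewrite Rmult_assoc, Rinv_l, Rmult_1_r in Hn by lra. lra. }
  assert (HKp : K p).
  { apply (cc_closed K HK). intros e He. destruct (Hsm (e / 2)) as [n Hn]; [lra|].
    exists (fst (fst (T n))). split.
    - pose proof (HT n). destruct (T n) as [[a1 b1] c1]. simpl. tauto.
    - specialize (Hp n). lra. }
  destruct (Hd p HKp) as [l Hl]. pose proof Hl as Hl0. rewrite cderiv_eps in Hl.
  apply Cmod_eq_0.
  assert (Hfin : forall e, 0 < e -> Cmod (tri f a b c) <= e * (3 * P * P)).
  { intros e He. destruct (Hl e He) as [d [Hd0 Hl1]].
    (* Each point of the sides of the [n]-th triangle is within three perimeters of [p]: two for the
       distance from [p] to the first vertex, one from that vertex to the point. *)
    destruct (Hsm (d / 3)) as [n Hn]; [lra|].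
    specialize (Hp n). pose proof (HT n) as H1. destruct (T n) as [[a1 b1] c1].
    destruct H1 as (K1 & K2 & K3 & H4 & H5). simpl in Hp.
    (* [g] is the affine approximation of [f] at [p], [G] a primitive of it, and [r] the remainder,
       written in the shape that [seg_linear] expects. *)
    set (g := fun z => (f p + l * (z - p))%C).
    set (r := fun z => (f z + (-(1)) * g z)%C).
    set (G := fun z => (f p * z + l * ((z - p) * (z - p)) / 2)%C).
    assert (HG : forall z, cderiv G z (g z)).
    { intros z. unfold G, g. eapply cderiv_eq.
      - apply cderiv_plus.
        + apply cderiv_mult; [apply cderiv_const | apply cderiv_id].
        + unfold Cdiv. apply cderiv_mult; [|apply cderiv_const].
          apply cderiv_mult; [apply cderiv_const|].
          apply cderiv_mult; (apply cderiv_minus; [apply cderiv_id | apply cderiv_const]).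
      - cbv beta. field. }
    assert (Hg : forall z, exists m, cderiv g z m).
    { intros z. eexists. apply cderiv_plus; [apply cderiv_const|].
      apply cderiv_mult; [apply cderiv_const|].
      apply cderiv_minus; [apply cderiv_id | apply cderiv_const]. }
    assert (Hgc : forall x y, cont_seg g x y).
    { intros x y t Ht. destruct (Hg (pt x y t)) as [m Hm']. now apply cderiv_ccont in Hm'. }
    assert (Hrc : forall x y, K x -> K y -> cont_seg r x y).
    { intros x y Hx Hy t Ht.
      destruct (Hd (pt x y t)) as [m1 Hm1]. { now apply (cc_convex K HK). }
      destruct (Hg (pt x y t)) as [m2 Hm2].
      eapply cderiv_ccont. unfold r. apply cderiv_plus; [apply Hm1|].
      apply cderiv_mult; [apply cderiv_const | apply Hm2]. }
    assert (Hr : tri r a1 b1 c1 = tri f a1 b1 c1).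
    { assert (E : forall x y, K x -> K y -> seg r x y = (seg f x y + -(1) * (G y - G x))%C).
      { intros x y Hx Hy. rewrite <- (seg_FTC G g) by auto.
        unfold r. apply seg_linear; auto. }
      unfold tri. rewrite !E by assumption. ring. }
    set (p1 := perim a1 b1 c1) in *.
    assert (Hp1 : 0 <= p1) by (rewrite H5; apply Rmult_le_pos; [assumption | apply pow_le; lra]).
    pose proof (Cmod_ge_0 (b1 - a1)). pose proof (Cmod_ge_0 (c1 - b1)). pose proof (Cmod_ge_0 (a1 - c1)).
    assert (Hp1e : Cmod (b1 - a1) + Cmod (c1 - b1) + Cmod (a1 - c1) = p1) by reflexivity.
    assert (Hb1 : forall x y, K x -> K y -> Cmod (x - a1) + Cmod (y - x) <= p1 ->
       Cmod (seg r x y) <= Cmod (y - x) * (e * (3 * p1))).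
    { intros x y Hx Hy Hxy. apply seg_bound; [now apply Hrc|]. intros t Ht.
      assert (Hz : Cmod (pt x y t - p) <= 3 * p1).
      { replace (pt x y t - p)%C with (RtoC t * (y - x) + ((x - a1) + (a1 - p)))%C
          by (unfold pt; ring).
        eapply Rle_trans; [apply Cmod_triangle|].
        eapply Rle_trans; [apply Rplus_le_compat_l, Cmod_triangle|].
        rewrite Cmod_mult, Cmod_R, Rabs_pos_eq by lra.
        pose proof (Cmod_ge_0 (y - x)). nra. }
      unfold r, g.
      replace (f (pt x y t) + - (1) * (f p + l * (pt x y t - p)))%C
        with (f (pt x y t) - f p - l * (pt x y t - p))%C by ring.
      eapply Rle_trans; [apply Hl1; lra|].
      apply Rmult_le_compat_l; lra. }
    assert (Hbd : Cmod (tri f a1 b1 c1) <= p1 * (e * (3 * p1))).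
    { rewrite <- Hr. unfold tri. rewrite <- Hp1e at 1.
      eapply Rle_trans; [apply Cmod_triangle|].
      eapply Rle_trans; [apply Rplus_le_compat_r, Cmod_triangle|].
      assert (Haa : Cmod (a1 - a1) = 0) by (replace (a1 - a1)%C with (RtoC 0) by ring; apply Cmod_0).
      rewrite !Rmult_plus_distr_r.
      apply Rplus_le_compat; [apply Rplus_le_compat|]; apply Hb1; try assumption.
      - lra.
      - lra.
      - rewrite (Cmod_minus_sym c1 a1). 
        assert (Cmod (a1 - c1) <= Cmod (b1 - a1) + Cmod (c1 - b1)); [|lra].
        rewrite Cmod_minus_sym.
        replace (c1 - a1)%C with ((b1 - a1) + (c1 - b1))%C by ring. apply Cmod_triangle. }
    eapply Rle_trans; [apply H4|].
    assert (0 < 4 ^ n) by (apply pow_lt; lra).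
    apply Rle_trans with (4 ^ n * (p1 * (e * (3 * p1)))); [nra|].
    rewrite H5. right.
    assert (E4 : 4 ^ n * ((/ 2) ^ n * (/ 2) ^ n) = 1).
    { rewrite <- !Rpow_mult_distr. replace (4 * (/2 * /2)) with 1 by field. apply pow1. }
    transitivity (4 ^ n * ((/ 2) ^ n * (/ 2) ^ n) * (e * (3 * P * P))); [ring|].
    rewrite E4. ring. }
  apply Rle_antisym; [|apply Cmod_ge_0].
  apply le_epsilon. intros e He. rewrite Rplus_0_l.
  assert (0 <= P * P) by nra.
  assert (He' : 0 < e / (3 * P * P + 1)) by (apply Rdiv_lt_0_compat; nra).
  eapply Rle_trans; [apply (Hfin _ He')|].
  unfold Rdiv. rewrite Rmult_assoc. rewrite <- (Rmult_1_r e) at 2.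
  apply Rmult_le_compat_l; [lra|].
  apply (Rmult_le_reg_l (3 * P * P + 1)); [nra|].
  rewrite <- Rmult_assoc, Rinv_r by nra. lra.
Qed.

(** * Primitives on a disc with one exceptional point *)

Lemma Cmod_diag (a : C) : Cmod (a - a) = 0.
Proof. replace (a - a)%C with (RtoC 0) by ring. apply Cmod_0. Qed.

Lemma Cmod_pt_le a b t m :
  Cmod a <= m -> Cmod b <= m -> 0 <= t <= 1 -> Cmod (pt a b t) <= m.
Proof.
  intros Ha Hb Ht.
  replace (pt a b t) with (RtoC (1 - t) * a + RtoC t * b)%C
    by (unfold pt; rewrite RtoC_minus; ring).
  eapply Rle_trans; [apply Cmod_triangle|].
  rewrite !Cmod_mult, !Cmod_R, !Rabs_pos_eq by lra. nra.
Qed.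

(** [Re ((z - a) * Cconj u)] is the real inner product of [z - a] and [u]. The second condition is
    therefore a half-plane with normal [u], and it excludes [a] as soon as [k > 0]. *)
Lemma half_disc_convex_closed (m k : R) (a u : C) :
  convex_closed (fun z => Cmod z <= m /\ k <= Re ((z - a) * Cconj u)).
Proof.
  split.
  - intros x y t [Hx1 Hx2] [Hy1 Hy2] Ht. split; [now apply Cmod_pt_le|].
    replace (Re ((pt x y t - a) * Cconj u))
      with ((1 - t) * Re ((x - a) * Cconj u) + t * Re ((y - a) * Cconj u))
      by (unfold pt, Re; simpl; ring).
    nra.
  - intros p H. split.
    + apply le_epsilon. intros e He. destruct (H e He) as (z & [Hz _] & Hzp).
      pose proof (Cmod_sub_ge p z). rewrite (Cmod_minus_sym p z) in *. lra.
    + apply le_epsilon. intros e He.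
      pose proof (Cmod_ge_0 u).
      destruct (H (e / (Cmod u + 1))) as (z & [_ Hz] & Hzp).
      { apply Rdiv_lt_0_compat; lra. }
      apply (Rmult_lt_compat_r (Cmod u + 1)) in Hzp; [|lra].
      unfold Rdiv in Hzp. rewrite Rmult_assoc, Rinv_l, Rmult_1_r in Hzp by lra.
      replace (Re ((p - a) * Cconj u)) with (Re ((z - a) * Cconj u) - Re ((z - p) * Cconj u))
        by (unfold Re; simpl; ring).
      pose proof (re_le_Cmod ((z - p) * Cconj u)) as Hr. rewrite Cmod_mult, Cmod_conj in Hr.
      apply Rabs_le_between in Hr. pose proof (Cmod_ge_0 (z - p)). nra.
Qed.

(** Subtract the constant [c], whose integral is [c * (b - a)]. Applied with [c] the value of the
    integrand at an endpoint, this is the differentiability of the primitive. *)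
Lemma seg_approx f a b c e :
  cont_seg f a b -> (forall t, 0 <= t <= 1 -> Cmod (f (pt a b t) - c) <= e) ->
  Cmod (seg f a b - c * (b - a)) <= e * Cmod (b - a).
Proof.
  intros Hf He.
  assert (H1 : forall x y, cont_seg (fun _ => RtoC 1) x y).
  { intros x y t _. eapply cderiv_ccont, cderiv_const. }
  assert (H2 : cont_seg (fun z => f z + (- c) * 1)%C a b).
  { intros t Ht e' He'. destruct (Hf t Ht e' He') as [d [Hd H]]. exists d. split; [assumption|].
    intros u Hu. replace (f u + - c * 1 - (f (pt a b t) + - c * 1))%C with (f u - f (pt a b t))%C by ring.
    now apply H. }
  replace (seg f a b - c * (b - a))%C with (seg (fun z => f z + (- c) * 1)%C a b).
  - rewrite Rmult_comm. apply seg_bound; [assumption|]. intros t Ht.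
    replace (f (pt a b t) + - c * 1)%C with (f (pt a b t) - c)%C by ring. now apply He.
  - rewrite (seg_linear f (fun _ => RtoC 1)) by auto.
    rewrite (seg_FTC (fun z => z) (fun _ => RtoC 1)) by (auto; intros; apply cderiv_id). ring.
Qed.

(** Shrinking the triangle towards [a] leaves pieces that avoid [a]; the hypothesis on
    [z'] keeps them in a half-plane not containing [a]. *)
Lemma Goursat_vertex q R0 a z z' :
  (forall x, Cmod x < R0 -> ccont q x) ->
  (forall x, Cmod x < R0 -> x <> a -> exists l, cderiv q x l) ->
  Cmod a < R0 -> Cmod z < R0 -> Cmod z' < R0 -> z <> a -> Cmod (z' - z) < Cmod (z - a) / 2 ->
  tri q a z z' = 0.
Proof.
  intros Hc Hd Ha Hz Hz' Hne Hzz.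
  set (m := Rmax (Cmod a) (Rmax (Cmod z) (Cmod z'))).
  assert (Hm : m < R0) by (repeat apply Rmax_lub_lt; assumption).
  assert (Hma : Cmod a <= m) by apply Rmax_l.
  assert (Hmz : Cmod z <= m) by (eapply Rle_trans; [apply Rmax_l | apply Rmax_r]).
  assert (Hmz' : Cmod z' <= m) by (eapply Rle_trans; [apply Rmax_r | apply Rmax_r]).
  assert (Hcs : forall x y, Cmod x <= m -> Cmod y <= m -> cont_seg q x y).
  { intros x y Hx Hy t Ht. apply Hc. eapply Rle_lt_trans; [|apply Hm]. now apply Cmod_pt_le. }
  set (u := (z - a)%C) in *.
  assert (Hu : 0 < Cmod u).
  { apply Cmod_gt_0. intros E. apply Hne. replace z with (u + a)%C by (unfold u; ring). rewrite E. ring. }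
  assert (Rz : Re ((z - a) * Cconj u) = Cmod u ^ 2).
  { rewrite Cmod2_alt. unfold u, Re, Im. simpl. ring. }
  assert (Rz' : Cmod u ^ 2 / 2 <= Re ((z' - a) * Cconj u)).
  { replace (Re ((z' - a) * Cconj u)) with (Re ((z - a) * Cconj u) + Re ((z' - z) * Cconj u))
      by (unfold Re; simpl; ring).
    pose proof (re_le_Cmod ((z' - z) * Cconj u)) as Hr. rewrite Cmod_mult, Cmod_conj in Hr.
    apply Rabs_le_between in Hr. rewrite Rz. nra. }
  assert (Hs : forall s, 0 < s <= 1 ->
     tri q a z z' = tri q a (pt a z s) (pt a z' s)).
  { intros s Hs.
    set (K := fun x => Cmod x <= m /\ s * Cmod u ^ 2 / 2 <= Re ((x - a) * Cconj u)).
    assert (HK : convex_closed K) by apply half_disc_convex_closed.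
    assert (Hu2 : 0 < Cmod u ^ 2) by (apply pow_lt; assumption).
    assert (HdK : forall x, K x -> exists l, cderiv q x l).
    { intros x [Hx1 Hx2]. apply Hd; [lra|]. intros ->.
      replace (Re ((a - a) * Cconj u)) with 0 in Hx2 by (unfold Re; simpl; ring). nra. }
    assert (Kz : K z) by (split; [assumption | rewrite Rz; nra]).
    assert (Kz' : K z') by (split; [assumption | nra]).
    assert (Hp : forall x, Re ((pt a x s - a) * Cconj u) = s * Re ((x - a) * Cconj u))
      by (intros x; unfold pt, Re; simpl; ring).
    assert (Ka : K (pt a z s)).
    { split; [apply Cmod_pt_le; auto; lra|]. rewrite Hp, Rz. nra. }
    assert (Ka' : K (pt a z' s)).
    { split; [apply Cmod_pt_le; auto; lra|]. rewrite Hp. nra. }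
    (* The quadrilateral left when the small triangle at [a] is cut off is divided by a diagonal
       into two triangles with vertices in [K]. *)
    pose proof (Goursat q K (pt a z s) z (pt a z' s) HK HdK Ka Kz Ka') as G1.
    pose proof (Goursat q K z z' (pt a z' s) HK HdK Kz Kz' Ka') as G2.
    unfold tri in *.
    rewrite (seg_split q a z s), (seg_rev q a z'), (seg_split q a z' s) by (try lra; auto).
    rewrite (seg_rev q (pt a z' s) z') in G2 by (apply Hcs; [apply Ka' | assumption]).
    rewrite (seg_rev q z (pt a z' s)) in G2 by (apply Hcs; [assumption | apply Ka']).
    rewrite (seg_rev q (pt a z s) (pt a z' s)) in G1 by (apply Hcs; [apply Ka | apply Ka']).
    rewrite (seg_rev q a (pt a z' s)) by (apply Hcs; [assumption | apply Ka']).
    set (A := seg q (pt a z s) z) in *. set (B := seg q z (pt a z' s)) in *.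
    set (D := seg q (pt a z s) (pt a z' s)) in *. set (E := seg q z z') in *.
    set (F := seg q (pt a z' s) z') in *. set (X := seg q a (pt a z s)). set (Y := seg q a (pt a z' s)).
    replace (X + A + E + - (Y + F))%C with
      (X + D + - Y + (A + B + - D) + (E + - F + - B))%C by ring.
    rewrite G1, G2. ring. }
  apply Cmod_eq_0. apply Rle_antisym; [|apply Cmod_ge_0].
  apply le_epsilon. intros e He. rewrite Rplus_0_l.
  destruct (Hc a Ha 1 Rlt_0_1) as [d [Hd0 Hq]].
  set (M := Cmod (q a) + 1).
  pose proof (Cmod_ge_0 (q a)). pose proof (Cmod_ge_0 (z' - a)). pose proof (Cmod_ge_0 (z' - z)).
  set (P := perim a z z').
  assert (HPe : Cmod u + Cmod (z' - z) + Cmod (a - z') = P) by reflexivity.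
  rewrite (Cmod_minus_sym a z') in HPe.
  (* The second term keeps the shrunken triangle within [d] of [a], where |q| <= [M]; the third
     makes [M] times its perimeter [s * P] at most [e]. *)
  set (s := Rmin 1 (Rmin (d / (P + 1)) (e / (M * P)))).
  assert (HP : 0 < P) by lra.
  assert (HM : 0 < M) by (unfold M; lra).
  assert (HMP : 0 < M * P) by nra.
  assert (S0 : 0 < s).
  { unfold s. repeat apply Rmin_pos; [lra | |]; apply Rdiv_lt_0_compat; lra. }
  assert (S1 : s <= 1) by apply Rmin_l.
  assert (S2 : s * (P + 1) <= d).
  { apply Rle_div_r; [lra|]. eapply Rle_trans; [apply Rmin_r | apply Rmin_l]. }
  assert (S3 : s * (M * P) <= e).
  { apply Rle_div_r; [assumption|]. eapply Rle_trans; [apply Rmin_r | apply Rmin_r]. }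
  rewrite (Hs s (conj S0 S1)).
  assert (Ez : Cmod (pt a z s - a) = s * Cmod u).
  { unfold pt. replace (a + s * (z - a) - a)%C with (s * u)%C by (unfold u; ring).
    rewrite Cmod_mult, Cmod_R, Rabs_pos_eq; lra. }
  assert (Ez' : Cmod (pt a z' s - a) = s * Cmod (z' - a)).
  { unfold pt. replace (a + s * (z' - a) - a)%C with (s * (z' - a))%C by ring.
    rewrite Cmod_mult, Cmod_R, Rabs_pos_eq; lra. }
  assert (Ezz : Cmod (pt a z' s - pt a z s) = s * Cmod (z' - z)).
  { unfold pt. replace (a + s * (z' - a) - (a + s * (z - a)))%C with (s * (z' - z))%C by ring.
    rewrite Cmod_mult, Cmod_R, Rabs_pos_eq; lra. }
  assert (Ma : Cmod (pt a z s) <= m) by (apply Cmod_pt_le; auto; lra).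
  assert (Ma' : Cmod (pt a z' s) <= m) by (apply Cmod_pt_le; auto; lra).
  assert (Hb : forall x y, Cmod x <= m -> Cmod y <= m -> Cmod (x - a) < d -> Cmod (y - a) < d ->
    Cmod (seg q x y) <= Cmod (y - x) * M).
  { intros x y Hx Hy Hxa Hya. apply seg_bound; [now apply Hcs|]. intros t Ht.
    assert (H3 : Cmod (pt x y t - a) < d).
    { replace (pt x y t - a)%C with (pt (x - a) (y - a) t)
        by (unfold pt; ring).
      eapply Rle_lt_trans; [apply (Cmod_pt_le _ _ _ (Rmax (Cmod (x - a)) (Cmod (y - a)))); auto|].
      - apply Rmax_l.
      - apply Rmax_r.
      - now apply Rmax_lub_lt. }
    specialize (Hq _ H3). pose proof (Cmod_sub_ge (q (pt x y t)) (q a)). unfold M. lra. }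
  assert (Pd : Cmod (a - a) < d) by (rewrite Cmod_diag; assumption).
  assert (Pz : Cmod (pt a z s - a) < d) by (rewrite Ez; nra).
  assert (Pz' : Cmod (pt a z' s - a) < d) by (rewrite Ez'; nra).
  unfold tri.
  eapply Rle_trans; [apply Cmod_triangle|].
  eapply Rle_trans; [apply Rplus_le_compat_r, Cmod_triangle|].
  pose proof (Hb a (pt a z s) Hma Ma Pd Pz) as B1.
  pose proof (Hb (pt a z s) (pt a z' s) Ma Ma' Pz Pz') as B2.
  pose proof (Hb (pt a z' s) a Ma' Hma Pz' Pd) as B3.
  rewrite Ez in B1. rewrite Ezz in B2. rewrite (Cmod_minus_sym a), Ez' in B3.
  apply Rle_trans with (s * (M * P)); [|assumption]. rewrite <- HPe. lra.
Qed.

(** The primitive is the integral from [a], so every triangle involved has the exceptional point as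
    a vertex and [Goursat_vertex] applies. The exceptional point is there for difference quotients,
    which are continuous at [a] but whose differentiability at [a] is not yet available. *)
Theorem disc_primitive q R0 a :
  (forall x, Cmod x < R0 -> ccont q x) ->
  (forall x, Cmod x < R0 -> x <> a -> exists l, cderiv q x l) ->
  Cmod a < R0 ->
  exists F, forall z, Cmod z < R0 -> cderiv F z (q z).
Proof.
  intros Hc Hd Ha. exists (fun z => seg q a z).
  intros z Hz. rewrite cderiv_eps. intros e He.
  destruct (Hc z Hz e He) as [d1 [Hd1 Hq]].
  assert (Hcs : forall x y, Cmod x < R0 -> Cmod y < R0 -> cont_seg q x y).
  { intros x y Hx Hy t Ht. apply Hc.
    eapply Rle_lt_trans; [apply (Cmod_pt_le _ _ _ (Rmax (Cmod x) (Cmod y))); auto|].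
    - apply Rmax_l.
    - apply Rmax_r.
    - now apply Rmax_lub_lt. }
  assert (H : exists d, 0 < d /\ forall u, Cmod (u - z) < d -> Cmod u < R0 ->
            (seg q a u - seg q a z)%C = seg q z u).
  { destruct (Ceq_dec z a) as [->|Hne].
    - exists 1. split; [lra|]. intros u _ _. unfold seg at 2. ring.
    - assert (Hp : 0 < Cmod (z - a)).
      { apply Cmod_gt_0. intros E. apply Hne. replace z with (z - a + a)%C by ring. rewrite E. ring. }
      exists (Cmod (z - a) / 2). split; [lra|]. intros u Hu HuR.
      pose proof (Goursat_vertex q R0 a z u Hc Hd Ha Hz HuR Hne Hu) as G. unfold tri in G.
      rewrite (seg_rev q a u) in G by now apply Hcs.
      replace (seg q z u) with (seg q a z + seg q z u + - seg q a u + (seg q a u - seg q a z))%C by ring.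
      rewrite G. ring. }
  destruct H as [d2 [Hd2 HF]].
  exists (Rmin (R0 - Cmod z) (Rmin d1 d2)). split. { repeat apply Rmin_pos; lra. }
  intros u Hu.
  assert (Hu1 : Cmod (u - z) < R0 - Cmod z) by (eapply Rlt_le_trans; [apply Hu | apply Rmin_l]).
  assert (Hu2 : Cmod (u - z) < d1)
    by (eapply Rlt_le_trans; [apply Hu | eapply Rle_trans; [apply Rmin_r | apply Rmin_l]]).
  assert (Hu3 : Cmod (u - z) < d2)
    by (eapply Rlt_le_trans; [apply Hu | eapply Rle_trans; [apply Rmin_r | apply Rmin_r]]).
  assert (HuR : Cmod u < R0) by (pose proof (Cmod_sub_ge u z); lra).
  rewrite HF by assumption.
  apply seg_approx; [now apply Hcs|]. intros t Ht. left. apply Hq.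
  replace (pt z u t - z)%C with (RtoC t * (u - z))%C by (unfold pt; ring).
  rewrite Cmod_mult, Cmod_R, Rabs_pos_eq by lra. pose proof (Cmod_ge_0 (u - z)). nra.
Qed.

(** * Cauchy's integral formula *)

Definition cis (t : R) : C := (cos t, sin t).

Lemma Cmod_cis t : Cmod (cis t) = 1.
Proof.
  transitivity (sqrt 1); [|apply sqrt_1].
  unfold Cmod, cis; simpl. f_equal.
  pose proof (sin2_cos2 t). unfold Rsqr in *. lra.
Qed.

Lemma cis_neq_0 t : cis t <> 0.
Proof. apply Cmod_gt_0. rewrite Cmod_cis. lra. Qed.

Lemma cis_plus s t : cis (s + t) = (cis s * cis t)%C.
Proof.
  unfold cis. rewrite cos_plus, sin_plus. apply injective_projections; simpl; ring.
Qed.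

Lemma cis_pow t n : (cis t ^ n)%C = cis (INR n * t).
Proof.
  induction n as [|n IH].
  - simpl. unfold cis. rewrite Rmult_0_l, cos_0, sin_0. reflexivity.
  - rewrite Cpow_S, IH, S_INR, Rmult_plus_distr_r, Rmult_1_l, cis_plus. ring.
Qed.

Lemma cis_inv t : (/ cis t)%C = cis (- t).
Proof.
  assert (H : (cis t * cis (- t) = 1)%C).
  { rewrite <- cis_plus, Rplus_opp_r. unfold cis. now rewrite cos_0, sin_0. }
  pose proof (cis_neq_0 t). 
  replace (cis (- t)) with (/ cis t * (cis t * cis (- t)))%C by (field; assumption).
  rewrite H. ring.
Qed.

Lemma rderiv_cis_lin k t : rderiv (fun s => cis (k * s)) t (RtoC k * (Ci * cis (k * t)))%C.
Proof.
  unfold cis.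
  replace (RtoC k * (Ci * (cos (k * t), sin (k * t))))%C
    with (k * - sin (k * t), k * cos (k * t)) by (apply injective_projections; simpl; ring).
  apply rderiv_pair; auto_derive; auto; ring.
Qed.

Lemma cis_period (n : nat) : cis (INR n * (2 * PI)) = 1.
Proof.
  unfold cis. rewrite <- (Rplus_0_l (INR n * (2 * PI))).
  replace (0 + INR n * (2 * PI)) with (0 + 2 * INR n * PI) by ring.
  now rewrite cos_period, sin_period, cos_0, sin_0.
Qed.

Lemma is_CInt_const (c : C) a b : is_CInt (fun _ => c) a b (RtoC (b - a) * c)%C.
Proof.
  pose proof (is_RInt_const (V := C_R_NormedModule) a b c) as H.
  replace (RtoC (b - a) * c)%C with (scal (b - a) (c : C_R_NormedModule)).
  - exact H.
  - apply injective_projections; unfold scal; simpl; unfold scal; simpl; unfold mult; simpl; ring.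
Qed.

(** Both signs occur: negative frequencies for the powers of [w / z] in the Cauchy kernel, a
    positive one for the mean of [Re (lam * z)] in the Schwarz bound. *)
Lemma is_CInt_cis (n : nat) (k : R) :
  (1 <= n)%nat -> k = INR n \/ k = - INR n ->
  is_CInt (fun t => cis (k * t)) 0 (2 * PI) 0.
Proof.
  intros Hn Hk. pose proof PI_RGT_0.
  assert (Hn0 : 0 < INR n) by (apply lt_0_INR; lia).
  assert (Hk0 : k <> 0) by (destruct Hk; subst; lra).
  assert (E : cis (k * (2 * PI)) = 1).
  { destruct Hk as [-> | ->]; [apply cis_period|].
    rewrite Ropp_mult_distr_l_reverse, <- cis_inv, cis_period. field. }
  assert (HD : (Ci * RtoC k)%C <> 0).
  { apply Cmult_neq_0.
    - apply Cmod_gt_0. rewrite Cmod_Ci. lra.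
    - intros HH. apply Hk0. exact (RtoC_inj _ _ HH). }
  pose proof (is_CInt_FTC (fun t => / (Ci * RtoC k) * cis (k * t))%C (fun t => cis (k * t)) 0 (2 * PI)) as HI.
  cbv beta in HI. rewrite E, Rmult_0_r in HI.
  replace (cis 0) with (RtoC 1) in HI by (unfold cis; now rewrite cos_0, sin_0).
  replace (/ (Ci * RtoC k) * 1 - / (Ci * RtoC k) * 1)%C with (RtoC 0) in HI by ring.
  apply HI; [lra| |].
  - intros t _. apply (rderiv_eq _ _ (/ (Ci * RtoC k) * (RtoC k * (Ci * cis (k * t))))%C).
    + apply (rderiv_comp_c (fun z => / (Ci * RtoC k) * z)%C (fun t => cis (k * t)) t (/ (Ci * RtoC k))%C); [|apply rderiv_cis_lin].
      eapply cderiv_eq; [apply cderiv_mult; [apply cderiv_const | apply cderiv_id]|]. cbv beta. ring.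
    + field. split; intros HH; apply HD; rewrite HH; ring.
  - intros t _. eapply rderiv_rcont, rderiv_cis_lin.
Qed.

Definition circ (r t : R) : C := (RtoC r * cis t)%C.

Lemma Cmod_circ r t : 0 <= r -> Cmod (circ r t) = r.
Proof. intros Hr. unfold circ. rewrite Cmod_mult, Cmod_cis, Cmod_R, Rabs_pos_eq; lra. Qed.

Lemma rderiv_circ r t : rderiv (circ r) t (Ci * circ r t)%C.
Proof.
  unfold circ, cis.
  apply (rderiv_eq (fun t => RtoC r * (cos t, sin t))%C _ (RtoC r * (Ropp (sin t), cos t))%C).
  - apply (rderiv_comp_c (fun z => RtoC r * z)%C).
    + eapply cderiv_eq; [apply cderiv_mult; [apply cderiv_const | apply cderiv_id]|]. cbv beta. ring.
    + apply rderiv_pair; auto_derive; auto; ring.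
  - apply injective_projections; simpl; ring.
Qed.

Lemma rcont_circ f r t :
  0 <= r -> (forall z, Cmod z = r -> ccont f z) -> rcont (fun s => f (circ r s)) t.
Proof.
  intros Hr Hf. apply (rcont_comp_c f).
  - apply Hf. now apply Cmod_circ.
  - eapply rderiv_rcont, rderiv_circ.
Qed.

(** The integral of [q] along the closed circle vanishes; multiplication by [- Ci] removes the
    factor [Ci] of the parametrized differential. *)
Lemma circ_primitive q F R0 r :
  0 < r < R0 -> (forall z, Cmod z < R0 -> cderiv F z (q z)) ->
  (forall z, Cmod z < R0 -> ccont q z) ->
  is_CInt (fun t => (q (circ r t) * circ r t)%C) 0 (2 * PI) 0.
Proof.
  intros Hr HF Hq. pose proof PI_RGT_0.
  assert (E : circ r (2 * PI) = circ r 0).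
  { unfold circ. f_equal. replace (2 * PI) with (INR 1 * (2 * PI)) by (simpl; ring).
    rewrite cis_period. unfold cis. now rewrite cos_0, sin_0. }
  pose proof (is_CInt_FTC (fun t => F (circ r t)) (fun t => (q (circ r t) * (Ci * circ r t))%C) 0 (2 * PI)) as HI.
  cbv beta in HI. rewrite E in HI.
  replace (F (circ r 0) - F (circ r 0))%C with (RtoC 0) in HI by ring.
  assert (HI' := HI ltac:(lra)). clear HI.
  assert (H1 : is_CInt (fun t => (q (circ r t) * (Ci * circ r t))%C) 0 (2 * PI) 0).
  { apply HI'.
    - intros t _. apply (rderiv_comp_c F); [apply HF; rewrite Cmod_circ; lra | apply rderiv_circ].
    - intros t _. apply (rcont_circ (fun z => q z * (Ci * z))%C); [lra|]. intros z Hz.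
      apply ccont_mult; [apply Hq; lra|].
      eapply cderiv_ccont. apply cderiv_mult; [apply cderiv_const | apply cderiv_id]. }
  apply (is_CInt_cmult (- Ci)) in H1.
  replace (- Ci * 0)%C with (RtoC 0) in H1 by ring.
  eapply is_CInt_ext; [|exact H1]. intros t. simpl.
  replace (- Ci * (q (circ r t) * (Ci * circ r t)))%C with (- (Ci * Ci) * (q (circ r t) * circ r t))%C by ring.
  replace (- (Ci * Ci))%C with (RtoC 1); [ring|].
  apply injective_projections; simpl; ring.
Qed.

(** * Difference quotients *)

Lemma analytic_cderiv D f z : analytic_on D f -> D z -> exists l, cderiv f z l.
Proof. intros H Hz. exact (H z Hz). Qed.

(** With [l] the derivative of [f] at [a], the filled-in value makes the quotient continuous at [a],
    which is what [disc_primitive] asks of its exceptional point. *)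
Definition diff_quot (f : C -> C) (a l z : C) : C :=
  if Ceq_dec z a then l else ((f z - f a) / (z - a))%C.

Lemma Csub_neq_0 (a b : C) : a <> b -> (a - b)%C <> 0.
Proof. intros H E. apply H. apply Ceq_of_Cmod. rewrite E. apply Cmod_0. Qed.

Lemma diff_quot_mul f a l z : (diff_quot f a l z * (z - a) = f z - f a)%C.
Proof.
  unfold diff_quot. destruct (Ceq_dec z a) as [->|Hne]; [ring|].
  field. now apply Csub_neq_0.
Qed.

Lemma diff_quot_ccont f a l : cderiv f a l -> ccont (diff_quot f a l) a.
Proof.
  intros H e He. rewrite cderiv_eps in H.
  destruct (H (e / 2)) as [d [Hd H1]]; [lra|].
  exists d. split; [assumption|]. intros u Hu. specialize (H1 u Hu).
  unfold diff_quot. destruct (Ceq_dec a a) as [_|]; [|congruence].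
  destruct (Ceq_dec u a) as [->|Hne].
  - now rewrite Cmod_diag.
  - pose proof (Csub_neq_0 u a Hne) as Hn.
    replace ((f u - f a) / (u - a) - l)%C with ((f u - f a - l * (u - a)) / (u - a))%C
      by (field; assumption).
    rewrite Cmod_div by assumption. apply Cmod_gt_0 in Hn.
    apply Rle_lt_trans with (e / 2); [|lra].
    apply Rle_div_l; lra.
Qed.

Lemma diff_quot_cderiv f a l z m :
  cderiv f z m -> z <> a -> exists m', cderiv (diff_quot f a l) z m'.
Proof.
  intros H Hne. pose proof (Csub_neq_0 z a Hne) as Hn.
  pose proof (proj1 (Cmod_gt_0 _) Hn) as Hp.
  eexists. apply (cderiv_ext_loc (fun u => (f u - f a) / (u - a))%C _ z _ (Cmod (z - a)) Hp).
  - intros u Hu. unfold diff_quot. destruct (Ceq_dec u a) as [->|_]; [|reflexivity].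
    rewrite Cmod_minus_sym in Hu. lra.
  - apply cderiv_div; [| | assumption].
    + apply cderiv_minus; [apply H | apply cderiv_const].
    + apply cderiv_minus; [apply cderiv_id | apply cderiv_const].
Qed.

Lemma diff_quot_disc f R0 a l :
  analytic_on (disc R0) f -> cderiv f a l ->
  forall z, Cmod z < R0 -> ccont (diff_quot f a l) z.
Proof.
  intros Hf Hl z Hz. destruct (Ceq_dec z a) as [->|Hne]; [now apply diff_quot_ccont|].
  destruct (analytic_cderiv _ _ z Hf Hz) as [m Hm].
  destruct (diff_quot_cderiv f a l z m Hm Hne) as [m' Hm']. now apply cderiv_ccont in Hm'.
Qed.

Lemma diff_quot_primitive f R0 a l :
  analytic_on (disc R0) f -> Cmod a < R0 -> cderiv f a l ->
  exists F, forall z, Cmod z < R0 -> cderiv F z (diff_quot f a l z).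
Proof.
  intros Hf Ha Hl. apply (disc_primitive _ R0 a); [| |assumption].
  - now apply diff_quot_disc.
  - intros z Hz Hne. destruct (analytic_cderiv _ _ z Hf Hz) as [m Hm].
    now apply (diff_quot_cderiv f a l z m).
Qed.

(** * The Cauchy kernel and its expansion *)

Lemma cderiv_pow f n z l : cderiv f z l -> exists m, cderiv (fun u => (f u ^ n)%C) z m.
Proof.
  intros Hf. induction n as [|n [m IH]].
  - exists 0. exact (cderiv_const 1 z).
  - eexists. simpl. apply cderiv_mult; [apply Hf | apply IH].
Qed.

Lemma circ_neq_0 r t : 0 < r -> circ r t <> 0.
Proof. intros Hr. apply Cmod_gt_0. rewrite Cmod_circ; lra. Qed.

Lemma circ_neq r t w : 0 < r -> Cmod w < r -> (circ r t - w)%C <> 0.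
Proof.
  intros Hr Hw. apply Csub_neq_0. intros E. rewrite <- E, Cmod_circ in Hw; lra.
Qed.

(** For [n = 0] this is the Cauchy kernel relative to the angle, dz being [Ci * z] dt. In general it
    is the tail, from index [n] on, of the geometric series of ratio [w / z], hence the kernel of
    the [n]-th Taylor remainder. *)
Definition kern (w : C) (n : nat) (z : C) : C := ((w / z) ^ n * (z / (z - w)))%C.

Lemma kern_ccont w n z : Cmod w < Cmod z -> ccont (kern w n) z.
Proof.
  intros Hw. pose proof (Cmod_ge_0 w).
  assert (Hz : z <> 0) by (apply Cmod_gt_0; lra).
  assert (Hzw : (z - w)%C <> 0) by (apply Csub_neq_0; intros E; subst; lra).
  unfold kern. apply ccont_mult.
  - destruct (cderiv_pow (fun z => w / z)%C n z _ 
      (cderiv_div (fun _ => w) (fun z => z) z _ _ (cderiv_const _ _) (cderiv_id _) Hz)) as [m Hm].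
    now apply cderiv_ccont in Hm.
  - eapply cderiv_ccont. apply cderiv_div; [apply cderiv_id | | assumption].
    apply cderiv_minus; [apply cderiv_id | apply cderiv_const].
Qed.

Lemma kern_S (w : C) n (z : C) : z <> 0 -> (z - w)%C <> 0 -> kern w (S n) z = (kern w n z - (w / z) ^ n)%C.
Proof. intros Hz Hzw. unfold kern. rewrite Cpow_S. field. now split. Qed.

Lemma kern_bound w n r t :
  0 < r -> Cmod w < r -> Cmod (kern w n (circ r t)) <= (Cmod w / r) ^ n * (r / (r - Cmod w)).
Proof.
  intros Hr Hw. unfold kern. 
  rewrite Cmod_mult, Cmod_pow, !Cmod_div by (try apply circ_neq_0; try apply circ_neq; assumption).
  rewrite Cmod_circ by lra. 
  apply Rmult_le_compat_l.
  - apply pow_le. apply Rdiv_le_0_compat; [apply Cmod_ge_0 | assumption].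
  - apply Rmult_le_compat_l; [lra|]. apply Rinv_le_contravar; [lra|].
    rewrite <- (Cmod_circ r t) at 1 by lra. apply Cmod_sub_ge.
Qed.

Lemma circ_pow_integral (w : C) r n :
  0 < r -> is_CInt (fun t => ((w / circ r t) ^ S n)%C) 0 (2 * PI) 0.
Proof.
  intros Hr.
  pose proof (is_CInt_cmult ((w / RtoC r) ^ S n)%C _ _ _ _
    (is_CInt_cis (S n) (- INR (S n)) ltac:(lia) (or_intror eq_refl))) as H.
  rewrite Cmult_0_r in H. eapply is_CInt_ext; [|exact H].
  intros t. cbv beta.
  rewrite Ropp_mult_distr_l_reverse, <- cis_inv, <- cis_pow, <- Cpow_inv by apply cis_neq_0.
  rewrite <- Cpow_mult_l. f_equal. unfold circ. field.
  split; [apply cis_neq_0 | intros E; apply RtoC_inj in E; lra].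
Qed.

(** Consecutive kernels of positive index differ by a power of [w / z] of mean zero, so they share
    one integral. It is zero because the kernels tend to zero uniformly on the circle; the kernel of
    index [0] exceeds that of index [1] by the constant [1]. *)
Lemma kern_integral w r :
  0 < r -> Cmod w < r -> is_CInt (fun t => kern w 0 (circ r t)) 0 (2 * PI) (RtoC (2 * PI)).
Proof.
  intros Hr Hw. pose proof PI_RGT_0. pose proof (Cmod_ge_0 w).
  assert (HI : forall n, is_CInt (fun t => kern w n (circ r t)) 0 (2 * PI)
                          (CInt (fun t => kern w n (circ r t)) 0 (2 * PI))).
  { intros n. apply CInt_correct; [lra|]. intros t _. apply rcont_circ; [lra|].
    intros z Hz. apply kern_ccont. lra. }
  assert (Hn : forall n, is_CInt (fun t => kern w (S n) (circ r t)) 0 (2 * PI)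
                 (CInt (fun t => kern w 1 (circ r t)) 0 (2 * PI))).
  { induction n as [|n IH]; [apply HI|].
    pose proof (is_CInt_plus _ _ _ _ _ _ IH (is_CInt_cmult (-(1))%C _ _ _ _ (circ_pow_integral w r n Hr))) as HP.
    replace (CInt (fun t : R => kern w 1 (circ r t)) 0 (2 * PI) + - (1) * 0)%C with
      (CInt (fun t : R => kern w 1 (circ r t)) 0 (2 * PI)) in HP by ring.
    eapply is_CInt_ext; [|exact HP]. intros t. cbv beta.
    rewrite (kern_S w (S n)) by (try apply circ_neq_0; try apply circ_neq; assumption). ring. }
  assert (Hq : 0 <= Cmod w / r < 1).
  { split; [apply Rdiv_le_0_compat; lra|]. apply Rlt_div_l; lra. }
  assert (H1 : CInt (fun t => kern w 1 (circ r t)) 0 (2 * PI) = 0).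
  { apply Cmod_eq_0. apply Rle_antisym; [|apply Cmod_ge_0]. apply le_epsilon. intros e He.
    rewrite Rplus_0_l.
    set (B := 2 * PI * (r / (r - Cmod w))).
    assert (HB : 0 < B). { unfold B. apply Rmult_lt_0_compat; [lra|]. apply Rdiv_lt_0_compat; lra. }
    destruct (pow_lt_1_zero (Cmod w / r)) with (y := e / B) as [n Hn'].
    - rewrite Rabs_pos_eq; lra.
    - now apply Rdiv_lt_0_compat.
    - specialize (Hn' (S n) ltac:(lia)). rewrite Rabs_pos_eq in Hn' by (apply pow_le; lra).
      eapply Rle_trans; [eapply is_CInt_bound; [| |apply (Hn n)]|]; [lra| intros t _; now apply kern_bound|].
      left. apply (Rmult_lt_compat_r B) in Hn'; [|assumption].
      unfold Rdiv at 2 in Hn'. rewrite Rmult_assoc, Rinv_l, Rmult_1_r in Hn' by lra.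
      unfold B in Hn'. lra. }
  pose proof (Hn 0%nat) as H2. rewrite H1 in H2.
  pose proof (is_CInt_plus _ _ _ _ _ _ H2 (is_CInt_const 1 0 (2 * PI))) as H3.
  replace (0 + RtoC (2 * PI - 0) * 1)%C with (RtoC (2 * PI)) in H3 by (rewrite Rminus_0_r; ring).
  eapply is_CInt_ext; [|exact H3]. intros t. cbv beta.
  rewrite (kern_S w 0) by (try apply circ_neq_0; try apply circ_neq; assumption). simpl. ring.
Qed.

(** The difference quotient at [w] has a primitive, so its circle integral vanishes; what remains is
    [f w] times the integral of the kernel. *)
Theorem Cauchy_formula f R0 r w :
  analytic_on (disc R0) f -> 0 < r < R0 -> Cmod w < r ->
  is_CInt (fun t => (f (circ r t) * kern w 0 (circ r t))%C) 0 (2 * PI) (RtoC (2 * PI) * f w)%C.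
Proof.
  intros Hf Hr Hw.
  destruct (analytic_cderiv _ _ w Hf) as [l Hl]; [unfold disc; lra|].
  destruct (diff_quot_primitive f R0 w l Hf) as [F HF]; [lra|assumption|].
  pose proof (circ_primitive _ F R0 r Hr HF (diff_quot_disc f R0 w l Hf Hl)) as H1.
  pose proof (is_CInt_plus _ _ _ _ _ _ H1
    (is_CInt_cmult (f w) _ _ _ _ (kern_integral w r (proj1 Hr) Hw))) as H2.
  replace (0 + f w * RtoC (2 * PI))%C with (RtoC (2 * PI) * f w)%C in H2 by ring.
  eapply is_CInt_ext; [|exact H2]. intros t. cbv beta.
  pose proof (circ_neq r t w (proj1 Hr) Hw) as Hn.
  unfold kern. simpl. rewrite Cmult_1_l.
  replace (diff_quot f w l (circ r t)) with ((f (circ r t) - f w) / (circ r t - w))%C.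
  - field. assumption.
  - rewrite <- (diff_quot_mul f w l). field. assumption.
Qed.

(** * Taylor coefficients, remainder and series *)

Definition coef (f : C -> C) (r : R) (n : nat) : C :=
  (CInt (fun t => f (circ r t) * / circ r t ^ n) 0 (2 * PI) / RtoC (2 * PI))%C.

Lemma RtoC_2PI : RtoC (2 * PI) <> 0.
Proof. pose proof PI_RGT_0. intros E. apply RtoC_inj in E. lra. Qed.

Lemma coef_integral f R0 r n :
  analytic_on (disc R0) f -> 0 < r < R0 ->
  is_CInt (fun t => (f (circ r t) * / circ r t ^ n)%C) 0 (2 * PI) (RtoC (2 * PI) * coef f r n)%C.
Proof.
  intros Hf Hr. pose proof PI_RGT_0. unfold coef.
  set (I := CInt _ _ _). replace (RtoC (2 * PI) * (I / RtoC (2 * PI)))%C with I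
    by (field; apply RtoC_2PI).
  apply CInt_correct; [lra|]. intros t _.
  apply (rcont_circ (fun z => f z * / z ^ n)%C); [lra|]. intros z Hz.
  assert (Hz0 : z <> 0) by (apply Cmod_gt_0; lra).
  apply ccont_mult.
  - destruct (analytic_cderiv _ _ z Hf) as [l Hl]; [unfold disc; lra|]. now apply cderiv_ccont in Hl.
  - destruct (cderiv_pow (fun z => z) n z _ (cderiv_id z)) as [m Hm].
    eapply cderiv_ccont. apply (cderiv_comp (fun u => / u)%C (fun z => z ^ n)%C); [|apply Hm].
    apply cderiv_inv. now apply Cpow_nz.
Qed.

(** Cauchy's formula with [n] terms of the geometric series peeled off the kernel, one by one
    through [kern_S]. *)
Lemma Taylor_integral f R0 r w n :
  analytic_on (disc R0) f -> 0 < r < R0 -> Cmod w < r ->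
  is_CInt (fun t => (f (circ r t) * kern w n (circ r t))%C) 0 (2 * PI)
    (RtoC (2 * PI) * (f w - csum (fun k => coef f r k * w ^ k) n))%C.
Proof.
  intros Hf Hr Hw. induction n as [|n IH].
  - simpl. replace (f w - 0)%C with (f w) by ring. now apply Cauchy_formula with R0.
  - pose proof (is_CInt_plus _ _ _ _ _ _ IH
      (is_CInt_cmult (- w ^ n)%C _ _ _ _ (coef_integral f R0 r n Hf Hr))) as H.
    simpl csum.
    replace (RtoC (2 * PI) * (f w - (csum (fun k => coef f r k * w ^ k) n + coef f r n * w ^ n)))%C with
      (RtoC (2 * PI) * (f w - csum (fun k : nat => coef f r k * w ^ k) n) +
      - w ^ n * (RtoC (2 * PI) * coef f r n))%C by ring.
    eapply is_CInt_ext; [|exact H]. intros t. cbv beta.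
    pose proof (circ_neq_0 r t (proj1 Hr)).
    rewrite kern_S by (try apply circ_neq_0; try apply circ_neq; tauto).
    unfold Cdiv. rewrite Cpow_mult_l, Cpow_inv by assumption. ring.
Qed.

Lemma Taylor_remainder f R0 r w n M :
  analytic_on (disc R0) f -> 0 < r < R0 -> Cmod w < r ->
  (forall t, 0 <= t <= 2 * PI -> Cmod (f (circ r t)) <= M) ->
  Cmod (f w - csum (fun k => coef f r k * w ^ k)%C n) <= M * ((Cmod w / r) ^ n * (r / (r - Cmod w))).
Proof.
  intros Hf Hr Hw HM. pose proof PI_RGT_0.
  assert (Hb : Cmod (RtoC (2 * PI) * (f w - csum (fun k => coef f r k * w ^ k)%C n))
      <= (2 * PI - 0) * (M * ((Cmod w / r) ^ n * (r / (r - Cmod w))))).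
  { eapply is_CInt_bound; [| |apply (Taylor_integral f R0 r w n Hf Hr Hw)]; [lra|].
    intros t Ht. cbv beta. rewrite Cmod_mult.
    apply Rmult_le_compat; try apply Cmod_ge_0.
    - now apply HM.
    - apply kern_bound; tauto. }
  rewrite Cmod_mult, Cmod_R, Rabs_pos_eq in Hb by lra. nra.
Qed.

Lemma circle_bound f R0 r :
  analytic_on (disc R0) f -> 0 < r < R0 ->
  exists M, forall t, 0 <= t <= 2 * PI -> Cmod (f (circ r t)) <= M.
Proof.
  intros Hf Hr. pose proof PI_RGT_0.
  destruct (continuity_ab_maj (fun t => Cmod (f (circ r t))) 0 (2 * PI)) as [t0 [H0 _]]; [lra| |].
  - intros t _ e He.
    assert (Hc : rcont (fun s => f (circ r s)) t).
    { apply (rcont_circ f); [lra|]. intros z Hz.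
      destruct (analytic_cderiv _ _ z Hf) as [l Hl]; [unfold disc; lra|].
      now apply cderiv_ccont in Hl. }
    destruct (Hc e He) as [d [Hd H1]]. exists d. split; [assumption|].
    intros u [_ Hu]. specialize (H1 u Hu). simpl. unfold Rdist.
    pose proof (Cmod_sub_ge (f (circ r u)) (f (circ r t))).
    pose proof (Cmod_sub_ge (f (circ r t)) (f (circ r u))) as H2. rewrite Cmod_minus_sym in H2.
    apply Rabs_def1; lra.
  - exists (Cmod (f (circ r t0))). exact H0.
Qed.

(** An asymptotic expansion at [0]: the constants depend on the order and no convergence is
    asserted. It determines the coefficients, which shows that [coef f r n] does not depend on
    [r]. *)
Definition expands (f : C -> C) (a : nat -> C) : Prop :=
  forall n, exists K d, 0 < d /\ forall w, Cmod w < d ->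
    Cmod (f w - csum (fun k => a k * w ^ k)%C n) <= K * Cmod w ^ n.

Lemma le_mult_all_small x K d :
  0 < d -> 0 <= x -> (forall t, 0 < t < d -> x <= K * t) -> x = 0.
Proof.
  intros Hd Hx H. apply Rle_antisym; [|assumption]. apply le_epsilon. intros e He.
  rewrite Rplus_0_l.
  assert (Hk : 0 < Rabs K + 1) by (pose proof (Rabs_pos K); lra).
  set (t := Rmin (d / 2) (e / (Rabs K + 1))).
  assert (Ht : 0 < t) by (apply Rmin_pos; [lra | now apply Rdiv_lt_0_compat]).
  assert (Ht1 : t <= d / 2) by apply Rmin_l.
  assert (Ht2 : t * (Rabs K + 1) <= e) by (apply Rle_div_r; [assumption | apply Rmin_r]).
  specialize (H t ltac:(lra)). pose proof (Rle_abs K). nra.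
Qed.

Lemma csum_ext a b n : (forall k, (k < n)%nat -> a k = b k) -> csum a n = csum b n.
Proof.
  induction n as [|n IH]; intros H; [reflexivity|]. simpl. rewrite IH, H; auto.
Qed.

Lemma expands_unique f a b : expands f a -> expands f b -> forall n, a n = b n.
Proof.
  intros Ha Hb n. induction n as [n IH] using (well_founded_induction Wf_nat.lt_wf).
  destruct (Ha (S n)) as (K1 & d1 & Hd1 & H1). destruct (Hb (S n)) as (K2 & d2 & Hd2 & H2).
  apply Ceq_of_Cmod.
  apply (le_mult_all_small _ (K1 + K2) (Rmin d1 d2)); [now apply Rmin_pos | apply Cmod_ge_0 |].
  intros t Ht.
  assert (Ht1 : t < d1) by (eapply Rlt_le_trans; [apply Ht | apply Rmin_l]).
  assert (Ht2 : t < d2) by (eapply Rlt_le_trans; [apply Ht | apply Rmin_r]).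
  assert (Hm : Cmod t = t) by (rewrite Cmod_R, Rabs_pos_eq; lra).
  specialize (H1 t). specialize (H2 t). rewrite Hm in H1, H2.
  specialize (H1 Ht1). specialize (H2 Ht2). simpl csum in H1, H2.
  rewrite (csum_ext (fun k => b k * t ^ k)%C (fun k => a k * t ^ k)%C) in H2
    by (intros k Hk; now rewrite IH).
  set (S0 := csum _ n) in *.
  assert (Hp : 0 < t ^ n) by (apply pow_lt; lra).
  apply (Rmult_le_reg_r (t ^ n)); [assumption|].
  replace (Cmod (a n - b n) * t ^ n) with (Cmod ((a n - b n) * RtoC t ^ n)).
  - replace ((a n - b n) * RtoC t ^ n)%C
      with ((f t - (S0 + b n * t ^ n)) + - (f t - (S0 + a n * t ^ n)))%C by ring.
    eapply Rle_trans; [apply Cmod_triangle|]. rewrite Cmod_opp. simpl in H1, H2. lra.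
  - rewrite Cmod_mult, Cmod_pow, Hm. reflexivity.
Qed.

Lemma coef_expands f R0 r : analytic_on (disc R0) f -> 0 < r < R0 -> expands f (coef f r).
Proof.
  intros Hf Hr n. destruct (circle_bound f R0 r Hf Hr) as [M HM].
  assert (HM0 : 0 <= M).
  { eapply Rle_trans; [apply Cmod_ge_0 | apply (HM 0)]. pose proof PI_RGT_0. lra. }
  exists (M * ((/ r) ^ n * 2)), (r / 2). split; [lra|]. intros w Hw.
  eapply Rle_trans; [apply (Taylor_remainder f R0 r w n M); try assumption; lra|].
  unfold Rdiv. rewrite Rpow_mult_distr.
  assert (0 <= Cmod w ^ n) by (apply pow_le, Cmod_ge_0).
  assert (0 < (/ r) ^ n) by (apply pow_lt, Rinv_0_lt_compat; lra).
  replace (M * ((/ r) ^ n * 2) * Cmod w ^ n) with (M * (Cmod w ^ n * (/ r) ^ n * 2)) by ring.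
  apply Rmult_le_compat_l; [assumption|]. apply Rmult_le_compat_l; [nra|].
  apply Rle_div_l; lra.
Qed.

Lemma coef_indep f R0 r s n :
  analytic_on (disc R0) f -> 0 < r < R0 -> 0 < s < R0 -> coef f r n = coef f s n.
Proof.
  intros Hf Hr Hs. eapply expands_unique; eapply coef_expands; eassumption.
Qed.

(** The coefficients are fixed at radius [R0 / 2]. The remainder at [w] needs a radius between |w|
    and [R0], to which the coefficients are transferred by [coef_indep]. *)
Theorem Taylor_series f R0 :
  0 < R0 -> analytic_on (disc R0) f ->
  exists a, expands f a /\ forall w, Cmod w < R0 -> cseries (fun k => a k * w ^ k)%C (f w).
Proof.
  intros HR Hf. exists (coef f (R0 / 2)). split; [apply coef_expands with R0; [assumption | lra]|].
  intros w Hw. pose proof (Cmod_ge_0 w).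
  set (r := (Cmod w + R0) / 2). assert (Hr : 0 < r < R0) by (unfold r; lra).
  assert (Hwr : Cmod w < r) by (unfold r; lra).
  destruct (circle_bound f R0 r Hf Hr) as [M HM].
  apply cseries_eps. intros e He.
  assert (HM0 : 0 <= M).
  { eapply Rle_trans; [apply Cmod_ge_0 | apply (HM 0)]. pose proof PI_RGT_0. lra. }
  set (B := M * (r / (r - Cmod w)) + 1).
  assert (HB : 0 < B).
  { unfold B. assert (0 <= M * (r / (r - Cmod w))); [|lra].
    apply Rmult_le_pos; [assumption|]. apply Rdiv_le_0_compat; lra. }
  assert (Hq : 0 <= Cmod w / r < 1).
  { split; [apply Rdiv_le_0_compat; lra|]. apply Rlt_div_l; lra. }
  destruct (pow_lt_1_zero (Cmod w / r)) with (y := e / B) as [N HN].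
  - rewrite Rabs_pos_eq; lra.
  - now apply Rdiv_lt_0_compat.
  - exists N. intros n Hn. specialize (HN n Hn). rewrite Rabs_pos_eq in HN by (apply pow_le; lra).
    rewrite (csum_ext _ (fun k => coef f r k * w ^ k)%C).
    2: { intros k _. f_equal. apply coef_indep with R0; try assumption; lra. }
    rewrite Cmod_minus_sym.
    eapply Rle_lt_trans; [apply (Taylor_remainder f R0 r w n M); assumption|].
    assert (0 <= (Cmod w / r) ^ n) by (apply pow_le; lra).
    apply (Rmult_lt_compat_r B) in HN; [|assumption].
    unfold Rdiv at 2 in HN. rewrite Rmult_assoc, Rinv_l, Rmult_1_r in HN by lra.
    unfold B in HN. nra.
Qed.

(** * Second-order expansions at the origin *)

(** Only an inequality near [0], without differentiability, so that expansions can be added,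
    multiplied, composed and inverted as polynomials modulo [w ^ 3]. *)
Definition jet2 (F : C -> C) (a b c : C) : Prop :=
  exists K d, 0 < d /\ forall w, Cmod w < d ->
    Cmod (F w - (a + b * w + c * w ^ 2)) <= K * Cmod w ^ 3.

Lemma expands_jet2 f a : expands f a -> jet2 f (a 0%nat) (a 1%nat) (a 2%nat).
Proof.
  intros H. destruct (H 3%nat) as (K & d & Hd & H1). exists K, d. split; [assumption|].
  intros w Hw. specialize (H1 w Hw). simpl csum in H1.
  replace (a 0%nat + a 1%nat * w + a 2%nat * w ^ 2)%C
    with (0 + a 0%nat * 1 + a 1%nat * (w * 1) + a 2%nat * (w * (w * 1)))%C by ring.
  exact H1.
Qed.

Lemma jet2_analytic f R0 : 0 < R0 -> analytic_on (disc R0) f -> exists a b c, jet2 f a b c.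
Proof.
  intros HR Hf. destruct (Taylor_series f R0 HR Hf) as [a [Ha _]].
  exists (a 0%nat), (a 1%nat), (a 2%nat). now apply expands_jet2.
Qed.

Lemma jet2_intro F a b c K d :
  0 < d -> (forall w, Cmod w < d -> Cmod (F w - (a + b * w + c * w ^ 2)) <= K * Cmod w ^ 3) ->
  jet2 F a b c.
Proof. intros. now exists K, d. Qed.

(** Normalizes the constants: [0 <= K] allows multiplying estimates, and [d <= 1] lets higher powers
    of |w| be absorbed by lower ones. *)
Lemma jet2_elim F a b c :
  jet2 F a b c -> exists K d, 0 <= K /\ 0 < d <= 1 /\
    forall w, Cmod w < d -> Cmod (F w - (a + b * w + c * w ^ 2)) <= K * Cmod w ^ 3.
Proof.
  intros (K & d & Hd & H). exists (Rabs K), (Rmin d 1).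
  split; [apply Rabs_pos|]. split. { split; [apply Rmin_pos; lra | apply Rmin_r]. }
  intros w Hw. eapply Rle_trans; [apply H; eapply Rlt_le_trans; [apply Hw | apply Rmin_l]|].
  apply Rmult_le_compat_r; [apply pow_le, Cmod_ge_0 | apply Rle_abs].
Qed.

Lemma jet2_poly a b c : jet2 (fun w => a + b * w + c * w ^ 2)%C a b c.
Proof.
  apply (jet2_intro _ _ _ _ 0 1); [lra|]. intros w _. rewrite Cmod_diag. lra.
Qed.

Lemma jet2_perturb F H a b c K d :
  jet2 F a b c -> 0 < d -> (forall w, Cmod w < d -> Cmod (H w - F w) <= K * Cmod w ^ 3) ->
  jet2 H a b c.
Proof.
  intros (K1 & d1 & Hd1 & H1) Hd HK.
  apply (jet2_intro _ _ _ _ (K + K1) (Rmin d d1)); [now apply Rmin_pos|]. intros w Hw.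
  specialize (H1 w (Rlt_le_trans _ _ _ Hw (Rmin_r _ _))).
  specialize (HK w (Rlt_le_trans _ _ _ Hw (Rmin_l _ _))).
  replace (H w - (a + b * w + c * w ^ 2))%C
    with ((H w - F w) + (F w - (a + b * w + c * w ^ 2)))%C by ring.
  eapply Rle_trans; [apply Cmod_triangle|]. lra.
Qed.

Lemma jet2_ext F H a b c d :
  0 < d -> (forall w, Cmod w < d -> F w = H w) -> jet2 F a b c -> jet2 H a b c.
Proof.
  intros Hd HE HF. apply (jet2_perturb F H a b c 0 d); try assumption.
  intros w Hw. rewrite (HE w Hw), Cmod_diag. lra.
Qed.

Lemma jet2_eq F a b c a' b' c' :
  jet2 F a b c -> a = a' -> b = b' -> c = c' -> jet2 F a' b' c'.
Proof. now intros H <- <- <-. Qed.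

Lemma jet2_plus F G a b c a' b' c' :
  jet2 F a b c -> jet2 G a' b' c' ->
  jet2 (fun w => F w + G w)%C (a + a')%C (b + b')%C (c + c')%C.
Proof.
  intros (K & d & Hd & H) (K' & d' & Hd' & H').
  apply (jet2_intro _ _ _ _ (K + K') (Rmin d d')); [now apply Rmin_pos|]. intros w Hw.
  specialize (H w (Rlt_le_trans _ _ _ Hw (Rmin_l _ _))).
  specialize (H' w (Rlt_le_trans _ _ _ Hw (Rmin_r _ _))).
  replace (F w + G w - (a + a' + (b + b') * w + (c + c') * w ^ 2))%C
   with ((F w - (a + b * w + c * w ^ 2)) + (G w - (a' + b' * w + c' * w ^ 2)))%C by ring.
  eapply Rle_trans; [apply Cmod_triangle|]. lra.
Qed.

Lemma Cmod_poly2_le a b c w :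
  Cmod w <= 1 -> Cmod (a + b * w + c * w ^ 2) <= Cmod a + Cmod b + Cmod c.
Proof.
  intros Hw. eapply Rle_trans; [apply Cmod_triangle|].
  eapply Rle_trans; [apply Rplus_le_compat_r, Cmod_triangle|].
  rewrite !Cmod_mult, Cmod_pow. pose proof (Cmod_ge_0 w).
  pose proof (Cmod_ge_0 b). pose proof (Cmod_ge_0 c).
  assert (Cmod w ^ 2 <= 1) by (simpl; nra). assert (0 <= Cmod w ^ 2) by (simpl; nra). nra.
Qed.

Lemma jet2_mult F G a b c a' b' c' :
  jet2 F a b c -> jet2 G a' b' c' ->
  jet2 (fun w => F w * G w)%C (a * a')%C (a * b' + b * a')%C (a * c' + b * b' + c * a')%C.
Proof.
  intros HF HG.
  apply jet2_elim in HF. destruct HF as (K & d & HK & Hd & H).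
  apply jet2_elim in HG. destruct HG as (K' & d' & HK' & Hd' & H').
  set (A := Cmod a + Cmod b + Cmod c). set (A' := Cmod a' + Cmod b' + Cmod c').
  assert (HA : 0 <= A) by (unfold A; pose proof (Cmod_ge_0 a); pose proof (Cmod_ge_0 b); pose proof (Cmod_ge_0 c); lra).
  assert (HA' : 0 <= A') by (unfold A'; pose proof (Cmod_ge_0 a'); pose proof (Cmod_ge_0 b'); pose proof (Cmod_ge_0 c'); lra).
  set (B := Cmod (b * c' + c * b') + Cmod (c * c')).
  apply (jet2_intro _ _ _ _ (A * K' + K * A' + K * K' + B) (Rmin d d')); [apply Rmin_pos; lra|].
  intros w Hw.
  specialize (H w (Rlt_le_trans _ _ _ Hw (Rmin_l _ _))).
  specialize (H' w (Rlt_le_trans _ _ _ Hw (Rmin_r _ _))).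
  assert (Hw1 : Cmod w <= 1) by (left; eapply Rlt_le_trans; [apply Hw|]; eapply Rle_trans; [apply Rmin_l|]; lra).
  pose proof (Cmod_poly2_le a b c w Hw1) as HP. pose proof (Cmod_poly2_le a' b' c' w Hw1) as HP'.
  fold A in HP. fold A' in HP'.
  set (P := (a + b * w + c * w ^ 2)%C) in *. set (P' := (a' + b' * w + c' * w ^ 2)%C) in *.
  set (E := (F w - P)%C) in *. set (E' := (G w - P')%C) in *.
  replace (F w * G w - (a * a' + (a * b' + b * a') * w + (a * c' + b * b' + c * a') * w ^ 2))%C
    with (P * E' + E * P' + E * E' + w ^ 3 * ((b * c' + c * b') + (c * c') * w))%C
    by (unfold E, E', P, P'; ring).
  eapply Rle_trans; [apply Cmod_triangle|].
  eapply Rle_trans; [apply Rplus_le_compat_r, Cmod_triangle|].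
  eapply Rle_trans; [apply Rplus_le_compat_r, Rplus_le_compat_r, Cmod_triangle|].
  rewrite (Cmod_mult P), (Cmod_mult E), (Cmod_mult E), (Cmod_mult (w ^ 3)), Cmod_pow.
  pose proof (Cmod_ge_0 w) as Hw0.
  set (W := Cmod w ^ 3) in *.
  assert (HW0 : 0 <= W) by (apply pow_le; assumption).
  assert (HW1 : W <= 1). { unfold W. rewrite <- (pow1 3). apply pow_incr. lra. }
  assert (HB : Cmod (b * c' + c * b' + c * c' * w) <= B).
  { unfold B. eapply Rle_trans; [apply Cmod_triangle|]. apply Rplus_le_compat_l.
    rewrite (Cmod_mult (c * c')). pose proof (Cmod_ge_0 (c * c')). nra. }
  pose proof (Cmod_ge_0 E). pose proof (Cmod_ge_0 E'). pose proof (Cmod_ge_0 P). pose proof (Cmod_ge_0 P').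
  assert (T1 : Cmod P * Cmod E' <= A * (K' * W)) by (apply Rmult_le_compat; assumption).
  assert (T2 : Cmod E * Cmod P' <= K * W * A') by (apply Rmult_le_compat; assumption).
  assert (T3 : Cmod E * Cmod E' <= K * W * (K' * W)) by (apply Rmult_le_compat; assumption).
  assert (T4 : W * Cmod (b * c' + c * b' + c * c' * w) <= W * B) by (apply Rmult_le_compat_l; assumption).
  assert (T5 : K * W * (K' * W) <= K * K' * W).
  { replace (K * W * (K' * W)) with (K * K' * W * W) by ring.
    rewrite <- (Rmult_1_r (K * K' * W)) at 2. apply Rmult_le_compat_l; [|assumption].
    apply Rmult_le_pos; [now apply Rmult_le_pos | assumption]. }
  lra.
Qed.

(** The quadratic polynomial of [F] evaluated at [G w] is handled by sums and products. The cubic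
    error of [F] at [G w] stays cubic in [w] because [G] has no constant term, whence |G w| <= [B]
    |w|. *)
Lemma jet2_comp F G a b c b' c' :
  jet2 F a b c -> jet2 G 0 b' c' ->
  jet2 (fun w => F (G w)) a (b * b')%C (b * c' + c * (b' * b'))%C.
Proof.
  intros HF HG.
  assert (HP : jet2 (fun w => (a + 0 * w + 0 * w ^ 2) + (b + 0 * w + 0 * w ^ 2) * G w
             + (c + 0 * w + 0 * w ^ 2) * (G w * G w))%C a (b * b')%C (b * c' + c * (b' * b'))%C).
  { eapply jet2_eq.
    - apply jet2_plus; [apply jet2_plus|].
      + apply (jet2_poly a 0 0).
      + apply jet2_mult; [apply jet2_poly | apply HG].
      + apply jet2_mult; [apply jet2_poly |]. apply jet2_mult; apply HG.
    - ring.
    - ring.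
    - ring. }
  apply jet2_elim in HF. destruct HF as (K & d & HK & Hd & H).
  apply jet2_elim in HG. destruct HG as (K' & d' & HK' & Hd' & H').
  set (B := Cmod b' + Cmod c' + K').
  pose proof (Cmod_ge_0 b') as Hb0. pose proof (Cmod_ge_0 c') as Hc0.
  assert (HB : 0 <= B) by (unfold B; lra).
  apply (jet2_perturb _ _ _ _ _ (K * B ^ 3) (Rmin d' (d / (B + 1))) HP).
  { apply Rmin_pos; [lra|]. apply Rdiv_lt_0_compat; lra. }
  intros w Hw.
  assert (Hw1 : Cmod w < d') by (eapply Rlt_le_trans; [apply Hw | apply Rmin_l]).
  assert (Hw2 : Cmod w * (B + 1) < d).
  { apply Rlt_div_r; [lra|]. eapply Rlt_le_trans; [apply Hw | apply Rmin_r]. }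
  pose proof (Cmod_ge_0 w) as Hw0.
  assert (HG : Cmod (G w) <= B * Cmod w).
  { replace (G w) with ((G w - (0 + b' * w + c' * w ^ 2)) + (b' * w + c' * w ^ 2))%C by ring.
    eapply Rle_trans; [apply Cmod_triangle|].
    eapply Rle_trans; [apply Rplus_le_compat; [apply (H' w Hw1) | apply Cmod_triangle]|].
    rewrite !Cmod_mult, Cmod_pow. simpl.
    assert (Cmod w * Cmod w <= Cmod w) by nra.
    assert (Cmod w * (Cmod w * Cmod w) <= Cmod w) by nra.
    unfold B. nra. }
  specialize (H (G w) ltac:(nra)).
  replace (F (G w) - (a + 0 * w + 0 * w ^ 2 + (b + 0 * w + 0 * w ^ 2) * G w
    + (c + 0 * w + 0 * w ^ 2) * (G w * G w)))%C with (F (G w) - (a + b * G w + c * G w ^ 2))%C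
    by ring.
  eapply Rle_trans; [apply H|]. rewrite Rmult_assoc. apply Rmult_le_compat_l; [assumption|].
  rewrite <- Rpow_mult_distr. apply pow_incr. split; [apply Cmod_ge_0 | assumption].
Qed.

(** The product of [F] with the candidate polynomial has expansion [1], [0], [0]; dividing the error
    by [F] costs a factor [2], as |F| >= 1/2 near [0]. *)
Lemma jet2_inv F b c : jet2 F 1 b c -> jet2 (fun w => / F w)%C 1 (- b)%C (b * b - c)%C.
Proof.
  intros HF.
  assert (HP := jet2_mult _ _ _ _ _ _ _ _ HF (jet2_poly 1 (- b)%C (b * b - c)%C)).
  apply jet2_elim in HP. destruct HP as (K & d & HK & Hd & H).
  assert (Hhalf : exists d', 0 < d' /\ forall w, Cmod w < d' -> 1 / 2 <= Cmod (F w)).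
  { apply jet2_elim in HF. destruct HF as (K1 & d1 & HK1 & Hd1 & H1).
    pose proof (Cmod_ge_0 b). pose proof (Cmod_ge_0 c).
    set (B := Cmod b + Cmod c + K1 + 1).
    exists (Rmin d1 (1 / 2 / B)). split.
    { apply Rmin_pos; [lra|]. apply Rdiv_lt_0_compat; unfold B; lra. }
    intros w Hw.
    assert (Hw1 : Cmod w < d1) by (eapply Rlt_le_trans; [apply Hw | apply Rmin_l]).
    assert (Hw2 : Cmod w * B < 1 / 2).
    { apply Rlt_div_r; [unfold B; lra|]. eapply Rlt_le_trans; [apply Hw | apply Rmin_r]. }
    pose proof (Cmod_ge_0 w) as Hw0.
    specialize (H1 w Hw1).
    assert (HG : Cmod (1 - F w) <= B * Cmod w).
    { replace (1 - F w)%C with (- (F w - (1 + b * w + c * w ^ 2)) + - (b * w + c * w ^ 2))%C by ring.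
      eapply Rle_trans; [apply Cmod_triangle|]. rewrite !Cmod_opp.
      eapply Rle_trans; [apply Rplus_le_compat; [apply H1 | apply Cmod_triangle]|].
      rewrite !Cmod_mult, Cmod_pow. simpl.
      assert (Cmod w * Cmod w <= Cmod w) by nra.
      assert (Cmod w * (Cmod w * Cmod w) <= Cmod w) by nra.
      unfold B. nra. }
    pose proof (Cmod_sub_ge 1 (F w)) as H3. 
    pose proof (Cmod_sub_ge 1 (1 - F w)) as H4.
    replace (1 - (1 - F w))%C with (F w) in H4 by ring. rewrite Cmod_1 in H4. lra. }
  destruct Hhalf as (d' & Hd' & Hh).
  apply (jet2_intro _ _ _ _ (2 * K) (Rmin d d')); [apply Rmin_pos; lra|].
  intros w Hw.
  specialize (H w (Rlt_le_trans _ _ _ Hw (Rmin_l _ _))).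
  specialize (Hh w (Rlt_le_trans _ _ _ Hw (Rmin_r _ _))).
  assert (HF0 : F w <> 0) by (apply Cmod_gt_0; lra).
  set (P := (1 + - b * w + (b * b - c) * w ^ 2)%C) in *.
  replace (/ F w - P)%C with (- (F w * P - 1) / F w)%C by (field; assumption).
  rewrite Cmod_div, Cmod_opp by assumption.
  apply Rle_div_l; [lra|].
  replace (F w * P - 1)%C with (F w * P -
      (1 * 1 + (1 * - b + b * 1) * w + (1 * (b * b - c) + b * - b + c * 1) * w ^ 2))%C by ring.
  eapply Rle_trans; [apply H|].
  assert (0 <= K * Cmod w ^ 3) by (apply Rmult_le_pos; [assumption | apply pow_le, Cmod_ge_0]).
  nra.
Qed.

Lemma jet2_unique F a b c a' b' c' :
  jet2 F a b c -> jet2 F a' b' c' -> a = a' /\ b = b' /\ c = c'.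
Proof.
  intros (K & d & Hd & H) (K' & d' & Hd' & H').
  assert (HD : forall t, 0 < t < Rmin d d' ->
    Cmod ((a - a') + (b - b') * t + (c - c') * t ^ 2) <= (K + K') * t ^ 3).
  { intros t Ht.
    assert (Hm : Cmod t = t) by (rewrite Cmod_R, Rabs_pos_eq; lra).
    specialize (H t). specialize (H' t). rewrite Hm in H, H'.
    specialize (H (Rlt_le_trans _ _ _ (proj2 Ht) (Rmin_l _ _))).
    specialize (H' (Rlt_le_trans _ _ _ (proj2 Ht) (Rmin_r _ _))).
    replace (a - a' + (b - b') * t + (c - c') * t ^ 2)%C
      with ((F t - (a' + b' * t + c' * t ^ 2)) + - (F t - (a + b * t + c * t ^ 2)))%C by ring.
    eapply Rle_trans; [apply Cmod_triangle|]. rewrite Cmod_opp. lra. }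
  assert (Hdd : 0 < Rmin (Rmin d d') 1) by (repeat apply Rmin_pos; lra).
  assert (HE : forall t, 0 < t < Rmin (Rmin d d') 1 -> 0 < t < Rmin d d' /\ t < 1).
  { intros t Ht. pose proof (Rmin_l (Rmin d d') 1). pose proof (Rmin_r (Rmin d d') 1). lra. }
  assert (Hmt : forall t, 0 < t -> Cmod t = t) by (intros t Ht; rewrite Cmod_R, Rabs_pos_eq; lra).
  assert (Ha : a = a').
  { apply Ceq_of_Cmod.
    apply (le_mult_all_small _ (Rabs (K + K') + Cmod (b - b') + Cmod (c - c')) _ Hdd (Cmod_ge_0 _)).
    intros t Ht. destruct (HE t Ht) as [Ht1 Ht2]. specialize (HD t Ht1).
    replace (a - a')%C with ((a - a' + (b - b') * t + (c - c') * t ^ 2) - ((b - b') * t + (c - c') * t ^ 2))%C by ring.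
    eapply Rle_trans; [apply Cmod_sub_le|].
    eapply Rle_trans; [apply Rplus_le_compat; [apply HD | apply Cmod_triangle]|].
    rewrite !Cmod_mult, Cmod_pow, Hmt by lra. simpl.
    pose proof (Cmod_ge_0 (b - b')). pose proof (Cmod_ge_0 (c - c')).
    pose proof (Rle_abs (K + K')). pose proof (Rabs_pos (K + K')).
    assert (t * (t * 1) <= t) by nra. assert (0 <= t * (t * (t * 1)) <= t) by nra. nra. }
  subst a'.
  assert (HD1 : forall t, 0 < t < Rmin d d' -> Cmod ((b - b') + (c - c') * t) <= (K + K') * t ^ 2).
  { intros t Ht. specialize (HD t Ht).
    replace (a - a + (b - b') * t + (c - c') * t ^ 2)%C with (((b - b') + (c - c') * t) * t)%C in HD by ring.
    rewrite Cmod_mult, Hmt in HD by lra. simpl in *. apply (Rmult_le_reg_r t); lra. }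
  assert (Hb : b = b').
  { apply Ceq_of_Cmod.
    apply (le_mult_all_small _ (Rabs (K + K') + Cmod (c - c')) _ Hdd (Cmod_ge_0 _)).
    intros t Ht. destruct (HE t Ht) as [Ht1 Ht2]. specialize (HD1 t Ht1).
    replace (b - b')%C with (((b - b') + (c - c') * t) - (c - c') * t)%C by ring.
    eapply Rle_trans; [apply Cmod_sub_le|].
    rewrite Cmod_mult, Hmt by lra. simpl in *.
    pose proof (Cmod_ge_0 (c - c')).
    pose proof (Rle_abs (K + K')). pose proof (Rabs_pos (K + K')).
    assert (0 <= t * (t * 1) <= t) by nra. nra. }
  subst b'. split; [reflexivity|]. split; [reflexivity|].
  apply Ceq_of_Cmod.
  apply (le_mult_all_small _ (K + K') _ Hdd (Cmod_ge_0 _)).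
  intros t Ht. destruct (HE t Ht) as [Ht1 Ht2]. specialize (HD1 t Ht1).
  replace (b - b + (c - c') * t)%C with ((c - c') * t)%C in HD1 by ring.
  rewrite Cmod_mult, Hmt in HD1 by lra. simpl in HD1. apply (Rmult_le_reg_r t); lra.
Qed.

Lemma jet2_value F a b c : jet2 F a b c -> F 0 = a.
Proof.
  intros (K & d & Hd & H). specialize (H 0). rewrite Cmod_0 in H. specialize (H Hd).
  apply Ceq_of_Cmod. replace (F 0 - a)%C with (F 0 - (a + b * 0 + c * 0 ^ 2))%C by ring.
  apply Rle_antisym; [|apply Cmod_ge_0]. simpl in H. simpl. lra.
Qed.

Lemma jet2_cderiv F a b c : jet2 F a b c -> cderiv F 0 b.
Proof.
  intros HF. pose proof (jet2_value _ _ _ _ HF) as H0.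
  apply jet2_elim in HF. destruct HF as (K & d & HK & Hd & H).
  rewrite cderiv_eps. intros e He. pose proof (Cmod_ge_0 c) as Hc.
  exists (Rmin d (e / (Cmod c + K + 1))). split.
  { apply Rmin_pos; [lra|]. apply Rdiv_lt_0_compat; lra. }
  intros u Hu. replace (u - 0)%C with u in * by ring.
  assert (Hw1 : Cmod u < d) by (eapply Rlt_le_trans; [apply Hu | apply Rmin_l]).
  assert (Hw2 : Cmod u * (Cmod c + K + 1) < e).
  { apply Rlt_div_r; [lra|]. eapply Rlt_le_trans; [apply Hu | apply Rmin_r]. }
  pose proof (Cmod_ge_0 u) as Hu0. specialize (H u Hw1). rewrite H0.
  replace (F u - a - b * u)%C with ((F u - (a + b * u + c * u ^ 2)) + c * u ^ 2)%C by ring.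
  eapply Rle_trans; [apply Cmod_triangle|]. rewrite Cmod_mult, Cmod_pow. simpl in *.
  assert (Cmod u * (Cmod u * (Cmod u * 1)) <= Cmod u * Cmod u) by nra. nra.
Qed.

Lemma cderiv_unique f z a b : cderiv f z a -> cderiv f z b -> a = b.
Proof.
  intros Ha Hb. rewrite <- (is_C_derive_unique f z a Ha). now apply is_C_derive_unique.
Qed.

Lemma prefix_bounded (u : nat -> R) N : exists B, forall n, (n < N)%nat -> u n <= B.
Proof.
  induction N as [|N [B HB]]; [exists 0; lia|].
  exists (Rmax B (u N)). intros n Hn.
  destruct (Nat.eq_dec n N) as [->|]; [apply Rmax_r|].
  eapply Rle_trans; [apply HB; lia | apply Rmax_l].
Qed.

(** Convergence at the point [s = R0 / 2] bounds |a n| [s ^ n]; for |w| < [s / 2] the tail from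
    index 3 is then dominated by a geometric series of ratio 1/2. *)
Lemma series_jet2 (a : nat -> C) (L : C -> C) R0 :
  0 < R0 -> (forall w, Cmod w < R0 -> cseries (fun k => a k * w ^ k)%C (L w)) ->
  jet2 L (a 0%nat) (a 1%nat) (a 2%nat).
Proof.
  intros HR HL. set (s := R0 / 2).
  assert (Hs : Cmod s = s) by (rewrite Cmod_R, Rabs_pos_eq; unfold s; lra).
  assert (Hb : exists B, 0 <= B /\ forall n, Cmod (a n) * s ^ n <= B).
  { pose proof (proj1 (cseries_eps _ _) (HL s ltac:(rewrite Hs; unfold s; lra)) 1 Rlt_0_1) as [N HN].
    destruct (prefix_bounded (fun n => Cmod (a n) * s ^ n) N) as [B HB].
    (* From index [N] on, a term is the difference of two partial sums that are both within [1] of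
       the limit. *)
    exists (Rmax B 2). split; [eapply Rle_trans; [|apply Rmax_r]; lra|].
    intros n. destruct (Compare_dec.le_lt_dec N n) as [Hn|Hn].
    - eapply Rle_trans; [|apply Rmax_r].
      replace (Cmod (a n) * s ^ n) with (Cmod (a n * RtoC s ^ n)) by (rewrite Cmod_mult, Cmod_pow, Hs; reflexivity).
      pose proof (HN n Hn) as H1. pose proof (HN (S n) ltac:(lia)) as H2. simpl in H2.
      set (S0 := csum _ n) in *. simpl.
      replace (a n * RtoC s ^ n)%C with ((S0 + a n * RtoC s ^ n - L s) - (S0 - L s))%C by ring.
      eapply Rle_trans; [apply Cmod_sub_le|]. simpl in *. lra.
    - eapply Rle_trans; [|apply Rmax_l]. now apply HB. }
  destruct Hb as (B & HB0 & HB).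
  assert (Hs0 : 0 < s) by (unfold s; lra).
  apply (jet2_intro _ _ _ _ (2 * B * (/ s) ^ 3) (s / 2)); [lra|].
  intros w Hw. pose proof (Cmod_ge_0 w) as Hw0.
  set (q := Cmod w / s).
  assert (Hq : 0 <= q <= 1 / 2).
  { unfold q. split; [apply Rdiv_le_0_compat; lra | apply Rle_div_l; lra]. }
  assert (Ht : forall n, Cmod (a n * w ^ n) <= B * q ^ n).
  { intros n. rewrite Cmod_mult, Cmod_pow. unfold q, Rdiv. rewrite Rpow_mult_distr.
    assert (Hsn : 0 < s ^ n) by (apply pow_lt; assumption).
    rewrite pow_inv.
    replace (Cmod (a n) * Cmod w ^ n) with (Cmod (a n) * s ^ n * (Cmod w ^ n * / s ^ n)) by (field; lra).
    apply Rmult_le_compat_r; [|apply HB].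
    apply Rmult_le_pos; [now apply pow_le | left; now apply Rinv_0_lt_compat]. }
  assert (Hrem : forall k, Cmod (csum (fun k => a k * w ^ k)%C (3 + k) - csum (fun k => a k * w ^ k)%C 3)
         <= 2 * B * (q ^ 3 * (1 - (1 / 2) ^ k))).
  { induction k as [|k IH].
    - rewrite Nat.add_0_r, Cmod_diag. simpl. lra.
    - replace (3 + S k)%nat with (S (3 + k)) by lia. 
      change (csum (fun k => a k * w ^ k)%C (S (3 + k)))
        with (csum (fun k => a k * w ^ k)%C (3 + k) + a (3 + k)%nat * w ^ (3 + k))%C.
      set (X := csum _ (3 + k)) in *. set (Y := csum _ 3) in *.
      replace (X + a (3 + k)%nat * w ^ (3 + k) - Y)%C with ((X - Y) + a (3 + k)%nat * w ^ (3 + k))%C by ring.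
      eapply Rle_trans; [apply Cmod_triangle|].
      eapply Rle_trans; [apply Rplus_le_compat; [apply IH | apply Ht]|].
      rewrite pow_add.
      assert (q ^ k <= (1 / 2) ^ k) by (apply pow_incr; lra).
      assert (0 <= B * q ^ 3) by (apply Rmult_le_pos; [assumption | apply pow_le; lra]).
      simpl ((1 / 2) ^ S k).
      replace (B * (q ^ 3 * q ^ k)) with (B * q ^ 3 * q ^ k) by ring. nra. }
  apply le_epsilon. intros e He.
  destruct (proj1 (cseries_eps _ _) (HL w ltac:(unfold s in Hw; lra)) e He) as [N HN].
  specialize (HN (3 + N)%nat ltac:(lia)). specialize (Hrem N).
  replace (a 0%nat + a 1%nat * w + a 2%nat * w ^ 2)%C with (csum (fun k => a k * w ^ k)%C 3)
    by (simpl; ring).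
  set (X := csum _ (3 + N)) in *. set (Y := csum _ 3) in *.
  replace (L w - Y)%C with ((X - Y) + - (X - L w))%C by ring.
  eapply Rle_trans; [apply Cmod_triangle|]. rewrite Cmod_opp.
  apply Rplus_le_compat; [|lra].
  eapply Rle_trans; [apply Hrem|].
  replace (2 * B * (/ s) ^ 3 * Cmod w ^ 3) with (2 * B * q ^ 3) by (unfold q, Rdiv; rewrite Rpow_mult_distr; ring).
  assert (0 <= B * q ^ 3) by (apply Rmult_le_pos; [assumption | apply pow_le; lra]).
  assert (0 < (1 / 2) ^ N) by (apply pow_lt; lra). nra.
Qed.

(** With [u = F z - F a], the real mean value theorem is applied to [Re (Cconj u * F)] minus |u|
    [phi] along the segment. A majorant [phi] in place of a constant gives integrated bounds;
    derivatives of [F] are asked for only inside the segment, since they may be unknown at its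
    end. *)
Lemma Cmean_value_ineq (F : C -> C) (F' : R -> C) (phi phi' : R -> R) (a z : C) :
  (forall t, 0 <= t <= 1 -> ccont F (pt a z t)) ->
  (forall t, 0 < t < 1 -> cderiv F (pt a z t) (F' t)) ->
  (forall t, 0 <= t <= 1 -> is_derive phi t (phi' t)) ->
  (forall t, 0 < t < 1 -> Cmod (F' t * (z - a)) <= phi' t) ->
  Cmod (F z - F a) <= phi 1 - phi 0.
Proof.
  intros Hc Hd Hphi Hb.
  set (u := (F z - F a)%C).
  destruct (Req_dec (Cmod u) 0) as [H0|H0].
  { rewrite H0.
    assert (H : phi 0 <= phi 1); [|lra].
    (* [MVT_gen] may return an endpoint as intermediate point. The value [0] there keeps the
       required sign, as no bound on the derivative is assumed at the endpoints. *)
    set (df := fun t => if Rlt_dec 0 t then if Rlt_dec t 1 then phi' t else 0 else 0).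
    destruct (MVT_gen phi 0 1 df) as (c & Hc1 & Hc2).
    - rewrite Rmin_left, Rmax_right by lra. intros x Hx. unfold df.
      destruct (Rlt_dec 0 x); [|lra]. destruct (Rlt_dec x 1); [|lra]. apply Hphi. lra.
    - rewrite Rmin_left, Rmax_right by lra. intros x Hx.
      apply continuity_pt_filterlim. apply (ex_derive_continuous (V := R_NormedModule)).
      eexists. apply Hphi. lra.
    - assert (0 <= df c); [|lra]. unfold df. destruct (Rlt_dec 0 c); [|lra].
      destruct (Rlt_dec c 1); [|lra]. eapply Rle_trans; [apply Cmod_ge_0 | apply Hb; lra]. }
  pose proof (Cmod_ge_0 u) as Hu.
  set (G := fun t => (Cconj u * F (pt a z t))%C).
  set (g := fun t => Re (G t) - Cmod u * phi t).
  set (dg := fun t => Re (Cconj u * (F' t * (z - a))) - Cmod u * phi' t).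
  set (df := fun t => if Rlt_dec 0 t then if Rlt_dec t 1 then dg t else 0 else 0).
  destruct (MVT_gen g 0 1 df) as (c & Hc1 & Hc2).
  - rewrite Rmin_left, Rmax_right by lra. intros x Hx. unfold df.
    destruct (Rlt_dec 0 x); [|lra]. destruct (Rlt_dec x 1); [|lra].
    unfold g, dg. apply (is_derive_minus (V := R_NormedModule)).
    + assert (HG : rderiv G x (Cconj u * (F' x * (z - a)))%C).
      { unfold G. apply (rderiv_comp_c (fun y => Cconj u * y)%C (fun t => F (pt a z t)) x (Cconj u)).
        - eapply cderiv_eq; [apply cderiv_mult; [apply cderiv_const | apply cderiv_id]|]. cbv beta. ring.
        - apply (rderiv_comp_c F); [now apply Hd | apply rderiv_pt]. }
      rewrite rderiv_eps in HG.
      split; [apply is_linear_scal_l|]. intros y Hy e.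
      apply (is_filter_lim_locally_unique (V := R_NormedModule)) in Hy. subst y.
      destruct (HG e (cond_pos e)) as [d [Hd0 H1]].
      exists (mkposreal d Hd0). intros y Hy. specialize (H1 y Hy).
      eapply Rle_trans; [|apply H1].
      eapply Rle_trans; [|apply re_le_Cmod]. right.
      unfold norm, minus, plus, opp, scal; simpl. unfold abs, mult; simpl. f_equal. ring.
    + apply is_derive_scal. apply Hphi. lra.
  - rewrite Rmin_left, Rmax_right by lra. intros x Hx.
    unfold g. apply continuity_pt_minus.
    + intros e He.
      assert (HG : rcont G x).
      { unfold G. apply (rcont_comp_c (fun y => Cconj u * F y)%C (pt a z)); [|apply rcont_pt].
        apply ccont_mult; [|now apply Hc]. eapply cderiv_ccont, cderiv_const. }
      destruct (HG e He) as [d [Hd0 H1]]. exists d. split; [assumption|].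
      intros y [_ Hy]. specialize (H1 y Hy). simpl. unfold Rdist.
      eapply Rle_lt_trans; [|apply H1].
      eapply Rle_trans; [|apply re_le_Cmod]. right. f_equal.
    + apply continuity_pt_mult; [apply continuity_pt_const; intros ? ?; reflexivity|].
      apply continuity_pt_filterlim. apply (ex_derive_continuous (V := R_NormedModule)).
      eexists. apply Hphi. lra.
  - assert (Hneg : df c <= 0).
    { unfold df. destruct (Rlt_dec 0 c); [|lra]. destruct (Rlt_dec c 1); [|lra].
      unfold dg. pose proof (re_le_Cmod (Cconj u * (F' c * (z - a)))) as Hr.
      rewrite Cmod_mult, Cmod_conj in Hr. apply Rabs_le_between in Hr.
      specialize (Hb c ltac:(lra)). nra. }
    assert (E : g 1 - g 0 = Cmod u * Cmod u - Cmod u * (phi 1 - phi 0)).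
    { unfold g, G. replace (pt a z 1) with z by (unfold pt; ring).
      replace (pt a z 0) with a by (unfold pt; ring).
      replace (Cmod u * Cmod u) with (Cmod u ^ 2) by ring. rewrite Cmod2_alt.
      unfold u, Re, Im. simpl. ring. }
    rewrite E in Hc2. nra.
Qed.

(** Integrates a first-order expansion of the derivative by the mean value inequality for [N - Q],
    where [Q] is the candidate polynomial. The origin is left out because the differential equation
    gives [w * L' w], not [L' w]. *)
Lemma jet2_primitive N b c K d :
  0 < d -> ccont N 0 ->
  (forall w, Cmod w < d -> w <> 0 ->
     exists l, cderiv N w l /\ Cmod (l - (b + c * w)) <= K * Cmod w ^ 2) ->
  jet2 N (N 0) b (c / 2)%C.
Proof.
  intros Hd Hc H.
  set (Q := fun w => (N 0 + b * w + c / 2 * w ^ 2)%C).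
  assert (HQ : forall w, cderiv Q w (b + c * w)%C).
  { intros w. unfold Q. eapply cderiv_eq.
    - apply cderiv_plus; [apply cderiv_plus; [apply cderiv_const|]|].
      + apply cderiv_mult; [apply cderiv_const | apply cderiv_id].
      + apply cderiv_mult; [apply cderiv_const|]. simpl.
        apply cderiv_mult; [apply cderiv_id|]. apply cderiv_mult; [apply cderiv_id | apply cderiv_const].
    - cbv beta. field. }
  apply (jet2_intro _ _ _ _ (Rabs K) d Hd). intros w Hw.
  destruct (Ceq_dec w 0) as [->|Hw0].
  { replace (N 0 - (N 0 + b * 0 + c / 2 * 0 ^ 2))%C with (RtoC 0) by ring.
    rewrite Cmod_0. simpl. lra. }
  assert (Hwp : 0 < Cmod w) by (now apply Cmod_gt_0).
  assert (Hpt : forall t, 0 < t < 1 -> exists l, cderiv (fun w => N w - Q w)%C (pt 0 w t) l /\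
     Cmod (l * (w - 0)) <= Rabs K * Cmod w ^ 3).
  { intros t Ht.
    replace (pt 0 w t) with (RtoC t * w)%C by (unfold pt; ring).
    assert (Hm : Cmod (t * w) = t * Cmod w) by (rewrite Cmod_mult, Cmod_R, Rabs_pos_eq; lra).
    destruct (H (t * w)%C) as (l & Hl & Hl2).
    - rewrite Hm. nra.
    - apply Cmod_gt_0. rewrite Hm. nra.
    - exists (l - (b + c * (t * w)))%C. split; [now apply cderiv_minus|].
      rewrite Cmod_mult. replace (w - 0)%C with w by ring. simpl in *.
      rewrite Hm in Hl2. pose proof (Rle_abs K). pose proof (Rabs_pos K).
      assert (K * (t * Cmod w * (t * Cmod w * 1)) <= Rabs K * (Cmod w * Cmod w)).
      { apply Rle_trans with (Rabs K * (t * Cmod w * (t * Cmod w * 1))).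
        - apply Rmult_le_compat_r; [nra | assumption].
        - apply Rmult_le_compat_l; [assumption|].
          assert (t * t <= 1) by nra. assert (0 <= Cmod w * Cmod w) by nra. nra. }
      nra. }
  (* The derivative along the segment is known only by existence at each point; [epsilon] turns it
     into a function of [t]. *)
  pose (F' := fun t => epsilon (inhabits (RtoC 0)) (fun l => cderiv (fun w => N w - Q w)%C (pt 0 w t) l /\
     Cmod (l * (w - 0)) <= Rabs K * Cmod w ^ 3)).
  assert (HF' : forall t, 0 < t < 1 -> cderiv (fun w => N w - Q w)%C (pt 0 w t) (F' t) /\
     Cmod (F' t * (w - 0)) <= Rabs K * Cmod w ^ 3).
  { intros t Ht. unfold F'. apply epsilon_spec. now apply Hpt. }
  pose proof (Cmean_value_ineq (fun w => N w - Q w)%C F'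
    (fun t => Rabs K * Cmod w ^ 3 * t) (fun _ => Rabs K * Cmod w ^ 3) 0 w) as HM.
  cbv beta in HM.
  replace (N w - Q w - (N 0 - Q 0))%C with (N w - Q w)%C in HM by (unfold Q; ring).
  rewrite Rmult_1_r, Rmult_0_r, Rminus_0_r in HM.
  apply HM.
  - intros t Ht. destruct (Req_dec t 0) as [->|Ht0].
    + replace (pt 0 w 0) with (RtoC 0) by (unfold pt; ring).
      assert (HQc : ccont Q 0) by (eapply cderiv_ccont, HQ).
      intros e He. destruct (Hc (e / 2)) as [d1 [Hd1 H1]]; [lra|].
      destruct (HQc (e / 2)) as [d2 [Hd2 H2]]; [lra|].
      exists (Rmin d1 d2). split; [now apply Rmin_pos|]. intros v Hv.
      specialize (H1 v (Rlt_le_trans _ _ _ Hv (Rmin_l _ _))).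
      specialize (H2 v (Rlt_le_trans _ _ _ Hv (Rmin_r _ _))).
      replace (N v - Q v - (N 0 - Q 0))%C with ((N v - N 0) - (Q v - Q 0))%C by ring.
      eapply Rle_lt_trans; [apply Cmod_sub_le|]. lra.
    + assert (Hex : exists l, cderiv (fun w => N w - Q w)%C (pt 0 w t) l).
      { replace (pt 0 w t) with (RtoC t * w)%C by (unfold pt; ring).
        assert (Hm : Cmod (t * w) = t * Cmod w) by (rewrite Cmod_mult, Cmod_R, Rabs_pos_eq; lra).
        destruct (H (t * w)%C) as (l & Hl & _).
        - rewrite Hm. nra.
        - apply Cmod_gt_0. rewrite Hm. nra.
        - eexists. apply cderiv_minus; [apply Hl | apply HQ]. }
      destruct Hex as [l Hl]. now apply cderiv_ccont in Hl.
  - intros t Ht. now apply HF'.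
  - intros t Ht. auto_derive; auto; ring.
  - intros t Ht. now apply HF'.
Qed.

(** * Exponential and square root *)

Lemma Cexp_plus a b : Cexp (a + b) = (Cexp a * Cexp b)%C.
Proof.
  unfold Cexp. simpl. unfold Re, Im. simpl. rewrite exp_plus, cos_plus, sin_plus.
  apply injective_projections; simpl; ring.
Qed.

Lemma Cexp_0 : Cexp 0 = 1.
Proof. unfold Cexp; simpl. rewrite exp_0, cos_0, sin_0. apply injective_projections; simpl; ring. Qed.

Lemma Cexp_neg a : (Cexp (- a) * Cexp a = 1)%C.
Proof. rewrite <- Cexp_plus. replace (- a + a)%C with (RtoC 0) by ring. apply Cexp_0. Qed.

Lemma Cexp_neq_0 a : Cexp a <> 0.
Proof.
  intros E. pose proof (Cexp_neg a) as H. rewrite E, Cmult_0_r in H.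
  apply RtoC_inj in H. lra.
Qed.

Lemma Cmod_Cexp z : Cmod (Cexp z) = exp (Re z).
Proof.
  replace (Cexp z) with (RtoC (exp (Re z)) * cis (Im z))%C.
  - rewrite Cmod_mult, Cmod_cis, Cmod_R, Rabs_pos_eq; [ring | left; apply exp_pos].
  - apply injective_projections; unfold Cexp, cis; simpl; ring.
Qed.

Lemma is_derive_eps (f : R -> R) x l e :
  is_derive f x l -> 0 < e ->
  exists d, 0 < d /\ forall u, Rabs (u - x) < d -> Rabs (f u - f x - (u - x) * l) <= e * Rabs (u - x).
Proof.
  intros [_ H] He. destruct (H x (fun P HP => HP) (mkposreal e He)) as [d Hd].
  exists d. split; [apply cond_pos|]. intros u Hu. exact (Hd u Hu).
Qed.

Lemma cderiv_Cexp_0 : cderiv Cexp 0 1.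
Proof.
  rewrite cderiv_eps. intros e He.
  (* The real part costs [4 * e1] and the imaginary part [5 * e1]; [e1 <= 1] serves to bound [exp x]
     by 3. *)
  set (e1 := Rmin 1 (e / 9)).
  assert (He1 : 0 < e1) by (apply Rmin_pos; lra).
  assert (E1 : e1 <= 1) by apply Rmin_l. assert (E2 : e1 <= e / 9) by apply Rmin_r.
  clearbody e1.
  destruct (is_derive_eps exp 0 1 e1) as (d1 & Hd1 & H1);
    [auto_derive; auto; rewrite exp_0; ring | assumption |].
  destruct (is_derive_eps sin 0 1 e1) as (d2 & Hd2 & H2);
    [auto_derive; auto; rewrite cos_0; ring | assumption |].
  destruct (is_derive_eps cos 0 0 e1) as (d3 & Hd3 & H3);
    [auto_derive; auto; rewrite sin_0; ring | assumption |].
  exists (Rmin (Rmin d1 d2) (Rmin d3 e1)). split; [repeat apply Rmin_pos; assumption|].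
  intros u Hu. rewrite Cexp_0. replace (u - 0)%C with u in * by ring.
  destruct u as [x y].
  pose proof (Rmax_Cmod (x, y)) as Hm. simpl in Hm.
  set (m := Cmod (x, y)) in *.
  assert (Hx : Rabs x <= m) by (eapply Rle_trans; [apply Rmax_l | apply Hm]).
  assert (Hy : Rabs y <= m) by (eapply Rle_trans; [apply Rmax_r | apply Hm]).
  assert (M1 : m < d1) by (eapply Rlt_le_trans; [apply Hu|]; eapply Rle_trans; [apply Rmin_l | apply Rmin_l]).
  assert (M2 : m < d2) by (eapply Rlt_le_trans; [apply Hu|]; eapply Rle_trans; [apply Rmin_l | apply Rmin_r]).
  assert (M3 : m < d3) by (eapply Rlt_le_trans; [apply Hu|]; eapply Rle_trans; [apply Rmin_r | apply Rmin_l]).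
  assert (M4 : m < e1) by (eapply Rlt_le_trans; [apply Hu|]; eapply Rle_trans; [apply Rmin_r | apply Rmin_r]).
  specialize (H1 x). specialize (H2 y). specialize (H3 y).
  rewrite Rminus_0_r in H1, H2, H3. rewrite exp_0 in H1. rewrite sin_0 in H2. rewrite cos_0 in H3.
  specialize (H1 ltac:(lra)). specialize (H2 ltac:(lra)). specialize (H3 ltac:(lra)).
  assert (Hm0 : 0 <= m) by apply Cmod_ge_0.
  rewrite Rminus_0_r in H2. rewrite Rmult_1_r in H1, H2. rewrite Rmult_0_r, Rminus_0_r in H3.
  assert (A1 : Rabs (exp x - 1 - x) <= e1 * m) by (eapply Rle_trans; [apply H1|]; nra).
  assert (A2 : Rabs (sin y - y) <= e1 * m) by (eapply Rle_trans; [apply H2|]; nra).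
  assert (A3 : Rabs (cos y - 1) <= e1 * m) by (eapply Rle_trans; [apply H3|]; nra).
  apply Rabs_le_between in A1, A2, A3, Hx, Hy. clear H1 H2 H3.
  assert (HX : 0 < exp x <= 3). { split; [apply exp_pos|]. nra. }
  replace (Cexp (x, y) - 1 - 1 * (x, y))%C
    with (RtoC (exp x * cos y - 1 - x) + Ci * RtoC (exp x * sin y - y))%C
    by (apply injective_projections; unfold Cexp; simpl; ring).
  eapply Rle_trans; [apply Cmod_triangle|]. rewrite Cmod_mult, Cmod_Ci, !Cmod_R.
  assert (B1 : Rabs (exp x * cos y - 1 - x) <= 4 * e1 * m).
  { replace (exp x * cos y - 1 - x) with ((exp x - 1 - x) + exp x * (cos y - 1)) by ring.
    apply Rabs_le_between. nra. }
  assert (B2 : Rabs (exp x * sin y - y) <= 5 * e1 * m).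
  { replace (exp x * sin y - y) with (exp x * (sin y - y) + (exp x - 1) * y) by ring.
    assert (C1 : Rabs (exp x * (sin y - y)) <= 3 * (e1 * m)).
    { rewrite Rabs_mult, (Rabs_pos_eq (exp x)) by lra.
      apply Rmult_le_compat; [lra | apply Rabs_pos | lra | now apply Rabs_le_between]. }
    assert (C2 : Rabs ((exp x - 1) * y) <= (2 * m) * e1).
    { rewrite Rabs_mult. apply Rmult_le_compat; try apply Rabs_pos.
      - apply Rabs_le_between. nra.
      - apply Rabs_le_between. lra. }
    eapply Rle_trans; [apply Rabs_triang|]. lra. }
  rewrite Rmult_1_l. apply Rle_trans with (9 * e1 * m); [lra|].
  apply Rmult_le_compat_r; lra.
Qed.

Lemma cderiv_Cexp z : cderiv Cexp z (Cexp z).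
Proof.
  assert (H : cderiv (fun u => Cexp z * Cexp (u - z))%C z (Cexp z)).
  { eapply cderiv_eq.
    - apply cderiv_mult; [apply cderiv_const|].
      apply (cderiv_comp Cexp (fun u => u - z)%C z 1).
      + replace (z - z)%C with (RtoC 0) by ring. apply cderiv_Cexp_0.
      + eapply cderiv_eq; [apply cderiv_minus; [apply cderiv_id | apply cderiv_const]|]. reflexivity.
    - cbv beta. ring. }
  apply (cderiv_ext_loc _ Cexp z _ 1) in H; [assumption | lra|].
  intros u _. rewrite <- Cexp_plus. f_equal. ring.
Qed.

Lemma Re_Csqrt_pos z : 0 < Re z -> 0 < Re (Csqrt z).
Proof.
  intros H. simpl. apply sqrt_lt_R0. pose proof (Cmod_ge_0 z). lra.
Qed.

(** The factorization of [u - z] as a difference of squares, together with |Csqrt u + Csqrt z| >=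
    [Re (Csqrt z)]: principal roots have nonnegative real part for every [u], so the cut needs no
    case distinction. *)
Lemma Csqrt_ccont z : 0 < Re z -> ccont Csqrt z.
Proof.
  intros Hz e He. pose proof (Re_Csqrt_pos z Hz) as Hs.
  exists (e * Re (Csqrt z)). split; [now apply Rmult_lt_0_compat|].
  intros u Hu.
  assert (Hd : Re (Csqrt z) <= Cmod (Csqrt u + Csqrt z)).
  { eapply Rle_trans; [|apply re_le_Cmod]. eapply Rle_trans; [|apply Rle_abs].
    pose proof (Csqrt_Re_ge_0 u). unfold Re in *. simpl in *. lra. }
  apply (Rmult_lt_reg_r (Re (Csqrt z))); [assumption|].
  eapply Rle_lt_trans; [|apply Hu].
  replace (u - z)%C with ((Csqrt u - Csqrt z) * (Csqrt u + Csqrt z))%C.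
  - rewrite Cmod_mult. apply Rmult_le_compat_l; [apply Cmod_ge_0 | assumption].
  - rewrite <- (Csqrt_sqr u) at 3. rewrite <- (Csqrt_sqr z) at 3. ring.
Qed.

Lemma cderiv_Csqrt z : 0 < Re z -> cderiv Csqrt z (/ (2 * Csqrt z))%C.
Proof.
  intros Hz.
  apply (cderiv_inverse (fun s => s * s)%C Csqrt z _ 1); [lra | | now apply Csqrt_ccont | |].
  - intros u _. apply Csqrt_sqr.
  - eapply cderiv_eq; [apply cderiv_mult; apply cderiv_id|]. cbv beta. ring.
  - intros E. pose proof (Re_Csqrt_pos z Hz) as Hs.
    assert (E2 : Re (2 * Csqrt z) = 0) by (rewrite E; reflexivity).
    replace (Re (2 * Csqrt z)) with (2 * Re (Csqrt z)) in E2 by (unfold Re; simpl; ring). lra.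
Qed.

Lemma Csqrt_1 : Csqrt 1 = 1.
Proof.
  unfold Csqrt. rewrite Cmod_1. simpl.
  replace ((1 + 1) / 2) with 1 by field. replace ((1 - 1) / 2) with 0 by field.
  rewrite sqrt_1, sqrt_0. destruct (Rle_dec 0 0); apply injective_projections; simpl; ring.
Qed.

Lemma Re_1_plus u : Cmod u < 1 -> 1 - Cmod u <= Re (1 + u).
Proof.
  intros H. pose proof (re_le_Cmod u) as Hr. apply Rabs_le_between in Hr.
  unfold Re in *. simpl. lra.
Qed.

Definition psi_AP_deriv (u : C) : C :=
  (Cexp u * Csqrt (1 + u) + Cexp u * / (2 * Csqrt (1 + u)))%C.

Lemma cderiv_psi_AP u : Cmod u < 1 -> cderiv psi_AP u (psi_AP_deriv u).
Proof.
  intros Hu. unfold psi_AP, psi_AP_deriv.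
  apply (cderiv_mult Cexp (fun u => Csqrt (1 + u))); [apply cderiv_Cexp|].
  eapply cderiv_eq.
  - apply (cderiv_comp Csqrt (fun u => 1 + u)%C).
    + apply cderiv_Csqrt. pose proof (Re_1_plus u Hu). lra.
    + apply cderiv_plus; [apply cderiv_const | apply cderiv_id].
  - ring.
Qed.

Lemma psi_AP_neq_0 u : Cmod u < 1 -> psi_AP u <> 0.
Proof.
  intros Hu. unfold psi_AP. apply Cmult_neq_0; [apply Cexp_neq_0|].
  intros E. pose proof (Re_1_plus u Hu).
  pose proof (Re_Csqrt_pos (1 + u) ltac:(lra)) as Hs. rewrite E in Hs. simpl in Hs. lra.
Qed.

Lemma psi_AP_0 : psi_AP 0 = 1.
Proof. unfold psi_AP. rewrite Cexp_0, Cplus_0_r, Csqrt_1. ring. Qed.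

(** The equation [Cexp (2 w) = Cexp w ^ 2] determines the quadratic coefficient. *)
Lemma jet2_Cexp : jet2 Cexp 1 1 (/ 2)%C.
Proof.
  destruct (jet2_analytic Cexp 1) as (a & b & c & H); [lra| |].
  { intros z _. exists (Cexp z). apply cderiv_Cexp. }
  pose proof (jet2_value _ _ _ _ H) as Ha. rewrite Cexp_0 in Ha. subst a.
  pose proof (cderiv_unique _ _ _ _ (jet2_cderiv _ _ _ _ H) cderiv_Cexp_0) as Hb. subst b.
  pose proof (jet2_comp _ _ _ _ _ _ _ H (jet2_poly 0 2 0)) as H1.
  pose proof (jet2_mult _ _ _ _ _ _ _ _ H H) as H2.
  apply (jet2_ext _ (fun w => Cexp w * Cexp w)%C _ _ _ 1) in H1; [|lra|].
  - destruct (jet2_unique _ _ _ _ _ _ _ H1 H2) as (_ & _ & E).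
    eapply jet2_eq; [apply H | reflexivity | reflexivity |].
    assert (E2 : (2 * c = 1)%C).
    { replace (2 * c)%C with ((1 * 0 + c * (2 * 2)) - (1 * c + 1 * 1 + c * 1) + 1)%C by ring.
      rewrite E. ring. }
    replace c with (2 * c / 2)%C by field. rewrite E2. field.
  - intros w _. rewrite <- Cexp_plus. f_equal. ring.
Qed.

(** The square has expansion [1 + w], which forces 2 b = 1 and 2 c + b^2 = 0. *)
Lemma jet2_Csqrt : jet2 (fun w => Csqrt (1 + w)) 1 (/ 2)%C (- / 8)%C.
Proof.
  destruct (jet2_analytic (fun w => Csqrt (1 + w)) 1) as (a & b & c & H); [lra| |].
  { intros u Hu. pose proof (Re_1_plus u Hu). unfold disc in Hu. eexists. 
    apply (cderiv_comp Csqrt (fun u => 1 + u)%C).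
    - apply cderiv_Csqrt. lra.
    - apply cderiv_plus; [apply cderiv_const | apply cderiv_id]. }
  pose proof (jet2_value _ _ _ _ H) as Ha. cbv beta in Ha.
  rewrite Cplus_0_r, Csqrt_1 in Ha. subst a.
  pose proof (jet2_mult _ _ _ _ _ _ _ _ H H) as H2.
  apply (jet2_ext _ (fun w => 1 + 1 * w + 0 * w ^ 2)%C _ _ _ 1) in H2; [|lra|].
  - destruct (jet2_unique _ _ _ _ _ _ _ H2 (jet2_poly 1 1 0)) as (_ & E1 & E2).
    assert (Hb : b = (/ 2)%C).
    { replace b with ((1 * b + b * 1) / 2)%C by field. rewrite E1. field. }
    subst b. eapply jet2_eq; [apply H | reflexivity | reflexivity |].
    replace c with (((1 * c + / 2 * / 2 + c * 1) - / 2 * / 2) / 2)%C by field.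
    rewrite E2. field.
  - intros w _. rewrite Csqrt_sqr. ring.
Qed.

Lemma jet2_psi_AP : jet2 psi_AP 1 (3 / 2)%C (7 / 8)%C.
Proof.
  eapply jet2_eq; [apply (jet2_mult _ _ _ _ _ _ _ _ jet2_Cexp jet2_Csqrt) | | |]; field.
Qed.

(** * Coefficients of Schwarz functions *)

Lemma Cmod_1_plus_sqr (v : C) : Cmod (1 + v) ^ 2 = 1 + Cmod v ^ 2 + 2 * Re v.
Proof. rewrite !Cmod2_alt. unfold Re, Im; simpl. ring. Qed.

(** Dual form of the Schwarz-Pick bound: average [om] against the kernel
    [z^-2 (1 + lam z / 2)^2], whose modulus has mean [1 + |lam|^2 / 4] as [r] tends to [1]. *)
Lemma schwarz_functional om lam :
  schwarz_function om ->
  Cmod (coef om (1 / 2) 2 + lam * coef om (1 / 2) 1) <= 1 + Cmod lam ^ 2 / 4.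
Proof.
  intros (Han & H0 & Hb). pose proof PI_RGT_0 as Hpi.
  set (a1 := coef om (1 / 2) 1). set (a2 := coef om (1 / 2) 2).
  assert (Ha0 : coef om (1 / 2) 0 = 0).
  { rewrite <- H0. symmetry.
    eapply jet2_value, expands_jet2, (coef_expands om 1); [assumption | lra]. }
  assert (Hr : forall r, 0 < r < 1 -> Cmod (a2 + lam * a1) <= / r ^ 2 + Cmod lam ^ 2 / 4).
  { intros r Hr.
    assert (E : forall n, coef om r n = coef om (1 / 2) n)
      by (intros n; apply (coef_indep om 1); try assumption; lra).
    pose proof (coef_integral om 1 r 0 Han Hr) as I0. rewrite E, Ha0 in I0.
    pose proof (coef_integral om 1 r 1 Han Hr) as I1. rewrite E in I1. fold a1 in I1.
    pose proof (coef_integral om 1 r 2 Han Hr) as I2. rewrite E in I2. fold a2 in I2.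
    (* The weights [1], [lam] and [lam * lam / 4] complete the square [(1 + lam * z / 2) ^ 2]; the
       last one is free of charge because the coefficient of index [0] vanishes. *)
    pose proof (is_CInt_plus _ _ _ _ _ _ (is_CInt_plus _ _ _ _ _ _ I2 (is_CInt_cmult lam _ _ _ _ I1))
       (is_CInt_cmult (lam * lam / 4)%C _ _ _ _ I0)) as I.
    replace (RtoC (2 * PI) * a2 + lam * (RtoC (2 * PI) * a1) + lam * lam / 4 * (RtoC (2 * PI) * 0))%C
      with (RtoC (2 * PI) * (a2 + lam * a1))%C in I by ring.
    (* This is the cross term of |1 + lam z / 2|^2, which has mean zero on the circle. *)
    assert (Hc : is_RInt (fun t => Re (lam * circ r t)) 0 (2 * PI) 0).
    { pose proof (is_CInt_cmult (lam * RtoC r)%C _ _ _ _ (is_CInt_cis 1 1 (le_n 1) (or_introl eq_refl))) as J.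
      rewrite Cmult_0_r in J.
      apply (is_CInt_ext _ (fun t => lam * circ r t)%C) in J.
      - exact (is_RInt_fct_extend_fst (U := R_NormedModule) (V := R_NormedModule) _ _ _ _ J).
      - intros t. rewrite Rmult_1_l. unfold circ. ring. }
    assert (Hg : is_RInt (fun t => (1 + Cmod lam ^ 2 * r ^ 2 / 4) * / r ^ 2 + / r ^ 2 * Re (lam * circ r t))
       0 (2 * PI) (2 * PI * ((1 + Cmod lam ^ 2 * r ^ 2 / 4) * / r ^ 2))).
    { pose proof (is_RInt_plus _ _ _ _ _ _ (is_RInt_const 0 (2 * PI) ((1 + Cmod lam ^ 2 * r ^ 2 / 4) * / r ^ 2))
         (is_RInt_scal _ _ _ (/ r ^ 2) _ Hc)) as J.
      cbv [plus scal mult] in J; simpl in J. 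
      replace (2 * PI * ((1 + Cmod lam ^ 2 * r ^ 2 / 4) * / r ^ 2)) with
        ((2 * PI - 0) * ((1 + Cmod lam ^ 2 * r ^ 2 / 4) * / r ^ 2) + / r ^ 2 * 0) by ring.
      exact J. }
    assert (Hr2 : 0 < r ^ 2) by (apply pow_lt; lra).
    assert (HB : Cmod (RtoC (2 * PI) * (a2 + lam * a1)) <= 2 * PI * ((1 + Cmod lam ^ 2 * r ^ 2 / 4) * / r ^ 2)).
    { eapply is_CInt_le; [| | exact I | exact Hg]; [lra|]. intros t _. cbv beta.
      pose proof (circ_neq_0 r t (proj1 Hr)) as Hz.
      pose proof (Cmod_circ r t ltac:(lra)) as Hcm.
      specialize (Hb (circ r t)). unfold disc in Hb. rewrite Hcm in Hb. specialize (Hb (proj2 Hr)).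
      set (z := circ r t) in *.
      replace (om z * / z ^ 2 + lam * (om z * / z ^ 1) + lam * lam / 4 * (om z * / z ^ 0))%C
        with (om z * / z ^ 2 * (1 + lam * z / 2) ^ 2)%C by (simpl; field; assumption).
      rewrite !Cmod_mult, Cmod_inv, !Cmod_pow, Hcm by now apply Cpow_nz.
      rewrite Cmod_1_plus_sqr.
      replace (Cmod (lam * z / 2) ^ 2) with (Cmod lam ^ 2 * r ^ 2 / 4).
      2: { unfold Cdiv. rewrite !Cmod_mult, Cmod_inv, Hcm, Cmod_R, Rabs_pos_eq; [field | lra |].
           intros E2. apply RtoC_inj in E2. lra. }
      replace (2 * Re (lam * z / 2)) with (Re (lam * z)).
      2: { replace (lam * z)%C with (2 * (lam * z / 2))%C at 1 by field.
           unfold Re. simpl. ring. }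
      assert (HP : 0 <= 1 + Cmod lam ^ 2 * r ^ 2 / 4 + Re (lam * z)).
      { replace (1 + Cmod lam ^ 2 * r ^ 2 / 4 + Re (lam * z)) with (Cmod (1 + lam * z / 2) ^ 2).
        - apply pow_le, Cmod_ge_0.
        - rewrite Cmod_1_plus_sqr. 
          replace (2 * Re (lam * z / 2)) with (Re (lam * z)).
          + unfold Cdiv. rewrite !Cmod_mult, Cmod_inv, Hcm, Cmod_R, Rabs_pos_eq; [field | lra |].
            intros E2. apply RtoC_inj in E2. lra.
          + replace (lam * z)%C with (2 * (lam * z / 2))%C at 1 by field.
            unfold Re. simpl. ring. }
      pose proof (Rinv_0_lt_compat _ Hr2). pose proof (Cmod_ge_0 (om z)).
      rewrite <- (Rmult_1_l ((1 + Cmod lam ^ 2 * r ^ 2 / 4) * / r ^ 2 + _)).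
      rewrite Rmult_assoc. apply Rmult_le_compat; try lra.
      apply Rmult_le_pos; lra. }
    rewrite Cmod_mult, Cmod_R, Rabs_pos_eq in HB by lra.
    apply Rmult_le_reg_l in HB; [|lra].
    eapply Rle_trans; [apply HB|]. right. field. lra. }
  set (X := Cmod (a2 + lam * a1)) in *. set (Y := Cmod lam ^ 2 / 4) in *.
  (* A single radius replaces the limit: if [X > 1 + Y], then [q = / (X - Y)] is below [1], and
     [r ^ 2 = (1 + q) / 2] lies strictly between [q] and [1], against [X - Y <= / r ^ 2]. *)
  destruct (Rle_dec X (1 + Y)) as [|Hn]; [assumption|]. exfalso.
  assert (Hq : 0 < / (X - Y) < 1).
  { split; [apply Rinv_0_lt_compat; lra|]. rewrite <- Rinv_1. apply Rinv_lt_contravar; lra. }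
  set (q := / (X - Y)) in *.
  assert (Hs : 0 < sqrt ((1 + q) / 2) < 1).
  { split; [apply sqrt_lt_R0; lra|].
    apply Rlt_le_trans with (sqrt 1); [apply sqrt_lt_1; lra | rewrite sqrt_1; lra]. }
  specialize (Hr _ Hs). rewrite pow2_sqrt in Hr by lra.
  assert (H1 : X - Y <= / ((1 + q) / 2)) by lra.
  assert (H2 : / q = X - Y) by (unfold q; apply Rinv_inv).
  rewrite <- H2 in H1.
  apply Rinv_le_contravar in H1; [|apply Rinv_0_lt_compat; lra].
  rewrite !Rinv_inv in H1. lra.
Qed.

(** With |lam| = 2 |c1| and the phase of [lam] aligned, the dual form reads |c2| + 2 |c1|^2 <= 1 +
    |c1|^2. For [c2 = 0] there is no phase to align with, and [lam = 2 * Cconj c1] suffices. *)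
Lemma schwarz_coeffs om :
  schwarz_function om ->
  exists c1 c2, jet2 om 0 c1 c2 /\ Cmod c2 <= 1 - Cmod c1 ^ 2.
Proof.
  intros Hom. exists (coef om (1 / 2) 1), (coef om (1 / 2) 2).
  pose proof (schwarz_functional om) as HF.
  destruct Hom as (Han & H0 & Hb).
  assert (HJ : jet2 om (coef om (1 / 2) 0) (coef om (1 / 2) 1) (coef om (1 / 2) 2)).
  { apply expands_jet2, (coef_expands om 1); [assumption | lra]. }
  split.
  - eapply jet2_eq; [apply HJ | | reflexivity | reflexivity].
    rewrite <- H0. symmetry. eapply jet2_value, HJ.
  - set (a1 := coef om (1 / 2) 1) in *. set (a2 := coef om (1 / 2) 2) in *.
    pose proof (Cmod_ge_0 a1) as Hm1. pose proof (Cmod_ge_0 a2) as Hm2.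
    assert (Ha1 : (Cconj a1 * a1)%C = RtoC (Cmod a1 ^ 2)) by (rewrite Cmod2_conj; ring).
    destruct (Ceq_dec a2 0) as [E|E].
    + specialize (HF (2 * Cconj a1)%C (conj Han (conj H0 Hb))).
      rewrite E, Cmod_0 in *.
      replace (0 + 2 * Cconj a1 * a1)%C with (2 * (Cconj a1 * a1))%C in HF by ring.
      rewrite Ha1, !Cmod_mult, Cmod_conj, !Cmod_R in HF.
      rewrite !Rabs_pos_eq in HF by (try apply pow_le; lra). simpl in *. nra.
    + (* [lam] is chosen so that [lam a1] is a positive multiple of [a2]. *)
      assert (Hp : 0 < Cmod a2) by now apply Cmod_gt_0.
      assert (Hpn : RtoC (Cmod a2) <> 0) by (intros E2; apply RtoC_inj in E2; lra).
      specialize (HF (2 * Cconj a1 * (a2 / RtoC (Cmod a2)))%C (conj Han (conj H0 Hb))).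
      replace (a2 + 2 * Cconj a1 * (a2 / RtoC (Cmod a2)) * a1)%C
        with (a2 / RtoC (Cmod a2) * RtoC (Cmod a2 + 2 * Cmod a1 ^ 2))%C in HF.
      2: { rewrite RtoC_plus, RtoC_mult, <- Ha1. field. assumption. }
      assert (Hu : Cmod (a2 / RtoC (Cmod a2)) = 1).
      { rewrite Cmod_div, Cmod_R, Rabs_pos_eq by (try assumption; lra). field. lra. }
      rewrite !Cmod_mult, Hu, Cmod_conj, !Cmod_R, !Rabs_pos_eq in HF
        by (try (pose proof (pow2_ge_0 (Cmod a1))); lra).
      simpl in *. nra.
Qed.

(** * The inverse logarithmic coefficients in terms of the Schwarz function *)

Lemma Cinv_0 : (/ 0)%C = 0.
Proof. unfold Cinv; simpl. apply injective_projections; simpl; unfold Rdiv; ring. Qed.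

(** From [g w = w * Cexp (L w)] the inverse is differentiable wherever [L] is, with derivative
    [Cexp (L w) * (1 + w * l)]. The chain rule for [f (g u) = u] then turns into the equation, since
    [g w = w * Cexp (L w)] is also the numerator factor of the starlike quotient. *)
Lemma log_quotient_ode f om g L w l :
  analytic_on (disc 1) f ->
  (forall z, disc 1 z -> starlike_quotient f z = psi_AP (om z)) ->
  is_inverse_quarter f g ->
  (forall w, disc (1 / 4) w -> g w = (w * Cexp (L w))%C) ->
  disc (1 / 4) w -> w <> 0 -> cderiv L w l ->
  (psi_AP (om (g w)) * (1 + w * l) = 1)%C.
Proof.
  intros Han Hq Hg HgL Hw Hw0 Hl.
  destruct (Hg w Hw) as [Hgd Hfg].
  assert (Hd0 : 0 < 1 / 4 - Cmod w) by (unfold disc in Hw; lra).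
  assert (Hnear : forall u, Cmod (u - w) < 1 / 4 - Cmod w -> disc (1 / 4) u).
  { intros u Hu. pose proof (Cmod_sub_ge u w). unfold disc. lra. }
  assert (Hgd1 : cderiv g w (1 * Cexp (L w) + w * (Cexp (L w) * l))%C).
  { apply (cderiv_ext_loc (fun u => u * Cexp (L u))%C g w _ _ Hd0).
    - intros u Hu. symmetry. apply HgL. now apply Hnear.
    - apply (cderiv_mult (fun u => u) (fun u => Cexp (L u))); [apply cderiv_id|].
      apply cderiv_comp; [apply cderiv_Cexp | assumption]. }
  pose proof (C_derive_correct f (g w) 0 (Han _ Hgd)) as Hm.
  pose proof (cderiv_comp f g w _ _ Hm Hgd1) as Hcomp.
  apply (cderiv_ext_loc _ (fun u => u) w _ _ Hd0) in Hcomp.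
  2: { intros u Hu. apply Hg. now apply Hnear. }
  pose proof (cderiv_unique _ _ _ _ Hcomp (cderiv_id w)) as E.
  rewrite <- (Hq _ Hgd). unfold starlike_quotient.
  rewrite (HgL w Hw) in *. 
  assert (HE := Cexp_neq_0 (L w)).
  destruct (Ceq_dec (w * Cexp (L w))%C 0) as [E0|_].
  { exfalso. revert E0. now apply Cmult_neq_0. }
  rewrite Hfg. etransitivity; [|exact E]. field. assumption.
Qed.

Lemma inverse_log_coeffs_formula f om Gamma c1 c2 :
  class_A f -> schwarz_function om ->
  (forall z, disc 1 z -> starlike_quotient f z = psi_AP (om z)) ->
  inverse_log_coeffs f Gamma -> jet2 om 0 c1 c2 ->
  Gamma 1%nat = (- (3 / 4) * c1)%C /\
  Gamma 2%nat = (29 / 32 * c1 ^ 2 - 3 / 8 * c2)%C.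
Proof.
  intros (Hf & Hf0 & _) (Hoan & Ho0 & Hob) Hq (g & L & Hg & (HLan & HL0 & HL) & HS) Hom.
  (* If [g 0] were another zero of [f], the quotient there would be [0] by the convention on
     division, whereas [psi_AP] has no zero in the disc. *)
  assert (Hg0 : g 0 = 0).
  { destruct (Hg 0) as [Hd Hfg]; [unfold disc; rewrite Cmod_0; lra|].
    destruct (Ceq_dec (g 0) 0) as [|Hne]; [assumption|]. exfalso.
    specialize (Hq _ Hd). unfold starlike_quotient in Hq.
    destruct (Ceq_dec (g 0) 0) as [|_]; [contradiction|].
    rewrite Hfg in Hq. unfold Cdiv in Hq. rewrite Cinv_0, Cmult_0_r in Hq.
    apply (psi_AP_neq_0 (om (g 0))); [now apply Hob | now symmetry]. }
  assert (HgL : forall w, disc (1 / 4) w -> g w = (w * Cexp (L w))%C).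
  { intros w Hw. destruct (Ceq_dec w 0) as [->|Hne]; [rewrite Hg0; ring|].
    rewrite HL by assumption. field. assumption. }
  assert (HLj : jet2 L 0 (2 * Gamma 1%nat)%C (2 * Gamma 2%nat)%C).
  { apply (series_jet2 (fun k => match k with O => 0 | S _ => 2 * Gamma k end)%C L (1 / 4)); [lra|].
    intros w Hw. unfold cseries. apply (is_series_decr_1 (K := C_AbsRing) (V := C_NormedModule)).
    match goal with |- is_series _ ?l => replace l with (L w) end.
    - eapply is_series_ext; [|apply (HS w Hw)]. intros n. simpl. ring.
    - change (L w = (L w + - (0 * w ^ 0))%C). ring. }
  (* The factor [w] shifts degrees: only the first coefficient of [L] reaches the quadratic term of
     [g]. *)
  assert (Hgj : jet2 g 0 1 (2 * Gamma 1%nat)%C).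
  { apply (jet2_ext (fun w => (0 + 1 * w + 0 * w ^ 2) * Cexp (L w))%C _ _ _ _ (1 / 4)); [lra| |].
    - intros w Hw. rewrite (HgL w Hw). ring.
    - eapply jet2_eq; [apply jet2_mult; [apply jet2_poly | apply (jet2_comp _ _ _ _ _ _ _ jet2_Cexp HLj)]| | |];
        ring. }
  assert (Hogj : jet2 (fun w => om (g w)) 0 c1 (c1 * (2 * Gamma 1%nat) + c2)%C).
  { eapply jet2_eq; [apply (jet2_comp _ _ _ _ _ _ _ Hom Hgj) | | |]; ring. }
  pose proof (jet2_inv _ _ _ (jet2_comp _ _ _ _ _ _ _ jet2_psi_AP Hogj)) as Hinv.
  cbv beta in Hinv.
  (* [b] and [c] are the coefficients of [/ psi_AP (om (g w))], that is of [1 + w * L' w]. [c] still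
     contains [Gamma 1], which the first-order comparison supplies at the end. *)
  set (b := (- (3 / 2 * c1))%C) in Hinv.
  set (c := (3 / 2 * c1 * (3 / 2 * c1) - (3 / 2 * (c1 * (2 * Gamma 1%nat) + c2) + 7 / 8 * (c1 * c1)))%C) in Hinv.
  destruct Hinv as (K & d & Hd & HK).
  assert (HLp : jet2 L (L 0) b (c / 2)%C).
  { apply (jet2_primitive L b c K (Rmin d (1 / 4))); [apply Rmin_pos; lra | |].
    - destruct (analytic_cderiv _ _ 0 HLan) as [l Hl]; [unfold disc; rewrite Cmod_0; lra|].
      now apply cderiv_ccont in Hl.
    - intros w Hw Hw0.
      assert (Hw1 : Cmod w < d) by (eapply Rlt_le_trans; [apply Hw | apply Rmin_l]).
      assert (Hw2 : disc (1 / 4) w) by (eapply Rlt_le_trans; [apply Hw | apply Rmin_r]).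
      destruct (analytic_cderiv _ _ w HLan Hw2) as [l Hl].
      exists l. split; [assumption|].
      pose proof (log_quotient_ode f om g L w l Hf Hq Hg HgL Hw2 Hw0 Hl) as E.
      specialize (HK w Hw1).
      assert (Hpsi := psi_AP_neq_0 (om (g w)) (Hob _ (proj1 (Hg w Hw2)))).
      assert (E2 : (/ psi_AP (om (g w)))%C = (1 + w * l)%C).
      { replace (1 + w * l)%C with (/ psi_AP (om (g w)) * (psi_AP (om (g w)) * (1 + w * l)))%C
          by (field; assumption).
        rewrite E. ring. }
      rewrite E2 in HK.
      assert (Hp : 0 < Cmod w) by now apply Cmod_gt_0.
      (* Cancelling |w| lowers the error from cubic to quadratic, the order that [jet2_primitive]
         expects of a derivative. *)
      apply (Rmult_le_reg_l (Cmod w)); [assumption|].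
      rewrite <- Cmod_mult.
      replace (w * (l - (b + c * w)))%C with (1 + w * l - (1 + b * w + c * w ^ 2))%C by ring.
      eapply Rle_trans; [apply HK|]. simpl. lra. }
  destruct (jet2_unique _ _ _ _ _ _ _ HLj HLp) as (_ & E1 & E2).
  assert (G1 : Gamma 1%nat = (- (3 / 4) * c1)%C).
  { replace (Gamma 1%nat) with (2 * Gamma 1%nat / 2)%C by field. rewrite E1. unfold b. field. }
  split; [assumption|].
  replace (Gamma 2%nat) with (2 * Gamma 2%nat / 2)%C by field. rewrite E2. unfold c. rewrite G1. field.
Qed.

(** [x0] is the modulus of [c1] at which 29/32 x^2 = 3/8 (1 - x^2), where the lower estimate of
    |Gamma 2| changes sign; there |Gamma 1| is 3/4 [x0]. *)
Lemma critical_point :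
  let x0 := 2 * (sqrt 3 / sqrt 41) in
  0 < x0 /\ x0 ^ 2 = 12 / 41 /\ 3 * sqrt 3 / (2 * sqrt 41) = 3 / 4 * x0.
Proof.
  intros x0. pose proof (sqrt_lt_R0 3 ltac:(lra)). pose proof (sqrt_lt_R0 41 ltac:(lra)).
  pose proof (pow2_sqrt 3 ltac:(lra)) as E3. pose proof (pow2_sqrt 41 ltac:(lra)) as E41.
  unfold x0. repeat split.
  - apply Rmult_lt_0_compat; [lra|]. now apply Rdiv_lt_0_compat.
  - unfold Rdiv. rewrite !Rpow_mult_distr, pow_inv, E3, E41. field.
  - field. lra.
Qed.

(** With x = |c1| in [0, 1], the triangle inequality bounds the difference above by 3/8 + 17/32 x^2
    - 3/4 x, which is at most 3/8. *)
Lemma coefficient_bounds (c1 c2 : C) :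
  Cmod c2 <= 1 - Cmod c1 ^ 2 ->
  - (3 * sqrt 3 / (2 * sqrt 41)) <=
    Cmod (29 / 32 * c1 ^ 2 - 3 / 8 * c2) - Cmod (- (3 / 4) * c1) <= 3 / 8.
Proof.
  intros H. destruct critical_point as (Hx0 & Hx2 & ->).
  set (x0 := 2 * (sqrt 3 / sqrt 41)) in *.
  pose proof (Cmod_ge_0 c1). pose proof (Cmod_ge_0 c2).
  assert (E1 : Cmod (- (3 / 4) * c1) = 3 / 4 * Cmod c1).
  { rewrite Cmod_mult, Cmod_opp, <- RtoC_div, Cmod_R, Rabs_pos_eq by lra. ring. }
  assert (E2 : Cmod (29 / 32 * c1 ^ 2) = 29 / 32 * Cmod c1 ^ 2).
  { rewrite Cmod_mult, Cmod_pow, <- RtoC_div, Cmod_R, Rabs_pos_eq by lra. ring. }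
  assert (E3 : Cmod (3 / 8 * c2) = 3 / 8 * Cmod c2).
  { rewrite Cmod_mult, <- RtoC_div, Cmod_R, Rabs_pos_eq by lra. ring. }
  pose proof (Cmod_sub_le (29 / 32 * c1 ^ 2) (3 / 8 * c2)) as U.
  pose proof (Cmod_sub_ge (29 / 32 * c1 ^ 2) (3 / 8 * c2)) as W.
  pose proof (Cmod_ge_0 (29 / 32 * c1 ^ 2 - 3 / 8 * c2)).
  rewrite E2, E3 in U, W. rewrite E1.
  set (x := Cmod c1) in *. set (G := Cmod (29 / 32 * c1 ^ 2 - 3 / 8 * c2)) in *.
  assert (Hx1 : x <= 1) by nra.
  split; [|nra].
  (* Up to [x0], |Gamma 2| >= 0 is enough. Beyond it the lower estimate is 41/32 x^2 - 3/8 - 3/4 x;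
     its vertex 12/41 lies to the left of [x0], so it increases from its value - 3/4 [x0]. *)
  destruct (Rle_dec x x0) as [Hx|Hx]; [lra|].
  assert (12 / 41 <= x0) by nra. nra.
Qed.

(** * Existence of extremal functions *)

(** The difference [(2 + x) * exp (- x) - (2 - x)] vanishes at [0] and has derivative
    [1 - (1 + x) * exp (- x)], nonnegative by [1 + x <= exp x]. *)
Lemma exp_le_Pade x : 0 <= x < 2 -> exp x <= (2 + x) / (2 - x).
Proof.
  intros Hx.
  set (g := fun x => (2 + x) * exp (- x) - (2 - x)).
  destruct (MVT_gen g 0 x
     (fun x => 1 - (1 + x) * exp (- x))) as (c & Hc & E).
  - intros y _. unfold g. auto_derive; auto. ring.
  - intros y _. apply continuity_pt_filterlim.
    apply (ex_derive_continuous (V := R_NormedModule) g). unfold g. auto_derive; auto.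
  - rewrite Rmin_left, Rmax_right in Hc by lra.
    assert (H1 : (1 + c) * exp (- c) <= 1).
    { rewrite exp_Ropp. apply (Rmult_le_reg_r (exp c)); [apply exp_pos|].
      rewrite Rmult_assoc, Rinv_l by (pose proof (exp_pos c); lra).
      pose proof (exp_ineq1_le c). lra. }
    unfold g in E. rewrite Ropp_0, exp_0 in E.
    assert (H2 : 2 - x <= (2 + x) * exp (- x)) by nra.
    apply Rle_div_r; [lra|].
    apply (Rmult_le_compat_l (exp x)) in H2; [|left; apply exp_pos].
    rewrite exp_Ropp in H2.
    replace (exp x * ((2 + x) * / exp x)) with (2 + x) in H2
      by (field; pose proof (exp_pos x); lra).
    exact H2.
Qed.

(** The mean value inequality with majorant [exp (t * Cmod u)], instead of comparing power
    series. *)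
Lemma Cmod_Cexp_sub_1 u : Cmod (Cexp u - 1) <= exp (Cmod u) - 1.
Proof.
  pose proof (Cmean_value_ineq Cexp (fun t => Cexp (pt 0 u t)) (fun t => exp (t * Cmod u))
    (fun t => Cmod u * exp (t * Cmod u)) 0 u) as H.
  cbv beta in H. rewrite Cexp_0, Rmult_1_l, Rmult_0_l, exp_0 in H. apply H.
  - intros t _. eapply cderiv_ccont, cderiv_Cexp.
  - intros t _. apply cderiv_Cexp.
  - intros t _. auto_derive; auto. ring.
  - intros t Ht. rewrite Cmod_mult. replace (u - 0)%C with u by ring. rewrite Rmult_comm.
    apply Rmult_le_compat_l; [apply Cmod_ge_0|]. rewrite Cmod_Cexp.
    replace (pt 0 u t) with (RtoC t * u)%C by (unfold pt; ring).
    assert (Hle : Re (t * u) <= t * Cmod u).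
    { pose proof (re_le_Cmod u) as Hr. apply Rabs_le_between in Hr.
      replace (Re (t * u)) with (t * Re u) by (unfold Re; simpl; ring). nra. }
    destruct Hle as [Hle|Hle]; [left; now apply exp_increasing | rewrite Hle; lra].
Qed.

(** The coefficient 3/2 is the derivative of [psi_AP] at [0], so the linear term is exact. The
    radius 9/20 is what the extremal [om] reach for |z| <= 1/2. The square root [s] is estimated
    through [(s - 1) * (s + 1) = u] and a lower bound for [Re s]. *)
Lemma psi_AP_sub_1 u :
  Cmod u <= 9 / 20 -> Cmod (psi_AP u - 1) <= 3 / 2 * (Cmod u + Cmod u ^ 2).
Proof.
  intros Hu. pose proof (Cmod_ge_0 u) as Hu0. set (U := Cmod u) in *.
  assert (HE : Cmod (Cexp u - 1) <= U + 13 / 20 * U ^ 2).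
  { eapply Rle_trans; [apply Cmod_Cexp_sub_1|]. fold U.
    pose proof (exp_le_Pade U ltac:(lra)) as Hp.
    assert ((2 + U) / (2 - U) <= 1 + U + 13 / 20 * U ^ 2); [|lra].
    apply Rle_div_l; [lra|]. simpl. nra. }
  pose proof (Re_1_plus u ltac:(fold U; lra)) as Hre. fold U in Hre.
  set (s := Csqrt (1 + u)) in *.
  assert (Hs2 : (s * s)%C = (1 + u)%C) by apply Csqrt_sqr.
  assert (Hs : Cmod s <= 1 + U / 2).
  { assert (Cmod s * Cmod s <= 1 + U).
    { rewrite <- Cmod_mult, Hs2. eapply Rle_trans; [apply Cmod_triangle|]. rewrite Cmod_1. fold U. lra. }
    pose proof (Cmod_ge_0 s). nra. }
  assert (Hres : 1 - 6 / 10 * U <= Re s).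
  { unfold s. change (1 - 6 / 10 * U <= sqrt ((Cmod (1 + u) + Re (1 + u)) / 2)).
    pose proof (re_le_Cmod (1 + u)) as Hr. apply Rabs_le_between in Hr.
    apply Rle_trans with (sqrt (1 - U)).
    - rewrite <- (sqrt_pow2 (1 - 6 / 10 * U)) by lra. apply sqrt_le_1_alt. simpl. nra.
    - apply sqrt_le_1_alt. lra. }
  assert (Hs1 : Cmod (s - 1) <= U / 2 + 7 / 40 * U ^ 2).
  { assert (Hd : 2 - 6 / 10 * U <= Cmod (s + 1)).
    { pose proof (re_le_Cmod (s + 1)) as Hr. apply Rabs_le_between in Hr.
      replace (Re (s + 1)) with (Re s + 1) in Hr by (unfold Re; simpl; ring). lra. }
    assert (Hm : Cmod (s - 1) * Cmod (s + 1) = U).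
    { rewrite <- Cmod_mult. unfold U. f_equal.
      replace ((s - 1) * (s + 1))%C with (s * s - 1)%C by ring. rewrite Hs2. ring. }
    pose proof (Cmod_ge_0 (s - 1)).
    assert (Cmod (s - 1) * (2 - 6 / 10 * U) <= U) by nra.
    apply (Rmult_le_reg_r (2 - 6 / 10 * U)); [lra|]. simpl. nra. }
  unfold psi_AP. fold s.
  replace (Cexp u * s - 1)%C with ((Cexp u - 1) * s + (s - 1))%C by ring.
  eapply Rle_trans; [apply Cmod_triangle|]. rewrite Cmod_mult.
  assert (HP : Cmod (Cexp u - 1) * Cmod s <= (U + 13 / 20 * U ^ 2) * (1 + U / 2))
    by (apply Rmult_le_compat; try apply Cmod_ge_0; assumption).
  simpl in *. assert (U * U * U <= 9 / 20 * (U * U)) by nra. nra.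
Qed.

(** 133/200 is the bound on |h|; the value 2 is the one for which |w| < 1/4 sends the disc of radius
    1/2 into itself. *)
Lemma exp_665 : exp (133 / 200) <= 2.
Proof.
  replace (133 / 200) with (133 / 400 + 133 / 400) by field. rewrite exp_plus.
  pose proof (exp_le_Pade (133 / 400) ltac:(lra)). pose proof (exp_pos (133 / 400)).
  assert ((2 + 133 / 400) / (2 - 133 / 400) <= 7 / 5) by (apply Rle_div_l; lra). nra.
Qed.

Lemma contraction_fixpoint (T : C -> C) rho q :
  0 <= rho -> 0 <= q < 1 ->
  (forall z, Cmod z <= rho -> Cmod (T z) <= rho) ->
  (forall y z, Cmod y <= rho -> Cmod z <= rho -> Cmod (T y - T z) <= q * Cmod (y - z)) ->
  exists p, Cmod p <= rho /\ T p = p.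
Proof.
  intros Hrho Hq Hself Hlip.
  set (u := fun n => Nat.iter n T (RtoC 0)).
  assert (Hu : forall n, Cmod (u n) <= rho).
  { induction n as [|n IH]; [simpl; now rewrite Cmod_0 | now apply (Hself (u n))]. }
  destruct (geometric_Cauchy u rho q Hq) as [p Hp].
  { induction n as [|n IH].
    - simpl. replace (T 0 - 0)%C with (T 0) by ring. rewrite Rmult_1_r. apply Hself. now rewrite Cmod_0.
    - change (Cmod (T (u (S n)) - T (u n)) <= rho * q ^ S n).
      eapply Rle_trans; [apply Hlip; apply Hu|].
      rewrite <- tech_pow_Rmult. nra. }
  assert (Hsmall : forall e, 0 < e -> exists n, Cmod (u n - p) < e /\ Cmod (u (S n) - p) < e).
  { intros e He. set (A := (rho + 1) / (1 - q)).
    assert (HA : 0 < A) by (apply Rdiv_lt_0_compat; lra).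
    destruct (pow_lt_1_zero q) with (y := e / A) as [N HN];
      [rewrite Rabs_pos_eq; lra | now apply Rdiv_lt_0_compat | ].
    assert (Hk : forall k, (N <= k)%nat -> Cmod (u k - p) < e).
    { intros k Hk. specialize (HN k Hk). rewrite Rabs_pos_eq in HN by (apply pow_le; lra).
      apply (Rmult_lt_compat_r A) in HN; [|assumption].
      unfold Rdiv at 1 in HN. rewrite Rmult_assoc, Rinv_l, Rmult_1_r in HN by lra.
      eapply Rle_lt_trans; [apply Hp|]. eapply Rle_lt_trans; [|apply HN].
      unfold A, Rdiv. rewrite <- Rmult_assoc. apply Rmult_le_compat_r.
      - left. apply Rinv_0_lt_compat. lra.
      - assert (0 <= q ^ k) by (apply pow_le; lra). nra. }
    exists N. split; apply Hk; lia. }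
  assert (Hpr : Cmod p <= rho).
  { apply le_epsilon. intros e He. destruct (Hsmall e He) as (n & H1 & _).
    pose proof (Cmod_sub_ge p (u n)) as H2. rewrite Cmod_minus_sym in H2. specialize (Hu n). lra. }
  exists p. split; [assumption|].
  apply Ceq_of_Cmod. apply Rle_antisym; [|apply Cmod_ge_0]. apply le_epsilon. intros e He.
  destruct (Hsmall (e / 2)) as (n & H1 & H2); [lra|].
  replace (T p - p)%C with ((u (S n) - p) - (T (u n) - T p))%C by (unfold u; simpl; ring).
  eapply Rle_trans; [apply Cmod_sub_le|].
  pose proof (Hlip (u n) p (Hu n) Hpr). pose proof (Cmod_ge_0 (u n - p)). nra.
Qed.

(** [q] is the difference quotient of [Psi] at [0], and [h] its primitive. Continuity of [q] at [0]
    is retained in order to extend bounds found away from [0]. *)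
Lemma log_derivative_primitive Psi :
  analytic_on (disc 1) Psi -> Psi 0 = 1 ->
  exists h q : C -> C, h 0 = 0 /\
    (forall z, Cmod z < 1 -> cderiv h z (q z)) /\
    (forall z, (q z * z = Psi z - 1)%C) /\ ccont q 0.
Proof.
  intros HP H0.
  destruct (analytic_cderiv _ _ 0 HP) as [l Hl]; [unfold disc; rewrite Cmod_0; lra|].
  destruct (diff_quot_primitive Psi 1 0 l HP) as [H HH]; [rewrite Cmod_0; lra | assumption |].
  exists (fun z => H z - H 0)%C, (diff_quot Psi 0 l).
  split; [ring|]. split; [|split].
  - intros z Hz. eapply cderiv_eq; [apply cderiv_minus; [now apply HH | apply cderiv_const]|]. ring.
  - intros z. rewrite <- H0, <- (diff_quot_mul Psi 0 l). ring.
  - now apply diff_quot_ccont.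
Qed.

(** * A function with prescribed logarithmic derivative, and its inverse *)

Section Construction.

Variables (Psi h q : C -> C).
Hypothesis h_0 : h 0 = 0.
Hypothesis h_deriv : forall z, Cmod z < 1 -> cderiv h z (q z).
Hypothesis q_Psi : forall z, (q z * z = Psi z - 1)%C.

Let f (z : C) : C := (z * Cexp (h z))%C.

Lemma starlike_cderiv z : Cmod z < 1 -> cderiv f z (Cexp (h z) * Psi z)%C.
Proof.
  intros Hz. unfold f. eapply cderiv_eq.
  - apply (cderiv_mult (fun z => z) (fun z => Cexp (h z))); [apply cderiv_id|].
    apply cderiv_comp; [apply cderiv_Cexp | now apply h_deriv].
  - cbv beta. replace (Psi z) with (q z * z + 1)%C by (rewrite q_Psi; ring). ring.
Qed.

Lemma starlike_class_A : Psi 0 = 1 -> class_A f.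
Proof.
  intros H0. split; [|split].
  - intros z Hz. eexists. now apply starlike_cderiv.
  - unfold f. ring.
  - apply is_C_derive_unique. eapply cderiv_eq.
    + apply starlike_cderiv. rewrite Cmod_0. lra.
    + rewrite h_0, H0, Cexp_0. ring.
Qed.

Lemma starlike_quotient_eq z : Psi 0 = 1 -> Cmod z < 1 -> starlike_quotient f z = Psi z.
Proof.
  intros H0 Hz. unfold starlike_quotient. destruct (Ceq_dec z 0) as [->|Hne]; [now symmetry|].
  rewrite (is_C_derive_unique _ _ _ (starlike_cderiv z Hz)). unfold f. field.
  split; [apply Cexp_neq_0 | assumption].
Qed.

(** The first bound gives |exp (- h)| <= 2, so multiplication by |w| < 1/4 stays within radius 1/2.
    With the second, exp (- h) has Lipschitz constant 2 * 49/25, and the contraction factor is a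
    quarter of it, 49/50. *)
Hypothesis h_bound : forall z, Cmod z <= 1 / 2 -> Cmod (h z) <= 133 / 200.
Hypothesis q_bound : forall z, Cmod z <= 1 / 2 -> Cmod (q z) <= 49 / 25.
Hypothesis Psi_neq_0 : forall z, Cmod z < 1 -> Psi z <> 0.

Let E (z : C) : C := Cexp (- h z)%C.

Lemma inv_exp_bound z : Cmod z <= 1 / 2 -> Cmod (E z) <= 2.
Proof.
  intros Hz. unfold E. rewrite Cmod_Cexp. eapply Rle_trans; [|apply exp_665].
  pose proof (h_bound z Hz) as Hb. pose proof (re_le_Cmod (- h z)) as Hr.
  rewrite Cmod_opp in Hr. apply Rabs_le_between in Hr.
  assert (Hle : Re (- h z) <= 133 / 200) by lra.
  destruct Hle as [Hle|Hle]; [left; now apply exp_increasing | rewrite Hle; lra].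
Qed.

Lemma inv_exp_lip y z :
  Cmod y <= 1 / 2 -> Cmod z <= 1 / 2 -> Cmod (E y - E z) <= 98 / 25 * Cmod (y - z).
Proof.
  intros Hy Hz.
  assert (Hp : forall t, 0 <= t <= 1 -> Cmod (pt z y t) <= 1 / 2) by (intros; now apply Cmod_pt_le).
  assert (HE : forall x, Cmod x < 1 -> cderiv E x (E x * - q x)%C).
  { intros x Hx. unfold E. apply (cderiv_comp Cexp (fun x => - h x)%C); [apply cderiv_Cexp|].
    apply cderiv_opp. now apply h_deriv. }
  pose proof (Cmean_value_ineq E (fun t => E (pt z y t) * - q (pt z y t))%C
    (fun t => 98 / 25 * Cmod (y - z) * t) (fun _ => 98 / 25 * Cmod (y - z)) z y) as H.
  cbv beta in H. rewrite Rmult_1_r, Rmult_0_r, Rminus_0_r in H. apply H.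
  - intros t Ht. eapply cderiv_ccont, HE. specialize (Hp t Ht). lra.
  - intros t Ht. apply HE. specialize (Hp t ltac:(lra)). lra.
  - intros t Ht. auto_derive; auto; ring.
  - intros t Ht. specialize (Hp t ltac:(lra)).
    rewrite Cmod_mult. apply Rmult_le_compat_r; [apply Cmod_ge_0|].
    rewrite Cmod_mult, Cmod_opp.
    pose proof (inv_exp_bound _ Hp). pose proof (q_bound _ Hp).
    pose proof (Cmod_ge_0 (E (pt z y t))). pose proof (Cmod_ge_0 (q (pt z y t))). nra.
Qed.

(** The condition on [w] stands under the existential quantifier so that choice yields a total
    function. *)
Lemma inverse_exists w : exists z, Cmod w < 1 / 4 -> Cmod z <= 1 / 2 /\ (w * E z)%C = z.
Proof.
  destruct (Rlt_dec (Cmod w) (1 / 4)) as [Hw|Hw]; [|exists 0; lra].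
  pose proof (Cmod_ge_0 w) as Hw0.
  destruct (contraction_fixpoint (fun z => w * E z)%C (1 / 2) (49 / 50)) as (p & Hp & HT).
  - lra.
  - lra.
  - intros z Hz. rewrite Cmod_mult. pose proof (inv_exp_bound z Hz).
    pose proof (Cmod_ge_0 (E z)). nra.
  - intros y z Hy Hz. replace (w * E y - w * E z)%C with (w * (E y - E z))%C by ring.
    rewrite Cmod_mult. pose proof (inv_exp_lip y z Hy Hz).
    pose proof (Cmod_ge_0 (E y - E z)). pose proof (Cmod_ge_0 (y - z)). nra.
  - exists p. intros _. now split.
Qed.

Theorem inverse_log_coeffs_exist : exists Gamma, inverse_log_coeffs f Gamma.
Proof.
  set (g := fun w => proj1_sig (constructive_indefinite_description _ (inverse_exists w))).
  assert (Hg : forall w, Cmod w < 1 / 4 -> Cmod (g w) <= 1 / 2 /\ (w * E (g w))%C = g w)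
    by (intros w; exact (proj2_sig (constructive_indefinite_description _ (inverse_exists w)))).
  clearbody g.
  assert (HEh : forall z, (E z * Cexp (h z) = 1)%C) by (intros z; apply Cexp_neg).
  assert (Hfg : forall w, Cmod w < 1 / 4 -> f (g w) = w).
  { intros w Hw. destruct (Hg w Hw) as [_ Hgw]. unfold f. rewrite <- Hgw at 1.
    rewrite <- Cmult_assoc, HEh. ring. }
  (* Subtracting two fixed point equations gives |g v - g w| <= 2 |v - w| + 49/50 |g v - g w|, hence
     a Lipschitz constant 100, for which [e / 101] is small enough. *)
  assert (Hcont : forall w, Cmod w < 1 / 4 -> ccont g w).
  { intros w Hw e He. exists (Rmin (1 / 4 - Cmod w) (e / 101)). split; [apply Rmin_pos; lra|].
    intros v Hv.
    assert (Hv1 : Cmod (v - w) < 1 / 4 - Cmod w) by (eapply Rlt_le_trans; [apply Hv | apply Rmin_l]).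
    assert (Hv2 : Cmod (v - w) < e / 101) by (eapply Rlt_le_trans; [apply Hv | apply Rmin_r]).
    pose proof (Cmod_sub_ge v w).
    destruct (Hg w Hw) as [Hw1 Hw2]. destruct (Hg v ltac:(lra)) as [Hv3 Hv4].
    assert (Hd : Cmod (g v - g w) <= 2 * Cmod (v - w) + 49 / 50 * Cmod (g v - g w)).
    { rewrite <- Hv4 at 1. rewrite <- Hw2 at 1.
      replace (v * E (g v) - w * E (g w))%C with ((v - w) * E (g v) + w * (E (g v) - E (g w)))%C by ring.
      eapply Rle_trans; [apply Cmod_triangle|]. rewrite !Cmod_mult.
      pose proof (inv_exp_bound _ Hv3). pose proof (inv_exp_lip _ _ Hv3 Hw1).
      pose proof (Cmod_ge_0 w). pose proof (Cmod_ge_0 (v - w)).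
      pose proof (Cmod_ge_0 (E (g v) - E (g w))). pose proof (Cmod_ge_0 (g v - g w)). nra. }
    lra. }
  assert (Hder : forall w, Cmod w < 1 / 4 -> exists l, cderiv g w l).
  { intros w Hw. destruct (Hg w Hw) as [Hw1 _]. eexists.
    apply (cderiv_inverse f g w (Cexp (h (g w)) * Psi (g w))%C (1 / 4 - Cmod w)); [lra | | now apply Hcont | |].
    - intros u Hu. apply Hfg. pose proof (Cmod_sub_ge u w). lra.
    - apply starlike_cderiv. lra.
    - apply Cmult_neq_0; [apply Cexp_neq_0 | apply Psi_neq_0; lra]. }
  (* The fixed point equation [g w = w * Cexp (- h (g w))] exhibits the required branch of the
     logarithm. *)
  set (L := fun w => (- h (g w))%C).
  assert (HLan : analytic_on (disc (1 / 4)) L).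
  { intros w Hw. destruct (Hder w Hw) as [l Hl]. destruct (Hg w Hw) as [Hw1 _].
    eexists. apply cderiv_opp. apply (cderiv_comp h g); [apply h_deriv; lra | apply Hl]. }
  assert (Hg0 : g 0 = 0).
  { destruct (Hg 0) as [_ H0]; [rewrite Cmod_0; lra|]. rewrite <- H0. ring. }
  assert (HL0 : L 0 = 0) by (unfold L; rewrite Hg0, h_0; ring).
  destruct (Taylor_series L (1 / 4) ltac:(lra) HLan) as (a & Ha & HS).
  assert (Ha0 : a 0%nat = 0).
  { rewrite <- HL0. symmetry. eapply jet2_value, expands_jet2, Ha. }
  exists (fun n => a n / 2)%C, g, L. split; [|split; [split; [|split]|]].
  - intros w Hw. destruct (Hg w Hw) as [Hw1 _]. split; [unfold disc; lra | now apply Hfg].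
  - exact HLan.
  - exact HL0.
  - intros w Hw Hw0. destruct (Hg w Hw) as [_ Hgw]. rewrite <- Hgw. unfold L, E. field. assumption.
  - intros w Hw. specialize (HS w Hw).
    apply (is_series_ext (K := C_AbsRing) (V := C_NormedModule) (fun k => a (S k) * w ^ S k)%C).
    + intros n. change ((a (S n) * w ^ S n)%C = (2 * (a (S n) / 2 * w ^ S n))%C). field.
    + apply (is_series_incr_1 (K := C_AbsRing) (V := C_NormedModule) (fun k => a k * w ^ k)%C).
      match goal with |- is_series _ ?l => replace l with (L w) end; [exact HS|].
      change (L w = (L w + a 0%nat * w ^ 0)%C). rewrite Ha0. ring.
Qed.

End Construction.

Theorem class_S_AP_exists om :
  schwarz_function om ->
  (forall z, Cmod z <= 1 / 2 -> Cmod (om z) <= Cmod z * (11 / 20 + 7 / 10 * Cmod z)) ->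
  exists f Gamma, class_S_AP f /\ inverse_log_coeffs f Gamma /\
    forall z, disc 1 z -> starlike_quotient f z = psi_AP (om z).
Proof.
  intros Hom Hsmall. pose proof Hom as (Han & H0 & Hb).
  set (Psi := fun z => psi_AP (om z)).
  assert (HP0 : Psi 0 = 1) by (unfold Psi; rewrite H0; apply psi_AP_0).
  assert (HPan : analytic_on (disc 1) Psi).
  { intros z Hz. destruct (Han z Hz) as [l Hl]. eexists.
    apply (cderiv_comp psi_AP om); [apply cderiv_psi_AP; now apply Hb | exact Hl]. }
  destruct (log_derivative_primitive Psi HPan HP0) as (h & q & Hh0 & Hh & Hq & Hqc).
  (* [B t = 3/2 (V + V^2) / t] for [V = t (11/20 + 7/10 t)], the bound on [om]. *)
  set (B := fun t => 33 / 40 + 1203 / 800 * t + 231 / 200 * t ^ 2 + 147 / 200 * t ^ 3).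
  assert (HB : forall z, Cmod z <= 1 / 2 -> z <> 0 -> Cmod (q z) <= B (Cmod z)).
  { intros z Hz Hz0. apply Cmod_gt_0 in Hz0.
    apply (Rmult_le_reg_r (Cmod z)); [assumption|]. rewrite <- Cmod_mult, Hq. unfold Psi.
    specialize (Hsmall z Hz). set (t := Cmod z) in *. set (U := Cmod (om z)) in *.
    assert (HU : U <= 9 / 20) by nra.
    eapply Rle_trans; [apply psi_AP_sub_1; exact HU|]. fold U.
    assert (0 <= U) by apply Cmod_ge_0.
    set (V := t * (11 / 20 + 7 / 10 * t)) in *.
    apply Rle_trans with (3 / 2 * (V + V ^ 2)); [simpl; nra|].
    right. unfold V, B. field. }
  assert (HB2 : forall t, 0 <= t <= 1 / 2 -> B t <= 979 / 500).
  { intros t Ht. unfold B.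
    assert (t ^ 2 <= 1 / 4) by (simpl; nra). assert (t ^ 3 <= 1 / 8) by (simpl; nra). lra. }
  assert (Hqb : forall z, Cmod z <= 1 / 2 -> Cmod (q z) <= 49 / 25).
  { intros z Hz. destruct (Ceq_dec z 0) as [->|Hz0].
    (* At the origin the bound is obtained by continuity from nearby points; 1/500 is the gap
       between 979/500 and 49/25. *)
    - destruct (Hqc (1 / 500)) as [d [Hd H1]]; [lra|].
      set (t := Rmin (d / 2) (1 / 2)).
      assert (Ht : 0 < t <= 1 / 2) by (split; [apply Rmin_pos; lra | apply Rmin_r]).
      assert (Htd : t <= d / 2) by apply Rmin_l.
      assert (Hm : Cmod t = t) by (rewrite Cmod_R, Rabs_pos_eq; lra).
      specialize (H1 t). replace (t - 0)%C with (RtoC t) in H1 by ring. rewrite Hm in H1.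
      specialize (H1 ltac:(lra)).
      pose proof (HB t) as H2. rewrite Hm in H2.
      specialize (H2 (proj2 Ht)). specialize (H2 ltac:(intros E; apply RtoC_inj in E; lra)).
      pose proof (HB2 t ltac:(lra)). pose proof (Cmod_sub_ge (q 0) (q t)) as H3.
      rewrite Cmod_minus_sym in H3. lra.
    - pose proof (Cmod_ge_0 z). pose proof (HB z Hz Hz0). pose proof (HB2 (Cmod z) ltac:(lra)). lra. }
  assert (Hhb : forall z, Cmod z <= 1 / 2 -> Cmod (h z) <= 133 / 200).
  { intros z Hz. destruct (Ceq_dec z 0) as [->|Hz0]; [rewrite Hh0, Cmod_0; lra|].
    apply Cmod_gt_0 in Hz0. set (r := Cmod z) in *.
    (* The majorant is the primitive of [B (r * t) * r] in [t]. Its value for [r = 1 / 2] at [t = 1]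
       is about 0.6601, just below 133/200; a constant bound on [q] would give only 0.98. *)
    pose proof (Cmean_value_ineq h (fun t => q (pt 0 z t))
      (fun t => 33 / 40 * (r * t) + 1203 / 1600 * (r * t) ^ 2 + 77 / 200 * (r * t) ^ 3 + 147 / 800 * (r * t) ^ 4)
      (fun t => B (r * t) * r) 0 z) as H.
    cbv beta in H. rewrite Hh0 in H. replace (h z - 0)%C with (h z) in H by ring.
    assert (Hpt : forall t, 0 <= t -> pt 0 z t = (RtoC t * z)%C /\ Cmod (pt 0 z t) = r * t).
    { intros t Ht. assert (E : pt 0 z t = (RtoC t * z)%C) by (unfold pt; ring).
      split; [exact E|]. rewrite E, Cmod_mult, Cmod_R, Rabs_pos_eq by lra. unfold r. ring. }
    eapply Rle_trans; [apply H|].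
    - intros t Ht. eapply cderiv_ccont, Hh. rewrite (proj2 (Hpt t (proj1 Ht))). nra.
    - intros t Ht. apply Hh. rewrite (proj2 (Hpt t ltac:(lra))). nra.
    - intros t Ht. unfold B. auto_derive; auto. field.
    - intros t Ht. rewrite Cmod_mult. replace (z - 0)%C with z by ring. fold r.
      destruct (Hpt t ltac:(lra)) as [_ E2].
      apply Rmult_le_compat_r; [lra|]. rewrite <- E2. apply HB.
      + rewrite E2. nra.
      + apply Cmod_gt_0. rewrite E2. nra.
    - rewrite Rmult_1_r, Rmult_0_r.
      assert (r ^ 2 <= 1 / 4) by (simpl; nra). assert (r ^ 3 <= 1 / 8) by (simpl; nra).
      assert (r ^ 4 <= 1 / 16) by (replace (r ^ 4) with (r ^ 2 * r ^ 2) by ring; pose proof (pow2_ge_0 r); nra).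
      simpl (0 ^ _). lra. }
  assert (HPn : forall z, Cmod z < 1 -> Psi z <> 0) by (intros z Hz; now apply psi_AP_neq_0, Hb).
  destruct (inverse_log_coeffs_exist Psi h q Hh0 Hh Hq Hhb Hqb HPn) as [Gamma HG].
  assert (HE : forall z, disc 1 z -> starlike_quotient (fun z => z * Cexp (h z))%C z = psi_AP (om z)).
  { intros z Hz. now apply (starlike_quotient_eq Psi h q). }
  exists (fun z => z * Cexp (h z))%C, Gamma. split; [split|split].
  - now apply (starlike_class_A Psi h q).
  - exists om. split; assumption.
  - exact HG.
  - exact HE.
Qed.

Theorem extremal_exists om c1 c2 :
  schwarz_function om ->
  (forall z, Cmod z <= 1 / 2 -> Cmod (om z) <= Cmod z * (11 / 20 + 7 / 10 * Cmod z)) ->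
  jet2 om 0 c1 c2 ->
  exists f Gamma, class_S_AP f /\ inverse_log_coeffs f Gamma /\
    Cmod (Gamma 2%nat) - Cmod (Gamma 1%nat)
      = Cmod (29 / 32 * c1 ^ 2 - 3 / 8 * c2) - Cmod (- (3 / 4) * c1).
Proof.
  intros Hom Hs Hj. destruct (class_S_AP_exists om Hom Hs) as (f & Gamma & Hf & HG & HQ).
  exists f, Gamma. split; [assumption|]. split; [assumption|].
  destruct (inverse_log_coeffs_formula f om Gamma c1 c2 (proj1 Hf) Hom HQ HG Hj) as [-> ->].
  reflexivity.
Qed.

(** * The extremal Schwarz functions and the theorem *)

Definition blaschke (x z : C) : C := (z * ((z + x) / (1 + x * z)))%C.

Lemma blaschke_denom (x : R) (z : C) : 0 <= x < 1 -> Cmod z < 1 -> (1 + x * z)%C <> 0.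
Proof.
  intros Hx Hz. apply Cmod_gt_0.
  pose proof (Cmod_sub_ge 1 (- (x * z))) as H. rewrite Cmod_1, Cmod_opp, Cmod_mult, Cmod_R, Rabs_pos_eq in H by lra.
  replace (1 - - (x * z))%C with (1 + x * z)%C in H by ring. pose proof (Cmod_ge_0 z). nra.
Qed.

(** With denominators cleared and both sides squared, they differ by 2 x (1 - x^2) (1 - t^2) (t - Re
    z), where t = |z|: on a circle about [0] the modulus is greatest at the positive point. *)
Lemma blaschke_bound (x : R) (z : C) :
  0 <= x < 1 -> Cmod z < 1 ->
  Cmod ((z + x) / (1 + x * z)) <= (x + Cmod z) / (1 + x * Cmod z).
Proof.
  intros Hx Hz. pose proof (blaschke_denom x z Hx Hz) as Hd. pose proof (Cmod_ge_0 z) as Hz0.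
  rewrite Cmod_div by assumption. apply Cmod_gt_0 in Hd.
  apply Rle_div_l; [assumption|].
  unfold Rdiv. rewrite Rmult_assoc, (Rmult_comm (/ _)), <- Rmult_assoc. apply Rle_div_r; [nra|].
  apply Rsqr_incr_0_var.
  2: { apply Rmult_le_pos; [lra|lra]. }
  rewrite !Rsqr_mult, !Rsqr_pow2, !Cmod2_alt.
  set (t := Cmod z) in *.
  assert (Ht : t ^ 2 = Re z ^ 2 + Im z ^ 2) by apply Cmod2_alt.
  assert (Ha : Re z <= t).
  { pose proof (re_le_Cmod z) as Hr. apply Rabs_le_between in Hr. unfold t. lra. }
  replace (Re (z + x)) with (Re z + x) by (unfold Re; simpl; ring).
  replace (Im (z + x)) with (Im z) by (unfold Im; simpl; ring).
  replace (Re (1 + x * z)) with (1 + x * Re z) by (unfold Re, Im; simpl; ring).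
  replace (Im (1 + x * z)) with (x * Im z) by (unfold Re, Im; simpl; ring).
  set (a := Re z) in *. set (b := Im z) in *.
  assert (Hb : b ^ 2 = t ^ 2 - a ^ 2) by lra.
  assert (Hk : 0 <= 2 * x * (1 - x ^ 2) * (1 - t ^ 2) * (t - a)).
  { repeat apply Rmult_le_pos; try lra; simpl; nra. }
  assert (Hid : (x + t) ^ 2 * ((1 + x * a) ^ 2 + (x * b) ^ 2) - ((a + x) ^ 2 + b ^ 2) * (1 + x * t) ^ 2
     = 2 * x * (1 - x ^ 2) * (1 - t ^ 2) * (t - a)).
  { rewrite Rpow_mult_distr, Hb. ring. }
  lra.
Qed.

Lemma blaschke_schwarz (x : R) : 0 <= x < 1 -> schwarz_function (blaschke x).
Proof.
  intros Hx. split; [|split].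
  - intros z Hz. pose proof (blaschke_denom x z Hx Hz) as Hd. eexists.
    apply (cderiv_mult (fun z => z) (fun z => (z + x) / (1 + x * z))%C); [apply cderiv_id|].
    apply cderiv_div; [| | assumption].
    + apply cderiv_plus; [apply cderiv_id | apply cderiv_const].
    + apply cderiv_plus; [apply cderiv_const|].
      apply cderiv_mult; [apply cderiv_const | apply cderiv_id].
  - unfold blaschke. ring.
  - intros z Hz. unfold blaschke. rewrite Cmod_mult. unfold disc in Hz.
    pose proof (blaschke_bound x z Hx Hz) as Hb. pose proof (Cmod_ge_0 z).
    assert ((x + Cmod z) / (1 + x * Cmod z) <= 1) by (apply Rle_div_l; nra).
    pose proof (Cmod_ge_0 ((z + x) / (1 + x * z))). nra.
Qed.

(** These coefficients realize equality in |c2| <= 1 - |c1|^2. The remainder is exactly - (1 - x^2)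
    x z^3 / (1 + x z). *)
Lemma blaschke_jet2 (x : R) : 0 <= x < 1 -> jet2 (blaschke x) 0 x (1 - x ^ 2)%C.
Proof.
  intros Hx. apply (jet2_intro _ _ _ _ 2 (1 / 2)); [lra|]. intros z Hz.
  pose proof (blaschke_denom x z Hx ltac:(lra)) as Hd.
  replace (blaschke x z - (0 + x * z + (1 - x ^ 2) * z ^ 2))%C
    with (- (RtoC ((1 - x ^ 2) * x) * z ^ 3) / (1 + x * z))%C.
  2: { unfold blaschke. rewrite RtoC_mult, RtoC_minus, RtoC_pow. field. assumption. }
  rewrite Cmod_div, Cmod_opp, Cmod_mult, Cmod_R, Cmod_pow by assumption.
  assert (Hh : 1 / 2 <= Cmod (1 + x * z)).
  { pose proof (Cmod_sub_ge 1 (- (x * z))) as H. rewrite Cmod_1, Cmod_opp, Cmod_mult, Cmod_R, Rabs_pos_eq in H by lra.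
    replace (1 - - (x * z))%C with (1 + x * z)%C in H by ring. pose proof (Cmod_ge_0 z). nra. }
  apply Rle_div_l; [lra|].
  assert (HR : 0 <= (1 - x ^ 2) * x <= 1).
  { simpl. split; [apply Rmult_le_pos; nra | nra]. }
  rewrite Rabs_pos_eq by lra.
  assert (0 <= Cmod z ^ 3) by (apply pow_le, Cmod_ge_0). nra.
Qed.

Theorem theorem4p1 :
  (forall (f : C -> C) (Gamma : nat -> C),
      class_S_AP f -> inverse_log_coeffs f Gamma ->
      - (3 * sqrt 3 / (2 * sqrt 41)) <= Cmod (Gamma 2%nat) - Cmod (Gamma 1%nat)
      /\ Cmod (Gamma 2%nat) - Cmod (Gamma 1%nat) <= 3 / 8)
  /\ (exists (f : C -> C) (Gamma : nat -> C),
        class_S_AP f /\ inverse_log_coeffs f Gamma /\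
        Cmod (Gamma 2%nat) - Cmod (Gamma 1%nat)
          = - (3 * sqrt 3 / (2 * sqrt 41)))
  /\ (exists (f : C -> C) (Gamma : nat -> C),
        class_S_AP f /\ inverse_log_coeffs f Gamma /\
        Cmod (Gamma 2%nat) - Cmod (Gamma 1%nat) = 3 / 8).
Proof.
  split; [|split].
  - intros f Gamma [Hf (om & Hom & HQ)] HG.
    destruct (schwarz_coeffs om Hom) as (c1 & c2 & Hj & Hc).
    destruct (inverse_log_coeffs_formula f om Gamma c1 c2 Hf Hom HQ HG Hj) as [-> ->].
    now apply coefficient_bounds.
  - destruct critical_point as (Hx0 & Hx2 & ->).
    set (x := 2 * (sqrt 3 / sqrt 41)) in *. clearbody x.
    assert (Hx : 0 <= x < 1) by nra.
    destruct (extremal_exists (blaschke x) x (1 - x ^ 2)%C) as (f & Gamma & Hf & HG & E).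
    + now apply blaschke_schwarz.
    + intros z Hz. unfold blaschke. rewrite Cmod_mult. pose proof (Cmod_ge_0 z).
      apply Rmult_le_compat_l; [assumption|].
      eapply Rle_trans; [apply blaschke_bound; [assumption | lra]|].
      apply Rle_div_l; [nra|].
      (* A rational bound just above the square root of 12/41, about 0.5410, which leaves a
         polynomial inequality. *)
      assert (x <= 5415 / 10000) by nra. nra.
    + now apply blaschke_jet2.
    + exists f, Gamma. split; [assumption|]. split; [assumption|]. rewrite E.
      rewrite <- RtoC_pow, Hx2, <- RtoC_minus, <- !RtoC_div, <- !RtoC_mult, <- RtoC_opp,
        <- RtoC_mult, <- RtoC_minus, !Cmod_R by lra.
      (* [Gamma 2] vanishes for this [x], so the difference of moduli is - |Gamma 1|. *)
      replace (29 / 32 * (12 / 41) - 3 / 8 * (1 - 12 / 41)) with 0 by field.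
      rewrite Rabs_R0. replace (- (3 / 4) * x) with (- (3 / 4 * x)) by ring.
      rewrite Rabs_Ropp, Rabs_pos_eq by lra. ring.
  (* On the disc [blaschke 0 z] is [z ^ 2]: here [Gamma 1] vanishes and |Gamma 2| is 3/8. *)
  - destruct (extremal_exists (blaschke 0) 0 1) as (f & Gamma & Hf & HG & E).
    + apply blaschke_schwarz. lra.
    + intros z Hz. unfold blaschke. rewrite Cmod_mult. pose proof (Cmod_ge_0 z).
      pose proof (blaschke_denom 0 z ltac:(lra) ltac:(lra)) as Hd.
      replace (z + 0)%C with (z * (1 + 0 * z))%C by ring.
      unfold Cdiv. rewrite <- Cmult_assoc, Cinv_r, Cmult_1_r by assumption.
      nra.
    + eapply jet2_eq; [apply (blaschke_jet2 0); lra | reflexivity | reflexivity | ring].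
    + exists f, Gamma. split; [assumption|]. split; [assumption|]. rewrite E.
      replace (29 / 32 * 0 ^ 2 - 3 / 8 * 1)%C with (RtoC (- (3 / 8)))
        by (rewrite RtoC_opp, RtoC_div by lra; ring).
      replace (- (3 / 4) * 0)%C with (RtoC 0) by ring.
      rewrite !Cmod_R, Rabs_Ropp, Rabs_R0, Rabs_pos_eq; lra.
Qed.
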